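(* (One-Block Estimate) Suppose the local jump rate $g$ of the mean zero zero range process (ZRP) is bounded, and let $\mu_0^N\in\mathbb{P}\mathbb{M}_N^d$, $N\in\mathbb{N}$, be any sequence of initial distributions satisfying the $O(N^d)$-entropy assumption $$C(\rho_* ):=\sup_{N\in\mathbb{N}}\frac{1}{N^d}H(\mu_0^N|\nu_{\rho_*}^N)<+\infty$$ for some (and thus for any) $\rho_*\in(0,\rho_c)$. Then for all $T>0$ and all $H\in C([0,T]\times\mathbb{T}^d)$, $$\lim_{\ell\to\infty}\limsup_{N\to\infty}\mathbb{E}^N\bigg|\int_0^T\frac{1}{N^d}\sum_{x\in\mathbb{T}_N^d}H\Big(t,\frac{x}{N}\Big)\Big[g(\eta_t(x))-\Phi\big(\eta_t^\ell(x)\wedge\rho_c\big)\Big]dt\bigg|=0,$$ where $\mathbb{E}^N$ denotes expectation with respect to the law of the diffusively accelerated ZRP (the Markov jump process $(\eta_t)_{t\ge0}$ with generator $N^2L^N$) started from $\mu_0^N$.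
   Context: Notation: $\mathbb{Z}_+=\{0,1,2,\dots\}$, $\mathbb{R}_+=[0,\infty)$, $a\wedge b=\min(a,b)$, $\mathbb{P}M$ is the set of Borel probability measures on a Polish space $M$, $\mathbb{T}^d=(\mathbb{R}/\mathbb{Z})^d$, $\mathbb{T}_N^d=(\mathbb{Z}/N\mathbb{Z})^d$, $\mathbb{M}_N^d=\{\eta:\mathbb{T}_N^d\to\mathbb{Z}_+\}$. $H(\mu|\nu)$ (for probability measures) is the relative entropy $\int\log\frac{d\mu}{d\nu}\,d\mu$ (equal to $+\infty$ if $\mu\not\ll\nu$). A local jump rate is a function $g:\mathbb{Z}_+\to\mathbb{R}_+$ with (a) $g(k)=0\iff k=0$; (b) $\|g'\|_\infty:=\sup_k|g(k+1)-g(k)|<\infty$; (c) $\varphi_c:=\liminf_{k\to\infty}\sqrt[k]{g!(k)}>0$, where $g!(0)=1$, $g!(k)=g(1)\cdots g(k)$. An elementary step distribution is a probability $p$ on $\mathbb{Z}^d$ with bounded support such that every $z\in\mathbb{Z}^d$ is a finite sum of elements of the support. Here $p$ has mean zero: $\sum_z z\,p(z)=0$. The ZRP on $\mathbb{T}_N^d$ is the Markov jump process on $\mathbb{M}_N^d$ with generator $L^Nf(\eta)=\sum_{x,y\in\mathbb{T}_N^d}\{f(\eta^{x,y})-f(\eta)\}g(\eta_x)p(y-x)$, where $\eta^{x,y}$ is obtained from $\eta$ by moving one particle from $x$ to $y$ (and $p(y-x)$ is understood as the sum of $p(z)$ over $z\equiv y-x$ mod $N$). Let $Z(\varphi)=\sum_{k\ge0}\varphi^k/g!(k)$,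 whose radius of convergence is $\varphi_c$, and $\mathcal{D}_Z=\{\varphi\ge0: Z(\varphi)<\infty\}$. For $\varphi\in\mathcal{D}_Z$ let $\bar\nu^1_\varphi\{k\}=\frac{1}{Z(\varphi)}\frac{\varphi^k}{g!(k)}$, $k\in\mathbb{Z}_+$, and let $\bar\nu^N_\varphi$ be the product measure on $\mathbb{M}_N^d$ with all one-site marginals equal to $\bar\nu^1_\varphi$. The mean density function $R(\varphi)=\int k\,d\bar\nu^1_\varphi(k)$ is continuous on $\mathcal{D}_Z$ and strictly increasing and $C^\infty$ on $[0,\varphi_c)$; the critical density is $\rho_c=\lim_{\varphi\uparrow\varphi_c}R(\varphi)\in(0,\infty]$. Put $\Phi=R^{-1}$ and $\nu^N_\rho=\bar\nu^N_{\Phi(\rho)}$ for $\rho\in R(\mathcal{D}_Z)$. When $\rho_c<\infty$, one has $\varphi_c\in\mathcal{D}_Z$ and $\Phi(\rho_c)=\varphi_c$. For $\eta\in\mathbb{M}_N^d$ and $\ell\in\mathbb{Z}_+$, $\eta^\ell(x)=\frac{1}{(2\ell+1)^d}\sum_{y\in\mathbb{T}_N^d:\,|y-x|\le\ell}\eta(y)$, with $|\cdot|$ the maximum norm (so the sum is over a box of side $2\ell+1$). *)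

(* Defs.v *)
From HB Require Import structures.
From mathcomp Require Import all_boot all_order all_algebra.
From mathcomp Require Import all_classical all_reals all_analysis.

Set Implicit Arguments.
Unset Strict Implicit.
Unset Printing Implicit Defensive.

Import Order.TTheory GRing.Theory Num.Theory.
Import numFieldNormedType.Exports.

Local Open Scope classical_set_scope.
Local Open Scope ring_scope.

Section jump_rates.
Context {R : realType}.

(* g!(k) = g(1) ... g(k) *)
Definition rate_fact (g : nat -> R) (k : nat) : R := \prod_(1 <= i < k.+1) g i.

(* liminf of the k-th root of g!(k); the term k = 0 is irrelevant *)
Definition phi_c (g : nat -> R) : \bar R :=
  limn_einf (fun k => (rate_fact g k `^ k%:R^-1)%:E).

Record jump_rate := JumpRate {
  rate :> nat -> R ;
  rate_ge0 : forall k, 0 <= rate k ;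
  rate_eq0 : forall k, rate k = 0 <-> k = 0%N ;
  rate_lip : has_ubound (range (fun k => `|rate k.+1 - rate k|)) ;
  rate_phi_c_gt0 : (0 < phi_c rate)%E }.

Lemma rate_fact_ge0 (g : jump_rate) k : 0 <= rate_fact g k.
Proof. by apply: prodr_ge0 => i _; exact: rate_ge0. Qed.

Definition partition_function (g : nat -> R) (phi : R) : \bar R :=
  (\sum_(0 <= k <oo) (phi ^+ k / rate_fact g k)%:E)%E.

Definition partition_domain (g : nat -> R) : set R :=
  [set phi | 0 <= phi /\ (partition_function g phi < +oo)%E].

Definition site_pmf (g : nat -> R) (phi : R) (k : nat) : R :=
  (fine (partition_function g phi))^-1 * (phi ^+ k / rate_fact g k).

(* The Dirac mass is a dummy value for fugacities outside the domain of Z. *)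
Definition site_measure (g : jump_rate) (phi : R) (U : set nat) : \bar R :=
  if `[< partition_domain g phi >]
  then (\esum_(k in U) (site_pmf g phi k)%:E)%E else \d_0%N U.

Section site_measure_probability.
Variables (g : jump_rate) (phi : R).

Let site_pmf_ge0 k : partition_domain g phi -> 0 <= site_pmf g phi k.
Proof.
move=> [phi0 _]; rewrite mulr_ge0 ?invr_ge0 ?divr_ge0 ?exprn_ge0 ?rate_fact_ge0//.
by apply/fine_ge0/nneseries_ge0 => i _ _;
  rewrite lee_fin divr_ge0 ?exprn_ge0 ?rate_fact_ge0.
Qed.

Let site_measure0 : site_measure g phi set0 = 0%E.
Proof.
by rewrite /site_measure measure0; case: asboolP => // _; rewrite esum_set0.
Qed.

Let site_measure_ge0 U : (0 <= site_measure g phi U)%E.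
Proof.
rewrite /site_measure; case: asboolP => // phiD.
by apply: esum_ge0 => k _; rewrite lee_fin site_pmf_ge0.
Qed.

Let site_measure_sigma_additive : semi_sigma_additive (site_measure g phi).
Proof.
move=> F mF tF mUF; rewrite /site_measure; case: asboolP => phiD; last first.
  exact: measure_semi_sigma_additive.
apply: cvg_toP.
  apply: ereal_nondecreasing_is_cvgn => a b ab.
  apply: lee_sum_nneg_natr => // n _ _.
  by apply: esum_ge0 => /= k _; rewrite lee_fin site_pmf_ge0.
by rewrite nneseries_sum_bigcup// => k; rewrite lee_fin site_pmf_ge0.
Qed.

HB.instance Definition _ := isMeasure.Build _ _ _ (site_measure g phi)
  site_measure0 site_measure_ge0 site_measure_sigma_additive.

Let site_measure_setT : site_measure g phi [set: nat] = 1%E.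
Proof.
rewrite /site_measure; case: asboolP => [phiD|_]; last exact: probability_setT.
have [phi0 Zoo] := phiD.
have w0 k : (0 <= (phi ^+ k / rate_fact g k)%:E)%E.
  by rewrite lee_fin divr_ge0 ?exprn_ge0 ?rate_fact_ge0.
have Z1 : (1 <= partition_function g phi)%E.
  rewrite /partition_function (@nneseriesD1 _ _ 0%N)//=.
  rewrite expr0 /rate_fact big_geq// invr1 mulr1 leeDl//.
  by apply: nneseries_ge0.
have Zfin : partition_function g phi \is a fin_num.
  by rewrite ge0_fin_numE// (le_trans _ Z1).
rewrite -nneseries_esumT => [|k]; last by rewrite lee_fin site_pmf_ge0.
rewrite /site_pmf; under eq_eseriesr do rewrite EFinM.
rewrite nneseriesZl//.
rewrite -/(partition_function g phi) -{2}(fineK Zfin) -EFinM mulVf//.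
by rewrite fine_eq0// gt_eqF// (lt_le_trans _ Z1).
Qed.

HB.instance Definition _ :=
  @Measure_isProbability.Build _ _ R (site_measure g phi) site_measure_setT.

End site_measure_probability.

Definition mean_density (g : jump_rate) (phi : R) : \bar R :=
  (\int[site_measure g phi]_k (k%:R)%:E)%E.

(* left limit at phi_c, which may be infinite *)
Definition rho_c (g : jump_rate) : \bar R :=
  lim (mean_density g (fine phi) @[phi --> within [set phi | phi < phi_c g]%E
                                             (nbhs (phi_c g))]).

(* The inverse of the mean density function on its domain; the default 0 is only
   taken outside of its range. *)
Definition Phi (g : jump_rate) (rho : R) : R :=
  xget 0 [set phi | partition_domain g phi /\ mean_density g phi = rho%:E].

End jump_rates.
Arguments jump_rate : clear implicits.

(* (Z/NZ)^d, represented by {0, ..., N - 1}^d *)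
Definition torus (d N : nat) : finType := 'rV['I_N]_d.

Definition config (I : finType) := {ffun I -> nat}.

HB.instance Definition _ (I : finType) := Countable.on (config I).
HB.instance Definition _ (I : finType) :=
  isPointed.Build (config I) [ffun=> 0%N].
HB.instance Definition _ (I : finType) :=
  @isMeasurable.Build default_measure_display (config I)
    discrete_measurable discrete_measurable0
    discrete_measurableC discrete_measurableU.

Definition iid_measure {R : realType} (I : finType) (nu : probability nat R)
    (A : set (config I)) : \bar R :=
  (\esum_(eta in A) (\prod_(x : I) fine (nu [set eta x]))%:E)%E.

Section iid_measure_probability.
Context {R : realType} (I : finType) (nu : probability nat R).
Local Notation P := (@iid_measure R I nu).
Local Notation q k := (fine (nu [set k])).

Let q_ge0 k : 0 <= q k. Proof. exact: fine_ge0. Qed.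

Let w_ge0 (eta : config I) : (0 <= (\prod_(x : I) q (eta x))%:E)%E.
Proof. by rewrite lee_fin prodr_ge0. Qed.

Let iid_measure0 : P set0 = 0%E. Proof. exact: esum_set0. Qed.

Let iid_measure_ge0 A : (0 <= P A)%E. Proof. exact: esum_ge0. Qed.

Let iid_measure_sigma_additive : semi_sigma_additive P.
Proof.
move=> F mF tF mUF; apply: cvg_toP.
  apply: ereal_nondecreasing_is_cvgn => a b ab.
  by apply: lee_sum_nneg_natr => // n _ _; exact: esum_ge0.
by rewrite /iid_measure nneseries_sum_bigcup.
Qed.

HB.instance Definition _ := isMeasure.Build _ _ _ P
  iid_measure0 iid_measure_ge0 iid_measure_sigma_additive.

Let cube M : set (config I) := [set eta | forall x, (eta x < M)%N].

Let iid_cube M : P (cube M) = ((\sum_(k < M) q (k : nat)) ^+ #|I|)%:E.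
Proof.
pose h (f : {ffun I -> 'I_M}) : config I := [ffun x => f x : nat].
have hinj : injective h.
  by move=> f f' /ffunP ff'; apply/ffunP => x; apply: val_inj;
     have := ff' x; rewrite !ffunE.
have cubeE : cube M = [set h f | f in [set: {ffun I -> 'I_M}]].
  apply/seteqP; split => [eta etaM|_ [f _ <-] x]; last by rewrite ffunE.
  exists [ffun x => Ordinal (etaM x)] => //.
  by apply/ffunP => x; rewrite !ffunE.
have fT : finite_set [set: {ffun I -> 'I_M}] by exact: finite_finset.
rewrite /iid_measure cubeE esum_fset//; last exact: finite_image.
rewrite fsbig_image; last by move=> f f' _ _ /hinj.
rewrite fsumEFin//; congr EFin.
rewrite -prodr_const bigA_distr_bigA/=.
transitivity (\sum_(f <- enum {ffun I -> 'I_M}) \prod_(x : I) q (h f x)).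
  rewrite [RHS]fsbig_seq ?enum_uniq//; apply: eq_fsbigl.
  apply/seteqP.
  by split => // f _ /=; rewrite mem_enum.
rewrite big_enum/=; apply: eq_bigr => f _; apply: eq_bigr => x _.
by rewrite ffunE.
Qed.

Let q_sum M : (\sum_(k < M) q (k : nat))%:E = nu `I_M.
Proof.
elim: M => [|M IH]; first by rewrite big_ord0 II0 measure0.
rewrite big_ord_recr/= EFinD IH fineK ?fin_num_measure// IIS measureU//.
by apply/seteqP; split => // k [/= + kM]; rewrite kM ltnn.
Qed.

Let q_cvg : \sum_(k < M) q (k : nat) @[M --> \oo] --> (1 : R).
Proof.
have IIT : \bigcup_M `I_M = [set: nat].
  by rewrite -subTset => k _; exists k.+1 => /=.
have IInd : {homo (fun M => `I_M : set nat) : n m / (n <= m)%N >-> (n <= m)%O}.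
  by move=> m n mn; apply/subsetPset => k /= km; exact: leq_trans mn.
have mII : measurable (\bigcup_M `I_M) by [].
have := nondecreasing_cvg_mu (mu := nu) (fun=> Logic.I) mII IInd.
rewrite IIT [X in _ --> X](_ : _ = 1%:E); last exact: probability_setT.
move=> /fine_cvg/=.
by apply: cvg_trans; apply: near_eq_cvg; near=> M => /=; rewrite -q_sum.
Unshelve. all: by end_near. Qed.

Let iid_measure_setT : P [set: config I] = 1%E.
Proof.
have cubeT : \bigcup_M cube M = [set: config I].
  rewrite -subTset => eta _; exists (\max_(x : I) eta x).+1 => //= x.
  by rewrite ltnS leq_bigmax.
have cube_nd : {homo cube : n m / (n <= m)%N >-> (n <= m)%O}.
  by move=> m n mn; apply/subsetPset => eta etam x; exact: leq_trans mn.
have mcube : measurable (\bigcup_M cube M) by [].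
have := nondecreasing_cvg_mu (mu := P) (fun=> Logic.I) mcube cube_nd.
rewrite cubeT => /cvg_lim <-//; apply/cvg_lim => //.
rewrite [X in X @ _ --> _](_ : _ =
    fun M => ((\sum_(k < M) q (k : nat)) ^+ #|I|)%:E); last first.
  by apply/funext => M; exact: iid_cube.
apply: cvg_EFin; first by near=> M.
rewrite -[1%R](expr1n _ #|I|) /comp/=.
exact: (cvg_comp _ _ q_cvg (@exprn_continuous R #|I| 1)).
Unshelve. all: by end_near. Qed.

HB.instance Definition _ :=
  @Measure_isProbability.Build _ _ R P iid_measure_setT.

End iid_measure_probability.

Definition rel_entropy {d} {T : measurableType d} {R : realType}
    (mu nu : probability T R) : \bar R :=
  if `[< mu `<< nu >]
  then (\int[mu]_x
          (ln (fine (Radon_Nikodym (charge_of_finite_measure mu) nu x)))%:E)%E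
  else +oo%E.

Record step_distribution (R : realType) (d : nat) := StepDistribution {
  step :> 'rV[int]_d -> R ;
  step_ge0 : forall z, 0 <= step z ;
  step_bounded : exists M : nat,
    forall z, step z != 0 -> forall i, (`|z ord0 i| <= M)%N ;
  step_sum1 : \sum_(z \in [set: 'rV[int]_d]) step z = 1 ;
  step_generate : forall z : 'rV[int]_d, exists s : seq 'rV[int]_d,
    (forall v, v \in s -> step v != 0) /\ z = \sum_(v <- s) v }.

Definition mean_zero {R : realType} {d : nat} (p : step_distribution R d) : Prop :=
  \sum_(z \in [set: 'rV[int]_d]) p z *: map_mx intr z = 0 :> 'rV[R]_d.

(* p(y - x): the total p-mass of the z with z = y - x modulo N *)
Definition torus_step {R : realType} {d : nat} (p : 'rV[int]_d -> R) (N : nat)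
    (x y : torus d N) : R :=
  \sum_(z \in [set z : 'rV[int]_d | forall i,
    (Posz (x ord0 i) + z ord0 i = Posz (y ord0 i) %[mod N])%Z]) p z.

(* The truncated subtraction matters only if x is empty, when the rate of the
   jump is 0. *)
Definition move {I : finType} (eta : config I) (x y : I) : config I :=
  [ffun z => (eta z - (z == x) + (z == y))%N].

Definition zrp_generator {R : realType} {d : nat} (g : nat -> R)
    (p : 'rV[int]_d -> R) (N : nat) (f : config (torus d N) -> R)
    (eta : config (torus d N)) : R :=
  \sum_(x : torus d N) \sum_(y : torus d N)
    (f (move eta x y) - f eta) * g (eta x) * torus_step p x y.

Definition bounded_function {S : Type} {R : realType} (f : S -> R) : Prop :=
  exists M : R, forall x, `|f x| <= M.

Section markov_jump_processes.
Context {R : realType} {I : finType}.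
Local Notation S := (config I).

(* (K t) for t >= 0 is a semigroup of Markov kernels with generator L *)
Record transition_semigroup (L : (S -> R) -> (S -> R)) (K : R -> R.-pker S ~> S)
    : Prop := TransitionSemigroup {
  semigroup0 : forall (eta : S) (A : set S), K 0 eta A = \d_eta A ;
  semigroupD : forall s t (eta : S) (A : set S), 0 <= s -> 0 <= t ->
    K (s + t) eta A = (\int[K s eta]_xi K t xi A)%E ;
  semigroup_generator : forall (f : S -> R) (eta : S), bounded_function f ->
    (\int[K t eta]_xi f xi - f eta) / t @[t --> 0^'+] --> L f eta }.

Record markov_jump_process {dsp} {Omega : measurableType dsp}
    (P : probability Omega R) (L : (S -> R) -> (S -> R)) (mu : probability S R)
    (X : R -> Omega -> S) : Prop := MarkovJumpProcess {
  process_measurable : forall t, 0 <= t -> measurable_fun [set: Omega] (X t) ;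
  (* cadlag paths in a discrete space *)
  process_right_cts : forall w t, 0 <= t -> \forall s \near t^'+, X s w = X t w ;
  process_left_lim : forall w t, 0 < t ->
    exists eta : S, \forall s \near t^'-, X s w = eta ;
  process_initial : forall A : set S, P (X 0 @^-1` A) = mu A ;
  (* h lists the observation times and the observed values of a past before t *)
  process_markov : exists2 K : R -> R.-pker S ~> S,
    transition_semigroup L K &
    forall (s t : R) (h : seq (R * S)) (eta : S) (A : set S), 0 <= s -> 0 <= t ->
      (forall r, r \in h -> 0 <= r.1 <= t) ->
      let past := [set w | (forall r, r \in h -> X r.1 w = r.2) /\ X t w = eta] in
      P (past `&` X (t + s) @^-1` A) = (P past * K s eta A)%E }.

End markov_jump_processes.

Definition accelerated_zrp {R : realType} {d : nat} (g : nat -> R)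
    (p : 'rV[int]_d -> R) (N : nat) {dsp} {Omega : measurableType dsp}
    (P : probability Omega R) (mu : probability (config (torus d N)) R)
    (X : R -> Omega -> config (torus d N)) : Prop :=
  markov_jump_process P
    (fun f eta => (N ^ 2)%:R * zrp_generator g p f eta) mu X.

Definition circle_dist {N : nat} (a b : 'I_N) : nat :=
  let k := `|Posz a - Posz b|%N in minn k (N - k).

Definition block_average {R : realType} {d N : nat} (l : nat)
    (eta : config (torus d N)) (x : torus d N) : R :=
  (\sum_(y : torus d N | [forall i, (circle_dist (x ord0 i) (y ord0 i) <= l)%N])
     eta y)%:R / ((2 * l + 1) ^ d)%:R.

(* min(rho, rho_c), where rho_c may be infinite *)
Definition min_rho_c {R : realType} (g : jump_rate R) (rho : R) : R :=
  fine (Order.min rho%:E (rho_c g)).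

Definition torus_point {R : realType} {d N : nat} (x : torus d N) : 'rV[R]_d :=
  \row_i ((x ord0 i)%:R / N%:R).

(* C([0,T] x T^d), as functions that are Z^d-periodic in space *)
Definition test_function {R : realType} {d : nat} (T : R)
    (H : R * 'rV[R]_d -> R) : Prop :=
  {within `[0, T] `*` [set: 'rV[R]_d], continuous H} /\
  forall t u (z : 'rV[int]_d), 0 <= t <= T -> H (t, u + map_mx intr z) = H (t, u).

(* Main.v *)
(* Let W be gamma times the sum over x of V_x, where V_x is the deviation of the
   average jump rate over the block around x from Phi of the block density, set to 0
   on blocks of density above A.  Discretising the Feynman-Kac semigroup of
   N^2 L + W and using the entropy inequality, the mean time integral of W is at most
   half the initial entropy plus T lambda, where lambda bounds the quadratic form of
   N^2 L + W in L^2 of the invariant product measure.  Only the symmetric part of L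
   enters this form, and it is a Dirichlet form because the steps on the torus are
   doubly stochastic.  On a fixed block with a fixed number of particles V_x is
   controlled by its canonical mean plus a multiple of the Dirichlet form of the block,
   and that form is absorbed by the factor N^2, since translations are finite
   compositions of steps of p.  What remains is the canonical mean of V_x, which tends
   to 0 with the size of the block by the equivalence of ensembles, uniformly for
   densities in [0, A]; above rho_c the surplus particles sit on few sites, which a
   bounded g does not see.  Since g is bounded, blocks of density above A cost at most
   a multiple of (number of particles) / (A N^d), whose mean is conserved in time and
   is O(1 / A) by the initial entropy bound.

   The function Phi (min rho rho_c) is handled through one variational formula that is
   valid on both sides of rho_c: it is the supremum of the phi >= 0 for which every
   truncated mean density at phi is at most rho. *)
Require Import Defs.
From mathcomp Require Import all_boot all_order all_algebra.
From mathcomp Require Import all_classical all_reals all_analysis.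
From mathcomp Require Import measurable_realfun.
From mathcomp Require Import ring lra zify.

Set Implicit Arguments.
Unset Strict Implicit.
Unset Printing Implicit Defensive.

Import Order.TTheory GRing.Theory Num.Theory.
Import numFieldNormedType.Exports.

Local Open Scope classical_set_scope.
Local Open Scope ring_scope.

(** * Truncated mean densities *)

(** Above [rho_c] no site law has the required mean, and at [rho_c] second moments may be infinite,
    so the equivalence of ensembles cannot rest on a local limit theorem. Exponential rates are
    compared instead. Detailed balance makes the mean of g at fugacity phi equal to phi whatever the
    density is, so deviations of the block average of g from phi are exponentially small under the
    product weight. It remains to see that fixing the particle number costs a smaller rate. For this
    lower bound on the canonical partition function the occupation numbers are truncated at a level
    k, where a fugacity with a suitable mean exists and Chernoff bounds apply, and the small
    proportion of missing particles is put on a single site, at a bounded factor per particle. Block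
    constants depend on the block size and on A but not on N, so a crude Poincare inequality is
    enough. The generator is known only through pointwise derivatives at time 0; uniform second
    order expansions are recovered from the semigroup property by doubling the time, and they make
    the discretisation rigorous. *)

Section truncated_series.
Context {R : realType}.
Variable c : nat -> R.
Hypothesis c_gt0 : forall j, 0 < c j.
Hypothesis c0 : c 0 = 1.

(** With c_j = 1 / g!(j) this is the partition function cut off at k, and [trunc_N] is phi times its
    derivative; their quotient is the mean of the site law conditioned on at most k particles.
    Inequalities between such means are kept cross-multiplied. *)
Definition trunc_Z (phi : R) (k : nat) : R := \sum_(j < k.+1) c j * phi ^+ j.
Definition trunc_N (phi : R) (k : nat) : R :=
  \sum_(j < k.+1) j%:R * (c j * phi ^+ j).

Lemma trunc_ZS phi k :
  trunc_Z phi k.+1 = trunc_Z phi k + c k.+1 * phi ^+ k.+1.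
Proof. by rewrite /trunc_Z big_ord_recr. Qed.

Lemma trunc_NS phi k :
  trunc_N phi k.+1 = trunc_N phi k + k.+1%:R * (c k.+1 * phi ^+ k.+1).
Proof. by rewrite /trunc_N big_ord_recr. Qed.

Lemma trunc_Z0 phi : trunc_Z phi 0 = 1.
Proof. by rewrite /trunc_Z big_ord1 expr0 mulr1. Qed.

Lemma trunc_N0 phi : trunc_N phi 0 = 0.
Proof. by rewrite /trunc_N big_ord1 mul0r. Qed.

Lemma trunc_Z_term_ge0 phi j : 0 <= phi -> 0 <= c j * phi ^+ j.
Proof. by move=> p0; rewrite mulr_ge0 ?exprn_ge0 // ltW. Qed.

Lemma trunc_Z_le phi k m : 0 <= phi -> (k <= m)%N ->
  trunc_Z phi k <= trunc_Z phi m.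
Proof.
move=> p0 /subnK <-; elim: (m - k)%N => [|i IH]; first by rewrite add0n.
by rewrite addSn trunc_ZS (le_trans IH)// lerDl trunc_Z_term_ge0.
Qed.

Lemma trunc_Z_ge1 phi k : 0 <= phi -> 1 <= trunc_Z phi k.
Proof. by move=> p0; rewrite -(trunc_Z0 phi) trunc_Z_le. Qed.

Lemma trunc_Z_gt0 phi k : 0 <= phi -> 0 < trunc_Z phi k.
Proof. by move=> p0; rewrite (lt_le_trans ltr01)// trunc_Z_ge1. Qed.

Lemma trunc_N_ge0 phi k : 0 <= phi -> 0 <= trunc_N phi k.
Proof.
by move=> p0; apply: sumr_ge0 => j _; rewrite mulr_ge0 ?ler0n ?trunc_Z_term_ge0.
Qed.

Lemma trunc_Z_homo a b k : 0 <= a -> a <= b -> trunc_Z a k <= trunc_Z b k.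
Proof.
move=> a0 ab; apply: ler_sum => j _; rewrite ler_pM2l ?c_gt0//.
by apply: lerXn2r => //; rewrite nnegrE// (le_trans a0).
Qed.

Lemma trunc_N_le_index phi k : 0 <= phi ->
  trunc_N phi k <= k%:R * trunc_Z phi k.
Proof.
move=> p0; rewrite /trunc_Z mulr_sumr; apply: ler_sum => j _.
by rewrite ler_wpM2r ?trunc_Z_term_ge0// ler_nat -ltnS.
Qed.

(** The term added at level k + 1 carries the factor k + 1, which exceeds the mean over the earlier
    terms, so the truncated means increase with the level. *)
Lemma trunc_mean_homo_index phi k m : 0 <= phi -> (k <= m)%N ->
  trunc_N phi k * trunc_Z phi m <= trunc_N phi m * trunc_Z phi k.
Proof.
move=> p0 km; rewrite -(subnK km); elim: (m - k)%N => [|i IH]//.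
rewrite addSn trunc_ZS trunc_NS mulrDr mulrDl lerD//.
rewrite [leRHS]mulrAC ler_wpM2r ?trunc_Z_term_ge0//.
rewrite (le_trans (trunc_N_le_index _ _))// ler_wpM2r ?(ltW (trunc_Z_gt0 _ _))//.
by rewrite ler_nat; lia.
Qed.

(* Multiplying out, the increment of the left-minus-right side from k to k + 1
   is the sum over j <= k of (k + 1 - j) c_j (b^(k+1) a^j - a^(k+1) b^j). *)
Lemma trunc_mean_lt a b k : 0 <= a -> a <= b -> (0 < k)%N ->
  trunc_N a k * trunc_Z b k + c 1 * (b - a) <= trunc_N b k * trunc_Z a k.
Proof.
move=> a0 ab; have b0 : 0 <= b by exact: le_trans ab.
case: k => // k _; elim: k => [|k IH].
  rewrite !trunc_ZS !trunc_NS !trunc_Z0 !trunc_N0 !expr1.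
  by rewrite le_eqVlt; apply/orP; left; apply/eqP; ring.
rewrite (trunc_ZS _ k.+1) (trunc_NS _ k.+1) [in leRHS](trunc_ZS _ k.+1)
  [in leRHS](trunc_NS _ k.+1).
set A := c k.+2 * a ^+ k.+2; set B := c k.+2 * b ^+ k.+2.
have : 0 <= k.+2%:R * B * trunc_Z a k.+1 - B * trunc_N a k.+1
            - (k.+2%:R * A * trunc_Z b k.+1 - A * trunc_N b k.+1).
  rewrite /trunc_Z /trunc_N !mulr_sumr -!sumrB sumr_ge0// => j _.
  have -> : k.+2%:R * B * (c j * a ^+ j) - B * (j%:R * (c j * a ^+ j)) -
    (k.+2%:R * A * (c j * b ^+ j) - A * (j%:R * (c j * b ^+ j))) =
    (k.+2%:R - j%:R) * c j * (B * a ^+ j - A * b ^+ j) by ring.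
  have jk : (j <= k.+2)%N by case: j => j /= /ltnW.
  rewrite mulr_ge0//; first by rewrite mulr_ge0 ?(ltW (c_gt0 _))// subr_ge0 ler_nat.
  have E x : x ^+ k.+2 = x ^+ (k.+2 - j) * x ^+ j :> R by rewrite -exprD subnK.
  have -> : B * a ^+ j = c k.+2 * b ^+ (k.+2 - j) * (a ^+ j * b ^+ j).
    by rewrite /B (E b); ring.
  have -> : A * b ^+ j = c k.+2 * a ^+ (k.+2 - j) * (a ^+ j * b ^+ j).
    by rewrite /A (E a); ring.
  rewrite subr_ge0 ler_wpM2r ?mulr_ge0 ?exprn_ge0// ler_pM2l ?c_gt0//.
  by apply: lerXn2r => //; rewrite nnegrE.
by move: IH; set x := trunc_N a k.+1; set y := trunc_N b k.+1;
   set z := trunc_Z a k.+1; set t := trunc_Z b k.+1; lra.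
Qed.

Lemma trunc_mean_le a b k : 0 <= a -> a <= b ->
  trunc_N a k * trunc_Z b k <= trunc_N b k * trunc_Z a k.
Proof.
move=> a0 ab; case: k => [|k]; first by rewrite !trunc_N0 !mul0r.
apply: le_trans (trunc_mean_lt a0 ab (ltn0Sn k)).
by rewrite lerDl mulr_ge0 ?subr_ge0// ltW.
Qed.

(** Markov's inequality: a mean of at most A leaves at least half of the mass on occupation numbers
    up to 2 A. *)
Lemma trunc_Z_bound phi (A : nat) k : (0 < A)%N -> 0 <= phi ->
  (forall k, trunc_N phi k <= A%:R * trunc_Z phi k) ->
  trunc_Z phi k <= 2 * trunc_Z phi (2 * A).
Proof.
move=> A0 p0 NA; have A0' : 0 < A%:R :> R by rewrite ltr0n.
have H i : (trunc_Z phi (2 * A + i) - trunc_Z phi (2 * A)) * A%:R <=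
   (trunc_N phi (2 * A + i) - A%:R * trunc_Z phi (2 * A + i))
   - (trunc_N phi (2 * A) - A%:R * trunc_Z phi (2 * A)).
  elim: i => [|i IH]; first by rewrite addn0 !subrr mul0r.
  rewrite addnS trunc_ZS trunc_NS.
  have := trunc_Z_term_ge0 (2 * A + i).+1 p0.
  set t := c _ * _ => t0.
  have : A%:R * t <= (2 * A + i).+1%:R * t - A%:R * t.
    by rewrite -mulrBl ler_wpM2r// -natrB ?ler_nat; lia.
  by lra.
have Hk i : trunc_Z phi (2 * A + i) <= 2 * trunc_Z phi (2 * A).
  have := H i; have := NA (2 * A + i)%N; have := trunc_N_ge0 (2 * A) p0.
  move=> h1 h2 h3.
  by rewrite -(ler_pM2r A0'); lra.
apply: le_trans (Hk k); apply: trunc_Z_le => //; exact: leq_addl.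
Qed.


Lemma trunc_Z_continuous k : continuous (trunc_Z ^~ k).
Proof.
elim: k => [|k IH] x.
  by rewrite (_ : trunc_Z ^~ 0%N = cst 1); [exact: cvg_cst|apply/funext => y; rewrite trunc_Z0].
rewrite (_ : trunc_Z ^~ _ = fun y => trunc_Z y k + c k.+1 * y ^+ k.+1); last first.
  by apply/funext => y; rewrite trunc_ZS.
by apply: cvgD; [exact: IH|apply: cvgM; [exact: cvg_cst|exact: exprn_continuous]].
Qed.

Lemma trunc_N_continuous k : continuous (trunc_N ^~ k).
Proof.
elim: k => [|k IH] x.
  by rewrite (_ : trunc_N ^~ 0%N = cst 0); [exact: cvg_cst|apply/funext => y; rewrite trunc_N0].
rewrite (_ : trunc_N ^~ _ =
    fun y => trunc_N y k + k.+1%:R * c k.+1 * y ^+ k.+1); last first.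
  by apply/funext => y; rewrite trunc_NS mulrA.
by apply: cvgD; [exact: IH|apply: cvgM; [exact: cvg_cst|exact: exprn_continuous]].
Qed.

Definition subcrit (rho : R) : set R :=
  [set phi | 0 <= phi /\ forall k, trunc_N phi k <= rho * trunc_Z phi k].

Definition phistar (rho : R) : R := sup (subcrit rho).

Lemma subcrit0 rho : 0 <= rho -> subcrit rho 0.
Proof.
move=> rho0; split=> // k; rewrite [leLHS](_ : _ = 0).
  by rewrite mulr_ge0 ?(ltW (trunc_Z_gt0 _ _)).
by apply: big1 => -[[|j] /= _] _; rewrite ?mul0r// expr0n/= !mulr0.
Qed.

Lemma subcrit_down rho a b : 0 <= a -> a <= b -> subcrit rho b -> subcrit rho a.
Proof.
move=> a0 ab [b0 H]; split=> // k.
rewrite -(ler_pM2r (trunc_Z_gt0 k b0)) (le_trans (trunc_mean_le _ a0 ab))//.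
by rewrite mulrAC ler_wpM2r// ltW// trunc_Z_gt0.
Qed.

Lemma subcrit_homo rho rho' : rho <= rho' -> subcrit rho `<=` subcrit rho'.
Proof.
move=> rr a [a0 H]; split=> // k; apply: le_trans (H k) _.
by rewrite ler_wpM2r// ltW// trunc_Z_gt0.
Qed.

(** Bounded truncated means force the series to converge, so [subcrit] can be stated without its
    radius of convergence and may contain the boundary point phi_c. *)
Lemma subcrit_bounded rho phi : subcrit rho phi ->
  exists M, forall k, trunc_Z phi k <= M.
Proof.
move=> [p0 H]; have [m _ Hm] : exists2 m : nat, True & rho <= m.+1%:R.
  exists (Num.bound `|rho|) => //; apply: le_trans (ler_norm _) _.
  by apply: le_trans (ltW (archi_boundP (normr_ge0 _))) _; rewrite ler_nat.
exists (2 * trunc_Z phi (2 * m.+1)) => k; apply: trunc_Z_bound => // {}k.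
by apply: le_trans (H k) _; rewrite ler_wpM2r// ltW// trunc_Z_gt0.
Qed.

(** By [trunc_mean_lt] the means at b and a differ by at least c_1 (b - a) / (Z_k(a) Z_k(b)), and
    the denominators are bounded uniformly in k. *)
Lemma subcrit_gap rho a b : 0 <= a -> a < b -> subcrit rho b ->
  exists2 k, 0 < k & subcrit (rho - k) a.
Proof.
move=> a0 ab Hb; have [M HM] := subcrit_bounded Hb.
have b0 : 0 <= b by case: Hb.
have M0 : 0 < M by apply: lt_le_trans (HM 0); rewrite trunc_Z_gt0.
pose kap := c 1 * (b - a) / M ^+ 2.
have kap0 : 0 < kap by rewrite divr_gt0 ?exprn_gt0// mulr_gt0 ?subr_gt0.
have E k : (0 < k)%N -> trunc_N a k <= (rho - kap) * trunc_Z a k.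
  move=> k0; have Za := trunc_Z_gt0 k a0; have Zb := trunc_Z_gt0 k b0.
  have h := trunc_mean_lt a0 (ltW ab) k0.
  have h2 : trunc_N b k * trunc_Z a k <= rho * trunc_Z b k * trunc_Z a k.
    by rewrite ler_pM2r//; case: Hb.
  have h3 : kap * (trunc_Z b k * trunc_Z a k) <= c 1 * (b - a).
    rewrite /kap mulrAC ler_pdivrMr ?exprn_gt0// ler_wpM2l//.
      by rewrite mulr_ge0 ?subr_ge0 ?(ltW ab)// ltW.
    rewrite expr2 ler_pM// ?(ltW Za) ?(ltW Zb)//.
    by rewrite (le_trans _ (HM k))// trunc_Z_homo// ltW.
  by rewrite -(ler_pM2r Zb); lra.
exists kap => //; split=> // -[|k]; last exact: E.
(* Level 0 asks for rho - kap >= 0, which follows from level 1. *)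
have := E 1%N isT; have := trunc_N_ge0 1 a0; have := trunc_Z_gt0 1 a0.
by rewrite trunc_N0 trunc_Z0 mulr1 => h1 h2 h3; rewrite -(pmulr_lge0 _ h1); lra.
Qed.

Lemma expr_convex (a b t : R) n : 0 <= a -> 0 <= b -> 0 <= t -> t <= 1 ->
  ((1 - t) * a + t * b) ^+ n <= (1 - t) * a ^+ n + t * b ^+ n.
Proof.
move=> a0 b0 t0 t1; elim: n => [|n IH]; first by rewrite !expr0; lra.
rewrite exprS; have u0 : 0 <= 1 - t by rewrite subr_ge0.
apply: le_trans (ler_wpM2l _ IH) _; first by rewrite addr_ge0// mulr_ge0.
have : 0 <= (a - b) * (a ^+ n - b ^+ n).
  have [ab|/ltW ba] := leP a b.
    rewrite mulr_le0// subr_le0//; apply: lerXn2r => //.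
  by rewrite mulr_ge0// subr_ge0//; apply: lerXn2r => //.
move=> h; have := mulr_ge0 (mulr_ge0 t0 u0) h; rewrite !exprS.
by set A := a ^+ n; set B := b ^+ n; lra.
Qed.

(* Right-continuity of the mean at a, through convexity of the monomials. *)
Lemma subcrit_step rho q a b (M : R) : 0 <= a -> a < b -> 0 <= rho -> q < rho ->
  subcrit q a -> (forall k, trunc_N b k <= M) ->
  exists2 phi, a < phi & subcrit rho phi.
Proof.
move=> a0 ab rho0 qr [_ Ha] HM; have b0 : 0 <= b by rewrite (le_trans a0)// ltW.
have M0 : 0 <= M by apply: le_trans (HM 0); exact: trunc_N_ge0.
have d0 : 0 < M + (rho - q) by lra.
pose t := (rho - q) / (M + (rho - q)).
have t0 : 0 < t by rewrite divr_gt0// subr_gt0.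
have t1 : t <= 1 by rewrite ler_pdivrMr//; lra.
have tM : t * M <= rho - q.
  by rewrite /t mulrAC ler_pdivrMr// ler_wpM2l; lra.
pose phi := (1 - t) * a + t * b.
have E : phi - a = t * (b - a) by rewrite /phi; ring.
have ltaphi : a < phi by rewrite -subr_gt0 E mulr_gt0 ?subr_gt0.
have aphi := ltW ltaphi.
exists phi => //.
have p0 : 0 <= phi by exact: le_trans aphi.
split=> // k.
have h1 : trunc_N phi k <= (1 - t) * trunc_N a k + t * trunc_N b k.
  rewrite /trunc_N !mulr_sumr -big_split/=; apply: ler_sum => j _.
  rewrite [leRHS](_ : _ = j%:R * (c j * ((1 - t) * a ^+ j + t * b ^+ j))); last ring.
  by rewrite ler_wpM2l ?ler0n// ler_pM2l ?c_gt0// expr_convex// ltW.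
have h2 := trunc_Z_homo k a0 aphi.
have h3 := Ha k; have h4 := trunc_Z_ge1 k a0; have h5 := trunc_N_ge0 k a0.
have h6 := HM k.
have h7 : t * trunc_N b k <= t * M by rewrite ler_pM2l.
have h8 : (1 - t) * trunc_N a k <= trunc_N a k by rewrite ler_piMl//; lra.
have h9 : rho * trunc_Z a k <= rho * trunc_Z phi k by rewrite ler_wpM2l.
have h10 : (rho - q) * 1 <= (rho - q) * trunc_Z a k by rewrite ler_wpM2l//; lra.
lra.
Qed.

(** The tangent inequality j b^j (r - b) <= b (r^j - b^j) shows that a bound for the partition sums
    at r bounds the first moments at every b < r. *)
Lemma trunc_N_bound b r k : 0 <= b -> b < r ->
  trunc_N b k <= b / (r - b) * trunc_Z r k.
Proof.
move=> b0 br; have rb : 0 < r - b by rewrite subr_gt0.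
rewrite mulrAC ler_pdivlMr// /trunc_N /trunc_Z mulr_suml mulr_sumr.
apply: ler_sum => j _; rewrite -(mulrA _ (_ * _)) -mulrA mulrCA [leRHS]mulrCA.
rewrite ler_pM2l ?c_gt0//; case: j => j _ /=.
have H i : b ^+ i <= r ^+ i.
  by apply: lerXn2r; rewrite ?nnegrE// ?(le_trans b0)// ltW.
have Hj : j%:R * (b ^+ j * (r - b)) <= b * (r ^+ j - b ^+ j).
  elim: j => [|j IH]; first by rewrite mul0r !expr0 subrr mulr0.
  have := H j; rewrite -subr_ge0 => h.
  have h2 := mulr_ge0 b0 (mulr_ge0 (ltW rb) h).
  have h3 : 0 <= b * (b * (r ^+ j - b ^+ j) - j%:R * (b ^+ j * (r - b))).
    by rewrite mulr_ge0// subr_ge0.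
  by rewrite !exprS -[j.+1]addn1 natrD; lra.
by apply: le_trans Hj _; rewrite ler_wpM2l// gerBl exprn_ge0.
Qed.

Variable G : R.
Hypothesis G_ge1 : 1 <= G.
Hypothesis c_ge : forall j, 1 <= c j * G ^+ j.

(** Beyond G every term of the series is at least 1, so Z diverges and the truncated means cannot
    stay bounded. *)
Lemma subcrit_leG rho phi : subcrit rho phi -> phi <= G.
Proof.
move=> H; rewrite leNgt; apply/negP => Gp; have [M HM] := subcrit_bounded H.
have hk k : k.+1%:R <= trunc_Z phi k.
  rewrite /trunc_Z -[k.+1 in leLHS]card_ord -sumr_const; apply: ler_sum => j _.
  apply: le_trans (c_ge j) _; rewrite ler_pM2l ?c_gt0//; apply: lerXn2r => //.
  - by rewrite nnegrE (le_trans ler01).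
  - by case: H.
  - exact: ltW.
have := le_trans (hk (Num.bound `|M|)) (HM _); apply/negP; rewrite -ltNge.
apply: le_lt_trans (ler_norm _) _.
by apply: lt_trans (archi_boundP (normr_ge0 _)) _; rewrite ltr_nat.
Qed.

Lemma subcrit_has_sup rho : 0 <= rho -> has_sup (subcrit rho).
Proof.
move=> rho0; split; first by exists 0; exact: subcrit0.
by exists G => phi; exact: subcrit_leG.
Qed.

Lemma phistar_ge0 rho : 0 <= rho -> 0 <= phistar rho.
Proof.
by move=> r0; apply: ub_le_sup; [case: (subcrit_has_sup r0)|exact: subcrit0].
Qed.

Lemma subcrit_le_phistar rho phi : 0 <= rho -> subcrit rho phi -> phi <= phistar rho.
Proof. by move=> r0 H; apply: ub_le_sup => //; case: (subcrit_has_sup r0). Qed.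

Lemma phistar_leG rho : 0 <= rho -> phistar rho <= G.
Proof.
move=> r0; apply: ge_sup; first by case: (subcrit_has_sup r0).
by move=> phi; exact: subcrit_leG.
Qed.

Lemma lt_phistar_subcrit rho phi : 0 <= rho -> 0 <= phi -> phi < phistar rho ->
  subcrit rho phi.
Proof.
move=> r0 p0 /sup_gt[]; first by case: (subcrit_has_sup r0).
by move=> b Hb /ltW pb; exact: subcrit_down Hb.
Qed.

(** Each truncated condition is closed in phi, so the supremum is attained. *)
Lemma phistar_subcrit rho : 0 <= rho -> subcrit rho (phistar rho).
Proof.
move=> r0; split=> [|k]; first exact: phistar_ge0.
rewrite leNgt; apply/negP => H.
have [/eqP p0|p0] := boolP (phistar rho == 0).
  by move: H; rewrite p0; case: (subcrit0 r0) => _ /(_ k); rewrite leNgt => /negP.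
have {}p0 : 0 < phistar rho by rewrite lt_neqAle eq_sym p0 phistar_ge0.
have : \forall x \near (phistar rho)^'-, rho * trunc_Z x k < trunc_N x k.
  have cont : (trunc_N x k - rho * trunc_Z x k) @[x --> (phistar rho)^'-] -->
      trunc_N (phistar rho) k - rho * trunc_Z (phistar rho) k.
    apply: cvg_at_left_filter; apply: cvgB; first exact: trunc_N_continuous.
    by apply: cvgM; [exact: cvg_cst|exact: trunc_Z_continuous].
  move: H; rewrite -subr_gt0 => /lt_nbhsr/cont Hc.
  by near=> x; rewrite -subr_gt0; near: x; exact: Hc.
move=> nH; have : \forall x \near (phistar rho)^'-, False.
  near=> x.
  have xp : x < phistar rho by near: x; exact: nbhs_left_lt.
  have x0 : 0 <= x by apply: ltW; near: x; exact: nbhs_left_gt.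
  have [_ /(_ k)] := lt_phistar_subcrit r0 x0 xp.
  by rewrite leNgt => /negP; apply; near: x.
by move=> /filter_ex[].
Unshelve. all: by end_near. Qed.

Lemma gt_phistar rho phi : 0 <= rho -> phistar rho < phi ->
  exists k, rho * trunc_Z phi k < trunc_N phi k.
Proof.
move=> r0 H; apply/not_existsP => h.
have : subcrit rho phi.
  split=> [|k]; first by rewrite ltW// (le_lt_trans _ H)// phistar_ge0.
  by rewrite leNgt; apply/negP.
by move=> /(subcrit_le_phistar r0); rewrite leNgt H.
Qed.

(** From above, a single truncation already violates the density bound at [phistar rho0 + e], and
    this is an open condition on rho. From below, [subcrit_gap] leaves room for a slightly smaller
    rho at [phistar rho0 - e]. *)
Lemma phistar_continuous (rho0 e : R) : 0 <= rho0 -> 0 < e ->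
  \forall rho \near rho0, 0 <= rho -> `|phistar rho - phistar rho0| <= e.
Proof.
move=> r0 e0; have e20 : phistar rho0 < phistar rho0 + e by rewrite ltrDl.
have [k Hk] := gt_phistar r0 e20; set b := _ + e in Hk e20.
have b0 : 0 <= b by rewrite ltW// (le_lt_trans _ e20)// phistar_ge0.
have nearU : \forall rho \near rho0, rho * trunc_Z b k < trunc_N b k.
  have Zb := trunc_Z_gt0 k b0.
  have : rho0 < trunc_N b k / trunc_Z b k by rewrite ltr_pdivlMr.
  by move=> /lt_nbhsl; apply: filterS => x; rewrite ltr_pdivlMr.
have nearL : \forall rho \near rho0, 0 <= rho -> phistar rho0 - e <= phistar rho.
  have [a0|a0] := leP (phistar rho0 - e) 0.
    by near=> rho => rho_ge0; rewrite (le_trans a0)// phistar_ge0.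
  have alt : phistar rho0 - e < phistar rho0 by rewrite gtrBl.
  have [kap kap0 Hkap] := subcrit_gap (ltW a0) alt (phistar_subcrit r0).
  have : rho0 - kap < rho0 by rewrite gtrBl.
  move=> /lt_nbhsr; apply: filterS => x /ltW Hx x0.
  by apply: subcrit_le_phistar => //; exact: subcrit_homo Hkap.
near=> rho => rho_ge0; rewrite ler_distl; apply/andP; split.
  by move: rho_ge0; near: rho.
rewrite -/b leNgt; apply/negP => /(lt_phistar_subcrit rho_ge0 b0)[_ /(_ k)].
by rewrite leNgt => /negP; apply; near: rho.
Unshelve. all: by end_near. Qed.

(* At rho = 0 the mean of every truncation vanishes only for phi = 0. *)
Lemma phistar_at0 : phistar 0 = 0.
Proof.
apply/eqP; rewrite eq_le phistar_ge0// andbT.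
have [_ /(_ 1%N)] := phistar_subcrit (lexx 0).
rewrite mul0r trunc_NS trunc_N0 add0r mul1r expr1.
by rewrite pmulr_rle0 ?c_gt0.
Qed.

(** The mean vanishes at fugacity 0, and [subcrit_step] moves from 0 to the right because r is a
    point of convergence. *)
Lemma phistar_gt0 rho r M : 0 < r -> (forall k, trunc_Z r k <= M) ->
  0 < rho -> 0 < phistar rho.
Proof.
move=> r0 HM rho0.
have r2 : 0 < r / 2 by rewrite divr_gt0.
have r2r : r / 2 < r by rewrite ltr_pdivrMr// mulr_natr mulr2n ltrDl.
have HN k : trunc_N (r / 2) k <= r / 2 / (r - r / 2) * M.
  apply: le_trans (trunc_N_bound _ (ltW r2) r2r) _.
  apply: ler_wpM2l (HM k).
  by apply: divr_ge0; [exact: ltW|rewrite subr_ge0 ltW].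
have [phi phi0 /(subcrit_le_phistar (ltW rho0))] :=
  subcrit_step (lexx 0) r2 (ltW rho0) rho0 (subcrit0 (lexx 0)) HN.
exact: lt_le_trans.
Qed.

End truncated_series.

(** * Expectations and the entropy inequality *)

Section bounded_expectation.
Context {d : measure_display} {T : measurableType d} {R : realType}.
Variable m : {measure set T -> \bar R}.
Hypothesis m1 : m [set: T] = 1%E.

Definition bounded_mfun (f : T -> R) :=
  measurable_fun [set: T] f /\ bounded_function f.

Lemma bounded_mfun_cst (c : R) : bounded_mfun (cst c).
Proof. by split; [exact: measurable_cst|exists `|c|]. Qed.

Lemma bounded_mfunD f g : bounded_mfun f -> bounded_mfun g ->
  bounded_mfun (fun x => f x + g x).
Proof.
move=> [mf [M HM]] [mg [N HN]]; split; first exact: measurable_funD.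
by exists (M + N) => x; rewrite (le_trans (ler_normD _ _))// lerD.
Qed.

Lemma bounded_mfunM f g : bounded_mfun f -> bounded_mfun g ->
  bounded_mfun (fun x => f x * g x).
Proof.
move=> [mf [M HM]] [mg [N HN]]; split; first exact: measurable_funM.
by exists (M * N) => x; rewrite normrM ler_pM.
Qed.

Lemma bounded_mfunZ c f : bounded_mfun f -> bounded_mfun (fun x => c * f x).
Proof. by move=> bf; apply: bounded_mfunM => //; exact: bounded_mfun_cst. Qed.

Lemma bounded_mfun_sum (I : Type) (s : seq I) (P : pred I) (F : I -> T -> R) :
  (forall i, bounded_mfun (F i)) ->
  bounded_mfun (fun x => \sum_(i <- s | P i) F i x).
Proof.
move=> bF; elim: s => [|i s IH].
  rewrite (_ : (fun _ => _) = cst 0); first exact: bounded_mfun_cst.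
  by apply/funext => x; rewrite big_nil.
rewrite (_ : (fun _ => _) = fun x => (if P i then F i x else 0)
    + \sum_(i <- s | P i) F i x); last first.
  by apply/funext => x; rewrite big_cons; case: ifP; rewrite ?add0r.
apply: bounded_mfunD => //; case: (P i) => //; exact: bounded_mfun_cst.
Qed.

Lemma bounded_mfun_integrable f : bounded_mfun f ->
  m.-integrable [set: T] (EFin \o f).
Proof.
move=> [mf [M HM]]; apply: measurable_bounded_integrable => //.
  by rewrite m1 ltry.
exists M; split; first exact: num_real.
by move=> x Mx y _; apply: le_trans (HM y) _; exact: ltW.
Qed.

Lemma mean_cst (c : R) : \int[m]_x c = c.
Proof. by rewrite Rintegral_cst// m1 /= mulr1. Qed.

Lemma meanD f g : bounded_mfun f -> bounded_mfun g ->
  \int[m]_x (f x + g x) = \int[m]_x f x + \int[m]_x g x.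
Proof. by move=> bf bg; rewrite RintegralD//; exact: bounded_mfun_integrable. Qed.

Lemma meanB f g : bounded_mfun f -> bounded_mfun g ->
  \int[m]_x (f x - g x) = \int[m]_x f x - \int[m]_x g x.
Proof. by move=> bf bg; rewrite RintegralB//; exact: bounded_mfun_integrable. Qed.

Lemma meanZ c f : bounded_mfun f -> \int[m]_x (c * f x) = c * \int[m]_x f x.
Proof. by move=> bf; rewrite RintegralZl//; exact: bounded_mfun_integrable. Qed.

Lemma mean_le f g : bounded_mfun f -> bounded_mfun g ->
  (forall x, f x <= g x) -> \int[m]_x f x <= \int[m]_x g x.
Proof. by move=> bf bg H; apply: le_Rintegral => //; exact: bounded_mfun_integrable. Qed.

Lemma mean_sum (I : Type) (s : seq I) (P : pred I) (F : I -> T -> R) :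
  (forall i, bounded_mfun (F i)) ->
  \int[m]_x (\sum_(i <- s | P i) F i x) = \sum_(i <- s | P i) \int[m]_x F i x.
Proof.
move=> bF; elim: s => [|i s IH].
  rewrite big_nil -[RHS](mean_cst 0); apply: eq_Rintegral => x _.
  by rewrite big_nil.
rewrite big_cons; case: ifP => Pi; last first.
  by rewrite -IH; apply: eq_Rintegral => x _; rewrite big_cons Pi.
rewrite -IH -meanD//; last exact: bounded_mfun_sum.
by apply: eq_Rintegral => x _; rewrite big_cons Pi.
Qed.

Lemma mean_norm_le f M : bounded_mfun f -> (forall x, `|f x| <= M) ->
  `|\int[m]_x f x| <= M.
Proof.
move=> bf HM; rewrite ler_norml; apply/andP; split.
  rewrite -(mean_cst (- M)); apply: mean_le => //; first exact: bounded_mfun_cst.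
  by move=> x; have := HM x; rewrite ler_norml => /andP[].
rewrite -(mean_cst M); apply: mean_le => //; first exact: bounded_mfun_cst.
by move=> x; have := HM x; rewrite ler_norml => /andP[].
Qed.

Lemma EFin_mean f : bounded_mfun f ->
  (\int[m]_x (f x)%:E = (\int[m]_x f x)%R%:E)%E.
Proof.
move=> bf; rewrite /Rintegral fineK//; apply: integrable_fin_num => //.
exact: bounded_mfun_integrable.
Qed.

End bounded_expectation.

(** * Integrals as sums over atoms, and the entropy inequality *)

Section countable_space.
Context {d : measure_display} {T : measurableType d} {R : realType}.
Variable pk : T -> nat.
Hypothesis pk_inj : injective pk.
Hypothesis mT : forall A : set T, measurable A.

Lemma discrete_measurable_fun {d'} {U : measurableType d'} (f : T -> U) D :
  measurable_fun D f.
Proof. by move=> *; exact: mT. Qed.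

Lemma integral_esum (m : {measure set T -> \bar R}) (f : T -> \bar R) :
  (forall x, 0 <= f x)%E ->
  (\int[m]_x f x = \esum_(x in [set: T]) (f x * m [set x]))%E.
Proof.
move=> f0; pose F n := [set x | pk x = n].
have FT : \bigcup_n F n = [set: T] by rewrite -subTset => x _; exists (pk x).
have tF : trivIset setT F by move=> i j _ _ [x []]; rewrite /F/= => <- <-.
rewrite -FT ge0_integral_bigcup; [|by move=> k; exact: mT|by move=> *; exact: mT|by move=> *; exact: f0|by []].
rewrite nneseries_sum_bigcup//; last by move=> x; rewrite mule_ge0.
apply: eq_eseriesr => n _; have [[x xn]|Fn] := pselect (exists x, F n x).
  have -> : F n = [set x].
    by apply/seteqP; split => y /=; [rewrite -xn => /pk_inj|move=> ->].
  rewrite esum_set1 ?mule_ge0// -integral_cst//.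
  by apply: eq_integral => y; rewrite inE => ->.
have -> : F n = set0 by rewrite -subset0 => x Fx; apply: Fn; exists x.
by rewrite integral_set0 esum_set0.
Qed.

Lemma eq_integral_null_set (m : {measure set T -> \bar R}) (f g : T -> \bar R) :
  (forall x, m [set x] != 0%E -> f x = g x) ->
  (\int[m]_x f x = \int[m]_x g x)%E.
Proof.
move=> fg; rewrite integralE [RHS]integralE; congr (_ - _)%E;
  rewrite !integral_esum//; apply: eq_esum => x _;
  have [->|/fg] := eqVneq (m [set x]) 0%E; rewrite ?mule0//.
- by rewrite !funeposE => ->.
- by rewrite !funenegE => ->.
Qed.

Lemma integral_monotone (m : {measure set T -> \bar R}) (f g : T -> \bar R) :
  (forall x, f x <= g x)%E -> (\int[m]_x f x <= \int[m]_x g x)%E.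
Proof.
move=> fg; rewrite integralE [leRHS]integralE; apply: leeB;
  apply: ge0_le_integral => //; try exact: discrete_measurable_fun.
- by move=> x _; rewrite !funeposE ge_max !le_max (fg x) lexx orbT.
- by move=> x _; rewrite !funenegE ge_max !le_max lexx orbT leeN2 (fg x).
Qed.

(* With c the nu-integral of exp F and f = d mu / d nu, the inequality
   ln y <= y - 1 at y = exp F / (f c) gives F - ln f - ln c <= exp F / (f c) - 1. *)
Lemma entropy_inequality (mu nu : probability T R) (F : T -> R) (H : R) :
  bounded_function F -> (rel_entropy mu nu <= H%:E)%E ->
  \int[mu]_x F x <= H + ln (\int[nu]_x expR (F x)).
Proof.
move=> [M HM]; rewrite /rel_entropy; case: asboolP => [dom|_]; last by rewrite leye_eq.
set f := Radon_Nikodym _ _ => hH.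
have bF : bounded_mfun F by split; [exact: discrete_measurable_fun|exists M].
have bE : bounded_mfun (fun x => expR (F x)).
  split; [exact: discrete_measurable_fun|exists (expR M) => x].
  by rewrite ger0_norm ?expR_ge0// ler_expR (le_trans (ler_norm _)).
have mu1 : mu [set: T] = 1%E := probability_setT mu.
have nu1 : nu [set: T] = 1%E := probability_setT nu.
set c := \int[nu]_x expR (F x).
have c0 : 0 < c.
  apply: lt_le_trans (expR_gt0 (- M)) _.
  rewrite -(mean_cst nu1 (expR (- M))); apply: mean_le => //.
    exact: bounded_mfun_cst.
  by move=> x; rewrite ler_expR; have := HM x; rewrite ler_norml => /andP[].
pose a x := fine (mu [set x]); pose b x := fine (nu [set x]).
have aE x : mu [set x] = (a x)%:E by rewrite fineK// fin_num_measure.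
have bEE x : nu [set x] = (b x)%:E by rewrite fineK// fin_num_measure.
have a0 x : 0 <= a x by exact: fine_ge0.
have b0 x : 0 <= b x by exact: fine_ge0.
have ab x : a x = fine (f x) * b x.
  have e : (mu [set x] = f x * nu [set x])%E.
    rewrite -integral_cst//.
    transitivity (\int[nu]_(y in [set x]) f y)%E.
      exact: (Radon_Nikodym_integral (nu := charge_of_finite_measure mu) dom).
    by apply: eq_integral => y; rewrite inE => ->.
  have ff : f x \is a fin_num.
    exact: (@Radon_Nikodym_fin_num _ _ _ (charge_of_finite_measure mu) nu x dom).
  by rewrite /a e bEE -(fineK ff).
(* [k] is exp F times d nu / d mu, with the value 0 on the mu-null points, where this density has no
   meaning. *)
pose k x := if a x == 0 then 0 else expR (F x) * (b x / a x).
have k0 x : 0 <= k x.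
  by rewrite /k; case: ifP => // _; rewrite mulr_ge0 ?expR_ge0// divr_ge0.
have ik : (\int[mu]_x (k x)%:E <= c%:E)%E.
  rewrite /c -EFin_mean// !integral_esum; last 2 first.
  - by move=> x; rewrite lee_fin.
  - by move=> x; rewrite lee_fin expR_ge0.
  apply: le_esum => x _ /=; rewrite aE bEE -!EFinM lee_fin /k.
  have [->|an0] := eqVneq (a x) 0; first by rewrite mul0r mulr_ge0 ?expR_ge0.
  by rewrite -mulrA divfK.
have ki : mu.-integrable setT (EFin \o k).
  apply/integrableP; split; first exact: discrete_measurable_fun.
  under eq_integral do rewrite /= ger0_norm//.
  by rewrite (le_lt_trans ik)// ltry.
pose l x := F x - ln c + 1 - c^-1 * k x.
have li : (\int[mu]_x (l x)%:E <= H%:E)%E.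
  apply: le_trans hH.
  (* The pointwise inequality needs positive mass, so on mu-null points the right-hand integrand is
     replaced by [l] itself. *)
  rewrite [leRHS](@eq_integral_null_set _ _
    (fun x => if a x == 0 then (l x)%:E else (ln (fine (f x)))%:E)); last first.
    by move=> x /=; rewrite aE eqe => /negbTE ->.
  apply: integral_monotone => x; case: ifP => // /negbT an0; rewrite lee_fin.
  have bp : 0 < b x.
    rewrite lt_neqAle b0 andbT eq_sym; apply: contra_neq an0 => bx0.
    by rewrite ab bx0 mulr0.
  have ap : 0 < a x by rewrite lt_neqAle a0 andbT eq_sym.
  have fE : fine (f x) = a x / b x by rewrite ab mulfK// gt_eqF.
  have kp : 0 < c^-1 * k x.
    by rewrite /k (negbTE an0) !mulr_gt0 ?expR_gt0 ?invr_gt0.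
  have h : ln (c^-1 * k x) <= c^-1 * k x - 1.
    by rewrite lerBrDl -[leRHS]lnK ?posrE// expR_ge1Dx.
  move: h; rewrite {1}/k (negbTE an0) !lnM ?posrE ?invr_gt0 ?mulr_gt0 ?expR_gt0 ?invr_gt0//.
  rewrite !lnV ?posrE// expRK fE ln_div ?posrE//.
  by rewrite /l; lra.
move: li; rewrite /l.
under eq_integral do rewrite EFinB.
rewrite integralB//; last 2 first.
- apply: bounded_mfun_integrable => //.
  apply: bounded_mfunD => //; last exact: bounded_mfun_cst.
  by apply: bounded_mfunD => //; exact: bounded_mfun_cst.
- by under eq_fun do rewrite EFinM; exact: integrableZl.
rewrite EFin_mean//; last first.
  apply: bounded_mfunD => //; last exact: bounded_mfun_cst.
  by apply: bounded_mfunD => //; exact: bounded_mfun_cst.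
rewrite !meanD//; [|exact: bounded_mfun_cst|
  by apply: bounded_mfunD => //; exact: bounded_mfun_cst|exact: bounded_mfun_cst].
rewrite !mean_cst//.
under eq_integral do rewrite EFinM.
rewrite ge0_integralZl//; last 2 first.
  by move=> x _; rewrite lee_fin.
  by rewrite lee_fin invr_ge0 ltW.
have ikf : (\int[mu]_x (k x)%:E)%E \is a fin_num by exact: integrable_fin_num.
rewrite -(fineK ikf) -EFinM -EFinB lee_fin.
have : c^-1 * fine (\int[mu]_x (k x)%:E)%E <= 1.
  by rewrite mulrC ler_pdivrMr// mul1r -lee_fin fineK.
lra.
Qed.

(** Here [a] is the factor by which [tau] changes the mass of a point. Both adding one particle and
    filling an empty block are instances. *)
Lemma integral_change_of_variables (m : {measure set T -> \bar R}) (P Q : set T)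
    (tau : T -> T) (a F : T -> R) :
  set_inj P tau -> tau @` P = Q -> (forall x, 0 <= a x) -> (forall x, 0 <= F x) ->
  (forall x, P x -> m [set tau x] = (a x)%:E * m [set x])%E ->
  \int[m]_x (\1_Q x * F x) = \int[m]_x (\1_P x * (a x * F (tau x))).
Proof.
move=> tinj tPQ a0 F0 mt; congr fine; rewrite !integral_esum; last 2 first.
- by move=> x; rewrite lee_fin !mulr_ge0// indicE ler0n.
- by move=> x; rewrite lee_fin mulr_ge0// indicE ler0n.
rewrite (_ : (\esum_(x in setT) _)%E = (\esum_(x in Q) ((F x)%:E * m [set x]))%E); last first.
  rewrite [RHS]esum_mkcond; apply: eq_esum => x _; rewrite indicE.
  by case: (x \in Q); rewrite ?mul1r ?mul0r ?mul0e.
rewrite [RHS](_ : _ = \esum_(x in P) ((a x * F (tau x))%:E * m [set x]))%E; last first.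
  rewrite [RHS]esum_mkcond; apply: eq_esum => x _; rewrite indicE.
  by case: (x \in P); rewrite ?mul1r ?mul0r ?mul0e.
rewrite -tPQ esum_image//.
apply: eq_esum => x Px; rewrite mt// EFinM muleA; congr (_ * _)%E.
by rewrite -EFinM mulrC.
Qed.

End countable_space.

Section config_expectation.
Context {R : realType} {I : finType}.

Lemma pickle_config_inj : injective (pickle : config I -> nat).
Proof. exact: (pcan_inj (@pickleK (config I))). Qed.

Lemma config_measurable (A : set (config I)) : measurable A.
Proof. by []. Qed.

Lemma bounded_mfun_config (F : config I -> R) : bounded_function F -> bounded_mfun F.
Proof. by move=> bF; split. Qed.

End config_expectation.

(** * The inverse of the mean density *)

Section fugacity.
Context {R : realType}.
Variable g : jump_rate R.

Definition inv_rate_fact (k : nat) : R := (rate_fact g k)^-1.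
Local Notation c := inv_rate_fact.

Lemma rate_gt0 k : (0 < k)%N -> 0 < g k.
Proof.
move=> k0; rewrite lt_neqAle rate_ge0 andbT eq_sym; apply/eqP => /rate_eq0.
by move=> k00; rewrite k00 in k0.
Qed.

Lemma rate_factS k : rate_fact g k.+1 = rate_fact g k * g k.+1.
Proof. by rewrite /rate_fact big_nat_recr. Qed.

Lemma rate_fact0 : rate_fact g 0 = 1.
Proof. by rewrite /rate_fact big_geq. Qed.

Lemma rate_fact_gt0 k : 0 < rate_fact g k.
Proof.
by elim: k => [|k IH]; rewrite ?rate_fact0// rate_factS mulr_gt0// rate_gt0.
Qed.

Lemma inv_rate_fact_gt0 k : 0 < c k.
Proof. by rewrite invr_gt0 rate_fact_gt0. Qed.

Lemma inv_rate_fact0 : c 0 = 1.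
Proof. by rewrite /c rate_fact0 invr1. Qed.

Lemma inv_rate_factS k : c k.+1 * g k.+1 = c k.
Proof.
have h := rate_gt0 (ltn0Sn k).
by rewrite /c rate_factS invfM -mulrA mulVf ?mulr1// gt_eqF.
Qed.

Local Hint Resolve inv_rate_fact_gt0 inv_rate_fact0 : core.

Lemma inv_rate_fact_ge (G : R) k : (forall k, g k <= G) -> 1 <= c k * G ^+ k.
Proof.
move=> gG; rewrite mulrC ler_pdivlMr ?rate_fact_gt0// mul1r.
elim: k => [|k IH]; first by rewrite rate_fact0.
rewrite rate_factS exprSr ler_pM// ?rate_ge0//; exact/ltW/rate_fact_gt0.
Qed.

Local Notation Zk := (trunc_Z c).
Local Notation Nk := (trunc_N c).

Lemma partition_term_ge0 (phi : R) k : 0 <= phi ->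
  (0 <= (phi ^+ k / rate_fact g k)%:E)%E.
Proof. by move=> p0; rewrite lee_fin divr_ge0 ?exprn_ge0 ?rate_fact_ge0. Qed.

Lemma trunc_Z_partial_sum (phi : R) k :
  (Zk phi k)%:E = (\sum_(0 <= j < k.+1) (phi ^+ j / rate_fact g j)%:E)%E.
Proof.
by rewrite sumEFin big_mkord; congr EFin; apply: eq_bigr => j _; rewrite mulrC.
Qed.

Lemma partition_function_ge (phi : R) k : 0 <= phi ->
  ((Zk phi k)%:E <= partition_function g phi)%E.
Proof.
move=> p0; rewrite trunc_Z_partial_sum.
by apply: nneseries_lim_ge => j *; exact: partition_term_ge0.
Qed.

Lemma nneseries_le_bound (u : nat -> \bar R) (M : \bar R) :
  (forall k, (0 <= u k)%E) -> (forall k, (\sum_(0 <= j < k.+1) u j <= M)%E) ->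
  (\sum_(0 <= j <oo) u j <= M)%E.
Proof.
move=> u0 HM; apply: lime_le; first exact: is_cvg_nneseries.
near=> k; have : (0 < k)%N by near: k; exact: nbhs_infty_gt.
by case: (k) => // j _; exact: HM.
Unshelve. all: by end_near. Qed.

Lemma partition_function_le (phi M : R) : 0 <= phi ->
  (forall k, Zk phi k <= M) -> (partition_function g phi <= M%:E)%E.
Proof.
move=> p0 HM; apply: nneseries_le_bound => k; first exact: partition_term_ge0.
by rewrite -trunc_Z_partial_sum lee_fin.
Qed.

Lemma partition_domainP (phi : R) : partition_domain g phi <->
  0 <= phi /\ exists M, forall k, Zk phi k <= M.
Proof.
split=> [[p0 Zoo]|[p0 [M HM]]]; split=> //.
  exists (fine (partition_function g phi)) => k.
  rewrite -lee_fin fineK ?partition_function_ge//.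
  by rewrite ge0_fin_numE// (le_trans _ (partition_function_ge 0 p0))// lee_fin
    ltW// trunc_Z_gt0.
exact: le_lt_trans (partition_function_le p0 HM) (ltry _).
Qed.

Lemma partition_function_fin (phi : R) : partition_domain g phi ->
  (partition_function g phi)%E = (fine (partition_function g phi))%:E.
Proof.
move=> [p0 Zoo]; rewrite fineK// ge0_fin_numE//.
by apply: le_trans (partition_function_ge 0 p0); rewrite lee_fin ltW// trunc_Z_gt0.
Qed.

Lemma trunc_Z_le_partition (phi : R) k : partition_domain g phi ->
  Zk phi k <= fine (partition_function g phi).
Proof.
move=> D; rewrite -lee_fin -partition_function_fin//.
by case: D => p0 _; exact: partition_function_ge.
Qed.

Lemma fine_partition_gt0 (phi : R) : partition_domain g phi ->
  0 < fine (partition_function g phi).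
Proof.
move=> D; apply: lt_le_trans (trunc_Z_le_partition 0 D).
by case: D => p0 _; rewrite trunc_Z_gt0.
Qed.

Lemma site_pmf_ge0 (phi : R) k : 0 <= phi -> 0 <= site_pmf g phi k.
Proof.
move=> p0; rewrite mulr_ge0 ?invr_ge0 ?divr_ge0 ?exprn_ge0 ?rate_fact_ge0//.
by apply/fine_ge0/nneseries_ge0 => i _ _; exact: partition_term_ge0.
Qed.

Lemma site_measure_set1 (phi : R) k : partition_domain g phi ->
  site_measure g phi [set k] = (site_pmf g phi k)%:E.
Proof.
move=> D; rewrite /site_measure asboolT// esum_set1// lee_fin site_pmf_ge0//.
by case: D.
Qed.

Lemma mean_densityE (phi : R) : partition_domain g phi ->
  mean_density g phi = (((fine (partition_function g phi))^-1)%:E *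
    \sum_(0 <= k <oo) (k%:R * (c k * phi ^+ k))%:E)%E.
Proof.
move=> D; have p0 : 0 <= phi by case: D.
rewrite /mean_density (@integral_esum _ _ _ id)//.
have t0 k : (0 <= (k%:R * (c k * phi ^+ k))%:E)%E.
  by rewrite lee_fin !mulr_ge0 ?exprn_ge0// ltW.
rewrite -nneseriesZl; last by move=> k _.
rewrite nneseries_esumT; last first.
  move=> k; rewrite mule_ge0// lee_fin invr_ge0.
  by rewrite ltW// fine_partition_gt0.
apply: eq_esum => k _ /=; rewrite site_measure_set1// -!EFinM; congr EFin.
by rewrite /site_pmf /c; ring.
Qed.

(** The truncated means increase with the level to the full mean, so a bound on the full mean is the
    same as a bound on all of them. This links the density defined by an integral to [subcrit]. *)
Lemma mean_density_le (phi rho : R) : partition_domain g phi -> 0 <= rho ->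
  (mean_density g phi <= rho%:E)%E <-> (forall k, Nk phi k <= rho * Zk phi k).
Proof.
move=> D r0; have p0 : 0 <= phi by case: D.
rewrite mean_densityE// muleC lee_pdivrMr ?fine_partition_gt0//.
rewrite -EFinM; have Z0 := fine_partition_gt0 D.
have t0 k : (0 <= (k%:R * (c k * phi ^+ k))%:E)%E.
  by rewrite lee_fin !mulr_ge0 ?exprn_ge0// ltW.
have NE k : (\sum_(0 <= j < k.+1) (j%:R * (c j * phi ^+ j))%:E)%E = (Nk phi k)%:E.
  by rewrite sumEFin big_mkord.
split=> [H k|H]; last first.
  apply: nneseries_le_bound => // k; rewrite NE lee_fin.
  by apply: le_trans (H k) _; rewrite ler_wpM2l// trunc_Z_le_partition.
set Z := fine _ in H Z0 *.
have HN m : Nk phi m <= rho * Z.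
  rewrite -lee_fin -NE; apply: le_trans H.
  by apply: nneseries_lim_ge => j *; exact: t0.
have [->|N0] := eqVneq (Nk phi k) 0; first by rewrite mulr_ge0// ltW// trunc_Z_gt0.
have {}N0 : 0 < Nk phi k by rewrite lt_neqAle eq_sym N0 trunc_N_ge0.
have Zk0 := trunc_Z_gt0 inv_rate_fact_gt0 inv_rate_fact0 k p0.
have HZ m : Zk phi m <= rho * Z * Zk phi k / Nk phi k.
  apply: (@le_trans _ _ (Zk phi (m + k))); first by apply: trunc_Z_le => //; exact: leq_addr.
  rewrite ler_pdivlMr// mulrC.
  apply: le_trans (trunc_mean_homo_index _ _ p0 (leq_addl m k)) _ => //.
  by rewrite ler_pM2r.
have := partition_function_le p0 HZ.
rewrite partition_function_fin// lee_fin -/Z ler_pdivlMr// => h.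
by rewrite -(ler_pM2r Z0) mulrC (le_trans h)//; lra.
Qed.


Lemma mean_density_homo (a b : R) : 0 <= a -> a <= b -> partition_domain g b ->
  (mean_density g a <= mean_density g b)%E.
Proof.
move=> a0 ab Db; have b0 : 0 <= b by exact: le_trans ab.
have Da : partition_domain g a.
  apply/partition_domainP; split=> //; move/partition_domainP : Db => [_ [M HM]].
  exists M => k; apply: le_trans (HM k).
  exact: (trunc_Z_homo inv_rate_fact_gt0).
have t0 phi k : 0 <= phi -> (0 <= (k%:R * (c k * phi ^+ k))%:E)%E.
  by move=> p0; rewrite lee_fin !mulr_ge0 ?exprn_ge0// ltW.
have : (0 <= mean_density g b)%E.
  rewrite mean_densityE// mule_ge0 ?lee_fin ?invr_ge0 ?(ltW (fine_partition_gt0 Db))//.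
  by apply: nneseries_ge0 => *; exact: t0.
case Eb : (mean_density g b) => [r| |]// r0; last by rewrite leey.
apply/mean_density_le => // k; have : (mean_density g b <= r%:E)%E by rewrite Eb.
move=> /mean_density_le => /(_ Db r0) H.
by case: (subcrit_down inv_rate_fact_gt0 inv_rate_fact0 a0 ab (conj b0 H)).
Qed.

(** * Bounded rates: radius of convergence, critical density and [Phi] *)

Section bounded_rate.
Variable G : R.
Hypothesis G_ge1 : 1 <= G.
Hypothesis gG : forall k, g k <= G.

Local Notation cG := (fun j => inv_rate_fact_ge j gG).
Local Notation phis := (phistar c).

(** Root test: for s below the liminf of the roots, the terms at r < s are eventually dominated by
    the geometric series of ratio r / s. *)
Lemma trunc_Z_bounded_root (r s : R) : 0 <= r -> r < s -> (s%:E < phi_c g)%E ->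
  exists M, forall k, Zk r k <= M.
Proof.
move=> r0 rs; rewrite /phi_c limn_einf_lim => sphi.
set u := fun k => _ in sphi.
have [n Hn] : exists n, forall k, (n <= k)%N -> (s%:E <= u k)%E.
  apply: contrapT => /forallNP h; move: sphi; apply/negP; rewrite -leNgt.
  apply: lime_le; first exact: is_cvg_einfs.
  near=> n; have /existsNP[k /not_implyP[nk /negP]] := h n.
  rewrite -ltNge => /ltW; apply: le_trans.
  by apply: ereal_inf_lbound; exists k.
have s0 : 0 < s by exact: le_lt_trans rs.
pose q := r / s; have q0 : 0 <= q by rewrite divr_ge0// ltW.
have q1 : q < 1 by rewrite ltr_pdivrMr// mul1r.
have term k : (n <= k)%N -> (0 < k)%N -> c k * r ^+ k <= q ^+ k.
  move=> nk k0; have := Hn _ nk; rewrite /u lee_fin => h.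
  rewrite /c mulrC ler_pdivrMr ?rate_fact_gt0// expr_div_n mulrAC ler_pdivlMr ?exprn_gt0//.
  rewrite ler_wpM2l ?exprn_ge0//.
  have -> : rate_fact g k = (rate_fact g k `^ k%:R^-1) ^+ k.
    rewrite -powR_mulrn ?powR_ge0// -powRrM mulVf ?powRr1 ?ltW ?rate_fact_gt0//.
    by rewrite pnatr_eq0 -lt0n.
  by rewrite ler_pXn2r// nnegrE ?powR_ge0// ltW.
have H i : Zk r (n + i) <= Zk r n + (1 - q ^+ i) / (1 - q).
  have dq : 0 < 1 - q by rewrite subr_gt0.
  elim: i => [|i IH]; first by rewrite addn0 expr0 subrr mul0r addr0.
  rewrite addnS trunc_ZS.
  have h : c (n + i).+1 * r ^+ (n + i).+1 <= q ^+ i.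
    rewrite (le_trans (term _ _ _))//; first by rewrite (leq_trans (leq_addr i n)).
    by rewrite ler_wiXn2l// ?(ltW q1)//; lia.
  have -> : (1 - q ^+ i.+1) / (1 - q) = (1 - q ^+ i) / (1 - q) + q ^+ i.
    by rewrite exprS; field; rewrite gt_eqF.
  by lra.
exists (Zk r n + 1 / (1 - q)) => k.
apply: (@le_trans _ _ (Zk r (n + k))).
  by apply: trunc_Z_le => //; exact: leq_addl.
apply: le_trans (H k) _; rewrite lerD2l ler_pM2r ?invr_gt0 ?subr_gt0//.
by rewrite gerBl exprn_ge0.
Unshelve. all: by end_near. Qed.

(** Converse of the root test: bounded partial sums give phi^k <= M g!(k), and (s / phi)^k < 1 / M
    eventually, so s^k <= g!(k) for every s < phi. *)
Lemma le_phi_c_trunc_Z_bounded (phi M : R) : 0 <= phi ->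
  (forall k, Zk phi k <= M) -> (phi%:E <= phi_c g)%E.
Proof.
move=> p0 HM; have [->|pn0] := eqVneq phi 0; first exact/ltW/rate_phi_c_gt0.
have {}p0 : 0 < phi by rewrite lt_neqAle eq_sym pn0.
have M0 : 0 < M by apply: lt_le_trans (HM 0); rewrite trunc_Z_gt0// ltW.
suff H s : 0 < s -> s < phi -> (s%:E <= phi_c g)%E.
  apply/lee_addgt0Pr => e e0; have [e_lt|e_ge] := ltP e phi.
    rewrite -leeBlDr// -EFinB H ?subr_gt0// gtrBl//.
  rewrite (@le_trans _ _ e%:E) ?lee_fin// leeDr//; exact/ltW/rate_phi_c_gt0.
move=> s0 sphi; rewrite /phi_c limn_einf_lim.
apply: lime_ge; first exact: is_cvg_einfs.
have q1 : `|s / phi| < 1.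
  by rewrite ger0_norm ?divr_ge0 ?ltW// ltr_pdivrMr// mul1r.
have /cvgrPdist_lt/(_ M^-1) := cvg_expr q1.
rewrite invr_gt0 => /(_ M0)[n _ Hn].
near=> m; apply: le_ereal_inf_tmp => _ [k /= mk <-]; rewrite lee_fin.
have nk : (n <= k)%N by rewrite (leq_trans _ mk)//; near: m; exact: nbhs_infty_ge.
have k0 : (0 < k)%N by rewrite (leq_trans _ mk)//; near: m; exact: nbhs_infty_gt.
have q0 : 0 <= (s / phi) ^+ k by rewrite exprn_ge0// divr_ge0// ltW.
have := Hn k nk; rewrite sub0r normrN ger0_norm// => h.
have h2 : phi ^+ k <= M * rate_fact g k.
  rewrite mulrC -ler_pdivrMl ?rate_fact_gt0// -/(c k).
  apply: le_trans (HM k); rewrite /trunc_Z big_ord_recr/= lerDr.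
  by apply: sumr_ge0 => j _; rewrite mulr_ge0 ?exprn_ge0// ltW.
have h3 : s ^+ k <= rate_fact g k.
  move: h; rewrite expr_div_n ltr_pdivrMr ?exprn_gt0// => /ltW h.
  by apply: le_trans h _; rewrite ler_pdivrMl.
have -> : s = (s ^+ k) `^ k%:R^-1.
  rewrite -powR_mulrn ?ltW// -powRrM mulfV ?powRr1 ?ltW//.
  by rewrite pnatr_eq0 -lt0n.
by apply: ge0_ler_powR; rewrite ?invr_ge0// ?nnegrE ?exprn_ge0 ?ltW// rate_fact_gt0.
Unshelve. all: by end_near. Qed.

Lemma phi_c_leG : (phi_c g <= G%:E)%E.
Proof.
rewrite leNgt; apply/negP => h.
have G0 : 0 <= G by exact: le_trans G_ge1.
have [s Gs sphi] : exists2 s : R, G < s & (s%:E < phi_c g)%E.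
  move: h; case: (phi_c g) => [r| |]//; last by move=> _; exists (G + 1); rewrite ?ltry// ltrDl.
  by rewrite lte_fin => h; exists ((G + r) / 2); rewrite ?lte_fin midf_lt.
have [M HM] := trunc_Z_bounded_root G0 Gs sphi.
have hk k : k.+1%:R <= Zk G k.
  rewrite /trunc_Z -[k.+1 in leLHS]card_ord -sumr_const; apply: ler_sum => j _.
  exact: cG.
have := le_trans (hk (Num.bound `|M|)) (HM _); apply/negP; rewrite -ltNge.
apply: le_lt_trans (ler_norm _) _.
by apply: lt_trans (archi_boundP (normr_ge0 _)) _; rewrite ltr_nat.
Qed.

Definition pc : R := fine (phi_c g).

Lemma phi_cE : phi_c g = pc%:E.
Proof.
rewrite /pc fineK// fin_numE; have := rate_phi_c_gt0 g; have := phi_c_leG.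
by case: (phi_c g).
Qed.

Lemma pc_gt0 : 0 < pc.
Proof. by rewrite -lte_fin -phi_cE; exact: rate_phi_c_gt0. Qed.

Lemma lt_pc_domain (r : R) : 0 <= r -> r < pc -> partition_domain g r.
Proof.
move=> r0 rp; apply/partition_domainP; split=> //.
apply: (trunc_Z_bounded_root (s := (r + pc) / 2)) => //; first by rewrite midf_lt.
by rewrite phi_cE lte_fin midf_lt.
Qed.

Lemma domain_le_pc (r : R) : partition_domain g r -> r <= pc.
Proof.
move=> /partition_domainP[r0 [M HM]].
by rewrite -lee_fin -phi_cE; exact: le_phi_c_trunc_Z_bounded HM.
Qed.

(** The mean density increases on [0, phi_c), so its left limit is a supremum; the substitution y =
    phi_c - phi turns it into a right limit at 0. *)
Lemma rho_cE : rho_c g = ereal_sup [set mean_density g x | x in `[0, pc[%classic].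
Proof.
rewrite /rho_c phi_cE; have pc0 := pc_gt0.
have near_left (U : set (\bar R)) :
    within [set phi | (phi < pc%:E)%E] (nbhs pc%:E) U <-> \forall y \near pc^'-, U y%:E.
  split=> [|h].
    by move=> /nbhs_EFin; apply: filterS => y h yp; exact: h.
  have {}h : \forall x \near pc, x < pc -> U x%:E := h.
  by apply/nbhs_EFin; apply: filterS h => y h yp; exact: h.
have FF : ProperFilter (within [set phi | (phi < pc%:E)%E] (nbhs pc%:E)).
  apply: Build_ProperFilter_ex => U /near_left h.
  by have [y Uy] := @filter_ex _ (at_left pc) _ _ h; exists y%:E.
apply: cvg_lim => //.
have H : mean_density g (pc - y) @[y --> 0^'+] -->
    ereal_sup ((fun y => mean_density g (pc - y)) @` `]0, pc]).
  apply: nonincreasing_at_right_cvge; first by rewrite bnd_simp.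
  move=> x y; rewrite !in_itv/= => /andP[x0 xp] /andP[y0 yp] xy.
  apply: mean_density_homo; rewrite ?subr_ge0 ?lerD2l ?lerN2//.
  by apply: lt_pc_domain; rewrite ?subr_ge0// ltrBlDr ltrDl.
rewrite [X in ereal_sup X](_ : _ = ((fun y => mean_density g (pc - y)) @` `]0, pc])); last first.
  apply/seteqP; split => _ [x /= + <-]; rewrite in_itv/= => /andP[x0 xp].
    exists (pc - x); last by congr mean_density; ring.
    by rewrite /= in_itv/= subr_gt0 xp/= gerBl.
  exists (pc - x) => //; rewrite /= in_itv/= subr_ge0 xp/=.
  by rewrite ltrBlDr ltrDl.
move=> U /H[e /= e0 He]; apply/near_left; exists e => //= y ye ypc.
have E : pc - (pc - y) = y by ring.
have := He (pc - y); rewrite /= E; apply.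
  by rewrite /ball_/= sub0r normrN.
by rewrite subr_gt0.
Qed.

Lemma mean_density_le_rho_c (x : R) : 0 <= x -> x < pc ->
  (mean_density g x <= rho_c g)%E.
Proof.
move=> x0 xp; rewrite rho_cE; apply: ereal_sup_ubound; exists x => //=.
by rewrite in_itv/= x0.
Qed.

Lemma lt_rho_c (y : \bar R) : (y < rho_c g)%E ->
  exists x, [/\ 0 <= x, x < pc & (y < mean_density g x)%E].
Proof.
rewrite rho_cE => /ereal_sup_gt[_ [x /= + <-] yx].
by rewrite in_itv/= => /andP[x0 xp]; exists x.
Qed.

Lemma rho_c_ge0 : (0 <= rho_c g)%E.
Proof.
apply: le_trans (mean_density_le_rho_c (lexx 0) pc_gt0).
by apply: integral_ge0 => k _; rewrite lee_fin.
Qed.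

Lemma subcrit_domain rho phi : subcrit c rho phi -> partition_domain g phi.
Proof.
move=> H; apply/partition_domainP; split; first by case: H.
exact: (subcrit_bounded inv_rate_fact_gt0 inv_rate_fact0 H).
Qed.

Lemma mean_density_ge0 phi : (0 <= mean_density g phi)%E.
Proof. by apply: integral_ge0 => k _; rewrite lee_fin. Qed.

Lemma phistar_domain rho : 0 <= rho -> partition_domain g (phis rho).
Proof.
move=> r0; apply: (@subcrit_domain rho).
exact: (phistar_subcrit inv_rate_fact_gt0 inv_rate_fact0 G_ge1 cG).
Qed.

Lemma mean_density_phistar_le rho : 0 <= rho -> (mean_density g (phis rho) <= rho%:E)%E.
Proof.
move=> r0; apply/mean_density_le => //; first exact: phistar_domain.
by case: (phistar_subcrit inv_rate_fact_gt0 inv_rate_fact0 G_ge1 cG r0).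
Qed.

(** The mean at [phis rho] does not exceed [rho_c]: below phi_c it belongs to the supremum that
    defines [rho_c], and at phi_c it is controlled by the values to the left. It cannot be smaller
    than both rho and [rho_c], because [subcrit_step] would then enlarge the supremum [phis rho]. *)
Lemma mean_density_phistar rho : 0 <= rho ->
  mean_density g (phis rho) = Order.min rho%:E (rho_c g).
Proof.
move=> r0; have D := phistar_domain r0; have mle := mean_density_phistar_le r0.
have ps0 : 0 <= phis rho by case: D.
apply/eqP; rewrite eq_le le_min mle/=; apply/andP; split.
  have [pslt|psge] := ltP (phis rho) pc; first exact: mean_density_le_rho_c.
  have -> : phis rho = pc by apply/eqP; rewrite eq_le psge domain_le_pc.
  have Dpc : partition_domain g pc.
    by have <- : phis rho = pc by apply/eqP; rewrite eq_le psge domain_le_pc.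
  case Er : (rho_c g) => [r| |]; [|by rewrite leey|by have := rho_c_ge0; rewrite Er].
  have rr0 : 0 <= r by have := rho_c_ge0; rewrite Er lee_fin.
  apply/mean_density_le => //.
  (* Every fugacity below phi_c is subcritical for the density r = [rho_c], so the supremum [phis r]
     reaches phi_c. *)
  have pcr : pc <= phis r.
    rewrite leNgt; apply/negP => rpc; have [y /andP[y1 y2]] : exists y, phis r < y < pc.
      by exists ((phis r + pc) / 2); rewrite !midf_lt.
    have y0 : 0 <= y.
      rewrite (le_trans _ (ltW y1))//.
      exact: (phistar_ge0 inv_rate_fact_gt0 inv_rate_fact0 G_ge1 cG).
    have : subcrit c r y.
      split=> //; apply/mean_density_le => //; first exact: lt_pc_domain.
      by rewrite -Er mean_density_le_rho_c.
    move=> /(subcrit_le_phistar inv_rate_fact_gt0 inv_rate_fact0 G_ge1 cG rr0).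
    by rewrite leNgt y1.
  have := phistar_subcrit inv_rate_fact_gt0 inv_rate_fact0 G_ge1 cG rr0.
  by move=> /(subcrit_down inv_rate_fact_gt0 inv_rate_fact0 (ltW pc_gt0) pcr)[].
rewrite leNgt; apply/negP; rewrite lt_min => /andP[mrho mrc].
(* A mean density at some x < phi_c exceeds the one at [phis rho]; by monotonicity [phis rho] < x,
   which leaves room on the right inside the region of convergence. *)
have [x [x0 xpc mx]] := lt_rho_c mrc.
have [q Eq] : exists q, mean_density g (phis rho) = q%:E.
  move: mrho; have := mean_density_ge0 (phis rho).
  by case: (mean_density _ _) => // q; exists q.
have q0 : 0 <= q by rewrite -lee_fin -Eq mean_density_ge0.
move: mrho mx; rewrite Eq lte_fin => qrho mx.
have psx : phis rho < x.
  rewrite ltNge; apply/negP => xps.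
  by have := mean_density_homo x0 xps D; rewrite Eq leNgt mx.
pose y := (x + pc) / 2.
have xy : x < y by rewrite midf_lt.
have ypc : y < pc by rewrite midf_lt.
have /partition_domainP[_ [M HM]] : partition_domain g y.
  by apply: lt_pc_domain => //; rewrite (le_trans x0)// ltW.
have HN k : Nk x k <= x / (y - x) * M.
  apply: le_trans (trunc_N_bound inv_rate_fact_gt0 k x0 xy) _.
  by apply: ler_wpM2l (HM k); rewrite divr_ge0// subr_ge0 ltW.
have sq : subcrit c q (phis rho).
  by split=> //; apply/mean_density_le => //; rewrite Eq.
have [z pz /(subcrit_le_phistar inv_rate_fact_gt0 inv_rate_fact0 G_ge1 cG r0)] :=
  subcrit_step inv_rate_fact_gt0 inv_rate_fact0 ps0 psx r0 qrho sq HN.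
by rewrite leNgt pz.
Qed.

Lemma mean_density_inj (a b rho : R) : partition_domain g a ->
  partition_domain g b -> 0 <= rho -> mean_density g a = rho%:E ->
  mean_density g b = rho%:E -> a = b.
Proof.
move=> + + r0; wlog ab : a b / a <= b => [H Da Db ma mb|Da Db ma mb].
  by have [ab|/ltW ba] := leP a b; [exact: H|apply/esym; exact: H].
apply/eqP; rewrite eq_le ab leNgt; apply/negP => lab.
have a0 : 0 <= a by case: Da.
have sb : subcrit c rho b.
  by split; [case: Db|apply/mean_density_le => //; rewrite mb].
have [k k0 [_ ha]] := subcrit_gap inv_rate_fact_gt0 inv_rate_fact0 a0 lab sb.
have rk : 0 <= rho - k.
  by have := ha 0; rewrite trunc_N0 trunc_Z0 ?mulr1.
by have /(mean_density_le Da rk) := ha; rewrite ma lee_fin; lra.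
Qed.

Lemma PhiE (m : R) phi : partition_domain g phi -> mean_density g phi = m%:E ->
  Phi g m = phi.
Proof.
move=> D mE; have m0 : 0 <= m by rewrite -lee_fin -mE mean_density_ge0.
rewrite /Phi; case: xgetP => [x _ [Dx mx]|/(_ phi)]; first exact: mean_density_inj mE.
by move=> /not_andP[].
Qed.

Lemma Phi_min_rho_c rho : 0 <= rho -> Phi g (min_rho_c g rho) = phis rho.
Proof.
move=> r0; apply: PhiE; first exact: phistar_domain.
rewrite mean_density_phistar// /min_rho_c fineK// fin_numE.
rewrite -mean_density_phistar//; have := mean_density_ge0 (phis rho).
by have := mean_density_phistar_le r0; case: (mean_density _ _).
Qed.

(** The strict inequality below phi_c gives the reference measure an exponential moment of the
    particle number. It holds since [rho_c] is a supremum of means to the left of phi_c and some of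
    them exceed rho. *)
Lemma Phi_subcritical rho : 0 <= rho -> (rho%:E < rho_c g)%E ->
  Phi g rho = phis rho /\ phis rho < pc.
Proof.
move=> r0 rlt; have mE : mean_density g (phis rho) = rho%:E.
  by rewrite mean_density_phistar// min_l// ltW.
split; first by apply: PhiE => //; exact: phistar_domain.
rewrite ltNge; apply/negP => pcle.
have [x [x0 xpc]] := lt_rho_c rlt; rewrite -mE.
have D := phistar_domain r0.
rewrite ltNge mean_density_homo//.
by rewrite (le_trans (ltW xpc)).
Qed.

Lemma rate_phistar_gt0 rho : 0 < rho -> 0 < phis rho.
Proof.
move=> r0; have pc2 : 0 < pc / 2 by rewrite divr_gt0// pc_gt0.
have /partition_domainP[_ [M HM]] : partition_domain g (pc / 2).
  by apply: lt_pc_domain; rewrite ?ltW// ltr_pdivrMr// mulr_natr mulr2n ltrDl pc_gt0.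
exact: (phistar_gt0 inv_rate_fact_gt0 inv_rate_fact0 G_ge1 cG pc2 HM).
Qed.

End bounded_rate.
End fugacity.

(** * Equivalence of ensembles *)

Section canonical_sums.
Context {R : realType}.
Variable g : jump_rate R.
Local Notation c := (inv_rate_fact g).
Local Notation Zk := (trunc_Z c).
Local Notation Nk := (trunc_N c).

Definition config_of {J : finType} {M : nat} (f : {ffun J -> 'I_M.+1}) : config J :=
  [ffun j => f j : nat].

Definition particles {J : finType} (xi : config J) : nat := (\sum_j xi j)%N.

Definition weight {J : finType} (xi : config J) : R := \prod_j c (xi j).

(** Unnormalised canonical expectation: with F = 1 it is the canonical partition function. Bounding
    the occupation numbers by M makes the sum finite and is no restriction when K <= M. *)
Definition canonical_sum (J : finType) (M K : nat) (F : config J -> R) : R :=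
  \sum_(f : {ffun J -> 'I_M.+1} | particles (config_of f) == K)
     weight (config_of f) * F (config_of f).

Lemma weight_gt0 (J : finType) (xi : config J) : 0 < weight xi.
Proof. by apply: prodr_gt0 => j _; exact: inv_rate_fact_gt0. Qed.

Lemma canonical_sum_le (J : finType) M K (F F' : config J -> R) :
  (forall xi, particles xi = K -> F xi <= F' xi) ->
  canonical_sum M K F <= canonical_sum M K F'.
Proof.
move=> H; apply: ler_sum => f /eqP fK; rewrite ler_wpM2l ?H//.
exact/ltW/weight_gt0.
Qed.

Lemma canonical_sumD (J : finType) M K (F F' : config J -> R) :
  canonical_sum M K (fun xi => F xi + F' xi) =
  canonical_sum M K F + canonical_sum M K F'.
Proof. by rewrite -big_split; apply: eq_bigr => f _; rewrite mulrDr. Qed.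

Lemma canonical_sumZ (J : finType) M K a (F : config J -> R) :
  canonical_sum M K (fun xi => a * F xi) = a * canonical_sum M K F.
Proof. by rewrite mulr_sumr; apply: eq_bigr => f _; rewrite mulrCA. Qed.

Lemma canonical_sum_ge0 (J : finType) M K (F : config J -> R) :
  (forall xi, 0 <= F xi) -> 0 <= canonical_sum M K F.
Proof.
by move=> F0; apply: sumr_ge0 => f _; rewrite mulr_ge0// ltW// weight_gt0.
Qed.

Lemma ler_sum_inj (I I' : finType) (P : pred I) (Q : pred I') (h : I -> I')
    (F : I' -> R) : {in P &, injective h} -> (forall x, P x -> Q (h x)) ->
  (forall y, 0 <= F y) -> \sum_(x | P x) F (h x) <= \sum_(y | Q y) F y.
Proof.
move=> hi PQ F0; rewrite -big_imset//= [leRHS](bigID (mem (h @: P)))/=.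
rewrite [X in _ <= X + _](_ : _ = \sum_(y in h @: P) F y).
  by rewrite lerDl sumr_ge0.
apply: eq_bigl => y; apply/andP/idP => [[]//|yh]; split=> //.
by move/imsetP : yh => [x Px ->]; exact: PQ.
Qed.

Lemma product_sum (J : finType) (M : nat) (a : nat -> R) :
  \sum_(f : {ffun J -> 'I_M.+1}) \prod_j a (config_of f j) =
  (\sum_(k < M.+1) a k) ^+ #|J|.
Proof.
rewrite -prodr_const bigA_distr_bigA/=; apply: eq_bigr => f _.
by apply: eq_bigr => j _; rewrite ffunE.
Qed.

Lemma weight_expr (J : finType) (phi : R) (xi : config J) :
  weight xi * phi ^+ particles xi = \prod_j (c (xi j) * phi ^+ xi j).
Proof. by rewrite /weight /particles -prodrXr -big_split. Qed.

Lemma expR_quadratic (y : R) : `|y| <= 2^-1 -> expR y <= 1 + y + 2 * y ^+ 2.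
Proof.
rewrite ler_norml => /andP[y1 y2]; have p : 0 < 1 - y by lra.
have h : expR y <= (1 - y)^-1.
  rewrite -[y in leLHS]opprK expRN lef_pV2 ?posrE ?expR_gt0//.
  exact: expR_ge1Dx.
apply: le_trans h _; rewrite -[leLHS]mul1r ler_pdivrMr//.
have q : 0 <= y ^+ 2 * (1 - 2 * y) by rewrite mulr_ge0 ?sqr_ge0//; lra.
by move: q; rewrite !expr2; lra.
Qed.

Lemma one_site_exp (k : nat) (a h : nat -> R) (b s mu : R) :
  (forall j, 0 <= a j) -> (forall j, (j <= k)%N -> `|h j| <= b) -> 0 <= s -> s * b <= 2^-1 ->
  \sum_(j < k.+1) a j * h j <= mu ->
  \sum_(j < k.+1) a j * expR (s * h j) <=
    (\sum_(j < k.+1) a j) * (1 + 2 * (s * b) ^+ 2) + s * mu.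
Proof.
move=> a0 hb s0 sb Hmu.
have H j : (j <= k)%N -> a j * expR (s * h j) <= a j * (1 + 2 * (s * b) ^+ 2) + s * (a j * h j).
  move=> jk; have shb : `|s * h j| <= s * b.
    by rewrite normrM (ger0_norm s0) ler_wpM2l// hb.
  have := expR_quadratic (le_trans shb sb) => e1.
  have e2 : (s * h j) ^+ 2 <= (s * b) ^+ 2.
    by rewrite -real_normK ?num_real// ler_pXn2r// ?nnegrE// (le_trans _ shb).
  have e3 : expR (s * h j) <= 1 + 2 * (s * b) ^+ 2 + s * h j by lra.
  by have := ler_wpM2l (a0 j) e3; rewrite mulrDr [a j * (s * _)]mulrCA.
apply: le_trans (_ : \sum_(j < k.+1) (a j * (1 + 2 * (s * b) ^+ 2) + s * (a j * h j)) <= _).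
  by apply: ler_sum => j _; apply: H; rewrite -ltnS.
by rewrite big_split/= -mulr_suml -mulr_sumr lerD2l ler_wpM2l.
Qed.

(** Times phi^K, the canonical sum is one layer of a sum of nonnegative product terms over all
    particle numbers, and the full sum factorises over the sites. *)
Lemma canonical_exp_moment (J : finType) M K (phi s : R) (h : nat -> R) : 0 < phi ->
  canonical_sum M K (fun xi : config J => expR (s * \sum_j h (xi j))) * phi ^+ K <=
  (\sum_(k < M.+1) (c k * phi ^+ k) * expR (s * h k)) ^+ #|J|.
Proof.
move=> p0; rewrite -(product_sum _ _ (fun k => c k * phi ^+ k * expR (s * h k))).
rewrite /canonical_sum mulr_suml.
have E (xi : config J) : particles xi = K ->
    weight xi * expR (s * \sum_j h (xi j)) * phi ^+ K =
    \prod_j (c (xi j) * phi ^+ xi j * expR (s * h (xi j))).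
  move=> <-; rewrite mulrAC weight_expr mulr_sumr expR_sum -big_split/=.
  by [].
rewrite (eq_bigr (fun f : {ffun J -> 'I_M.+1} => \prod_j (c (config_of f j) *
    phi ^+ config_of f j * expR (s * h (config_of f j))))); last first.
  by move=> f /eqP /E.
rewrite [leRHS](bigID (fun f => particles (config_of f) == K))/=.
rewrite lerDl; apply: sumr_ge0 => f _; apply: prodr_ge0 => j _.
by rewrite !mulr_ge0 ?expR_ge0 ?exprn_ge0// ltW// inv_rate_fact_gt0.
Qed.

Section bounded_rate.
Variable G : R.
Hypothesis G_ge1 : 1 <= G.
Hypothesis gG : forall k, g k <= G.
Local Notation phis := (phistar c).

Lemma inv_rate_fact_fill k i : c k <= G ^+ i * c (k + i).
Proof.
elim: i => [|i IH]; first by rewrite expr0 mul1r addn0.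
apply: le_trans IH _; rewrite exprSr -mulrA ler_wpM2l ?exprn_ge0//.
  exact: le_trans G_ge1.
rewrite addnS -(inv_rate_factS g (k + i)) mulrC ler_wpM2r//.
exact/ltW/inv_rate_fact_gt0.
Qed.

(* Putting i further particles on one site costs at most a factor G^i. *)
Lemma canonical_fill (J : finType) (x0 : J) k M K i :
  (k <= M)%N -> (K <= M)%N -> (i <= K)%N ->
  @canonical_sum J k (K - i) (fun=> 1) <= G ^+ i * @canonical_sum J M K (fun=> 1).
Proof.
move=> kM KM iK; have G0 : 0 <= G by exact: le_trans G_ge1.
pose h (f : {ffun J -> 'I_k.+1}) : {ffun J -> 'I_M.+1} :=
  [ffun j => inord (f j + (j == x0) * i)].
have partE (f : {ffun J -> 'I_k.+1}) : particles (config_of f) == (K - i)%N ->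
    forall j, (f j + (j == x0) * i <= M)%N.
  move=> /eqP fK j; have [->|_] := eqVneq j x0; last first.
    by rewrite mul0n addn0 (leq_trans _ kM)// -ltnS.
  rewrite mul1n; apply: leq_trans KM; rewrite -(subnK iK) leq_add2r -fK.
  rewrite /particles (bigD1 x0)//= ffunE; exact: leq_addr.
have hE f : particles (config_of f) == (K - i)%N ->
    forall j, config_of (h f) j = (config_of f j + (j == x0) * i)%N.
  by move=> fK j; rewrite !ffunE inordK// ltnS partE.
apply: (@le_trans _ _ (\sum_(f : {ffun J -> 'I_k.+1} |
    particles (config_of f) == (K - i)%N) G ^+ i * weight (config_of (h f)))).
  apply: ler_sum => f fK; rewrite mulr1 /weight (bigD1 x0)//= [in leRHS](bigD1 x0)//=.
  rewrite mulrA (hE f fK) eqxx mul1n.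
  rewrite (eq_bigr (fun j => c (config_of (h f) j))); last first.
    by move=> j /negbTE jx; rewrite (hE f fK) jx mul0n addn0.
  apply: ler_wpM2r; last exact: inv_rate_fact_fill.
  by apply: prodr_ge0 => j _; exact/ltW/inv_rate_fact_gt0.
rewrite -mulr_sumr; apply: ler_wpM2l; first by rewrite exprn_ge0.
rewrite /canonical_sum; under [leRHS]eq_bigr do rewrite mulr1.
apply: (ler_sum_inj (F := fun f => weight (config_of f))) => [f f' Pf Pf' hh|f Pf|f].
- apply/ffunP => j; apply: val_inj => /=.
  have := hE f Pf j; rewrite hh (hE f' Pf') !ffunE => /eqP.
  by rewrite eqn_add2r => /eqP.
- rewrite /particles; under eq_bigr do rewrite (hE f Pf).
  rewrite big_split/= [X in (_ + X)%N](bigD1 x0)//= eqxx mul1n.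
  rewrite [X in (i + X)%N]big1 ?addn0; last by move=> j /negbTE ->.
  by move: Pf; rewrite /particles => /eqP ->; rewrite subnK.
- exact/ltW/weight_gt0.
Qed.

(** [canonical_fill] is applied to each of the m + 1 particle numbers K - i. Only the left-hand side
    is truncated at k, as the site that receives the missing particles may exceed k. *)
Lemma window_le (J : finType) (x0 : J) k M K m (phi B : R) :
  (k <= M)%N -> (K <= M)%N -> 0 < phi -> 1 <= B -> G / phi <= B ->
  \sum_(f : {ffun J -> 'I_k.+1} | (K - m <= particles (config_of f) <= K)%N)
     weight (config_of f) * phi ^+ particles (config_of f)
  <= m.+1%:R * (B ^+ m * (phi ^+ K * @canonical_sum J M K (fun=> 1))).
Proof.
move=> kM KM p0 B1 GB.
pose X := @canonical_sum J M K (fun=> 1).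
have G0 : 0 <= G by exact: le_trans G_ge1.
have X0 : 0 <= X by apply: canonical_sum_ge0.
pose Q (i : 'I_m.+1) (f : {ffun J -> 'I_k.+1}) :=
  (i <= K)%N && (particles (config_of f) == (K - i)%N).
pose u (f : {ffun J -> 'I_k.+1}) := weight (config_of f) * phi ^+ particles (config_of f).
have u0 f : 0 <= u f by rewrite mulr_ge0 ?exprn_ge0 ?ltW// weight_gt0.
apply: (@le_trans _ _ (\sum_(i < m.+1) \sum_(f : {ffun J -> 'I_k.+1} | Q i f) u f)).
  rewrite (exchange_big_dep (fun=> true))//= [leRHS](bigID
    (fun f : {ffun J -> 'I_k.+1} => (K - m <= particles (config_of f) <= K)%N))/=.
  rewrite -[leLHS]addr0 lerD//; last by apply: sumr_ge0 => f _; exact: sumr_ge0.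
  apply: ler_sum => f /andP[f1 f2].
  have im : (K - particles (config_of f) < m.+1)%N by lia.
  rewrite (bigD1 (Ordinal im))/=; last by rewrite /Q/= leq_subr/= subKn.
  by rewrite lerDl sumr_ge0.
rewrite -[m.+1 in leRHS]card_ord mulr_natl -sumr_const.
apply: ler_sum => i _; have [iK|Ki] := leqP i K; last first.
  rewrite big_pred0; last by move=> f; rewrite /Q leqNgt Ki.
  by rewrite !mulr_ge0 ?exprn_ge0 ?(ltW p0)// (le_trans ler01).
rewrite (eq_bigl (fun f : {ffun J -> 'I_k.+1} =>
    particles (config_of f) == (K - i)%N)); last by move=> f; rewrite /Q iK.
rewrite (eq_bigr (fun f => weight (config_of f) * 1 * phi ^+ (K - i))); last first.
  by move=> f /eqP fK; rewrite /u fK mulr1.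
rewrite -mulr_suml mulrC.
apply: le_trans (ler_wpM2l _ (canonical_fill x0 kM KM iK)) _.
  by rewrite exprn_ge0// ltW.
have -> : phi ^+ (K - i) * (G ^+ i * X) = (G / phi) ^+ i * (phi ^+ K * X).
  rewrite -{2}(subnK iK) exprD expr_div_n.
  by field; rewrite expf_neq0// gt_eqF.
apply: ler_wpM2r; first by rewrite mulr_ge0// exprn_ge0// ltW.
apply: (@le_trans _ _ (B ^+ i)).
  rewrite lerXn2r// nnegrE ?divr_ge0// ?(ltW p0)//; exact: le_trans B1.
by rewrite ler_weXn2l// -ltnS.
Qed.

Lemma product_exp_moment (J : finType) k (phi s : R) (h : nat -> R) :
  \sum_(f : {ffun J -> 'I_k.+1}) weight (config_of f) * phi ^+ particles (config_of f)
     * expR (s * \sum_j h (config_of f j)) =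
  (\sum_(i < k.+1) (c i * phi ^+ i) * expR (s * h i)) ^+ #|J|.
Proof.
rewrite -(product_sum _ _ (fun k => c k * phi ^+ k * expR (s * h k))).
by apply: eq_bigr => f _; rewrite weight_expr mulr_sumr expR_sum -big_split.
Qed.

Lemma expr_exp_bound (Z x : R) n : 0 <= Z -> 0 <= x ->
  (Z * (1 + x)) ^+ n <= Z ^+ n * expR (n%:R * x).
Proof.
move=> Z0 x0; rewrite exprMn; apply: ler_wpM2l; first exact: exprn_ge0.
rewrite expRM_natl; apply: lerXn2r; rewrite ?nnegrE ?expR_ge0 ?addr_ge0//.
exact: expR_ge1Dx.
Qed.

(** Chernoff bounds in both directions for the product law truncated at k, whose one-site mean is
    rho by hypothesis and whose occupation numbers are bounded. *)
Lemma truncated_concentration (J : finType) k (phi rho b e : R) : 0 < phi ->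
  0 < b -> (forall j, (j <= k)%N -> `|j%:R - rho| <= b) -> 0 < e -> e <= 2 * b ->
  Nk phi k = rho * Zk phi k ->
  Zk phi k ^+ #|J| * (1 - 2 * expR (- (#|J|%:R * (e ^+ 2 / (8 * b ^+ 2))))) <=
  \sum_(f : {ffun J -> 'I_k.+1} |
      `|(particles (config_of f))%:R - rho * #|J|%:R| <= e * #|J|%:R)
     weight (config_of f) * phi ^+ particles (config_of f).
Proof.
move=> p0 b0 hb e0 eb NZ; set n := #|J|.
pose P (f : {ffun J -> 'I_k.+1}) :=
  `|(particles (config_of f))%:R - rho * n%:R| <= e * n%:R.
(* Minimises - s e + 2 (s b)^2, with the value - e^2 / (8 b^2). *)
pose s := e / (4 * b ^+ 2).
have s0 : 0 < s by rewrite divr_gt0// mulr_gt0// exprn_gt0.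
have sb : s * b <= 2^-1.
  have -> : s * b = e / (4 * b) by rewrite /s; field; rewrite gt_eqF.
  by rewrite ler_pdivrMr ?mulr_gt0//; lra.
pose u (f : {ffun J -> 'I_k.+1}) := weight (config_of f) * phi ^+ particles (config_of f).
have u0 f : 0 <= u f by rewrite mulr_ge0 ?exprn_ge0 ?ltW// weight_gt0.
have a0 j : 0 <= c j * phi ^+ j by rewrite mulr_ge0 ?exprn_ge0 ?ltW// inv_rate_fact_gt0.
have Z0 : 0 <= Zk phi k by apply: sumr_ge0.
have DE (f : {ffun J -> 'I_k.+1}) (r : R) : \sum_j (r * ((config_of f j)%:R - rho)) =
    r * ((particles (config_of f))%:R - rho * n%:R).
  by rewrite -mulr_sumr sumrB -natr_sum sumr_const mulr_natr.
have H (r : R) : `|r| = 1 ->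
    \sum_(f : {ffun J -> 'I_k.+1}) u f *
       expR (s * (r * ((particles (config_of f))%:R - rho * n%:R)) - s * e * n%:R)
    <= Zk phi k ^+ n * expR (- (n%:R * (e ^+ 2 / (8 * b ^+ 2)))).
  move=> r1; under eq_bigr do rewrite -DE expRD mulrA.
  rewrite -mulr_suml (product_exp_moment _ _ _ _ (fun j => r * (j%:R - rho))).
  have h1 : \sum_(i < k.+1) c i * phi ^+ i * expR (s * (r * (i%:R - rho))) <=
     Zk phi k * (1 + 2 * (s * b) ^+ 2).
    rewrite -[leRHS]addr0 -[X in _ + X](mulr0 s).
    apply: (@one_site_exp k (fun i => c i * phi ^+ i) (fun i => r * (i%:R - rho))
      b s 0) => //.
    - by move=> j jk; rewrite normrM r1 mul1r hb.
    - exact: ltW.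
    - rewrite (eq_bigr (fun i : 'I_k.+1 => r * (i%:R * (c i * phi ^+ i) - rho * (c i * phi ^+ i)))).
        by rewrite -mulr_sumr sumrB -!mulr_sumr -/(Nk phi k) -/(Zk phi k) NZ subrr mulr0.
      by move=> i _; ring.
  have h2 : 0 <= \sum_(i < k.+1) c i * phi ^+ i * expR (s * (r * (i%:R - rho))).
    by apply: sumr_ge0 => i _; rewrite mulr_ge0 ?expR_ge0.
  have q0 : 0 <= 2 * (s * b) ^+ 2 by rewrite mulr_ge0// sqr_ge0.
  have h3 := le_trans (lerXn2r n h2 (le_trans h2 h1) h1) (expr_exp_bound n Z0 q0).
  apply: le_trans (ler_wpM2r (expR_ge0 _) h3) _.
  rewrite -[leLHS]mulrA -expRD ler_wpM2l ?exprn_ge0// ler_expR le_eqVlt.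
  apply/orP; left.
  by apply/eqP; rewrite /s; field; rewrite gt_eqF.
have tot : Zk phi k ^+ n = \sum_(f | P f) u f + \sum_(f | ~~ P f) u f.
  rewrite (_ : Zk phi k = \sum_(i < k.+1) c i * phi ^+ i * expR (0 * 0)); last first.
    by apply: eq_bigr => i _; rewrite mul0r expR0 mulr1.
  rewrite -(product_exp_moment _ _ _ _ (fun=> 0)) (bigID P)/=.
  by congr (_ + _); apply: eq_bigr => f _; rewrite mul0r expR0 mulr1.
have out : \sum_(f | ~~ P f) u f <=
    2 * (Zk phi k ^+ n * expR (- (n%:R * (e ^+ 2 / (8 * b ^+ 2))))).
  rewrite mulr2n mulrDl mul1r.
  apply: le_trans (lerD (H 1 (normr1 _)) (H (-1) _)); last by rewrite normrN1.
  rewrite -big_split/= [leRHS](bigID P)/= -[leLHS]add0r lerD//.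
    by apply: sumr_ge0 => f _; rewrite addr_ge0// mulr_ge0// expR_ge0.
  apply: ler_sum => f; rewrite /P -ltNge => Pf; rewrite -mulrDr ler_peMr//.
  set D := _ - _ in Pf *; have [D0|D0] := leP 0 D.
    rewrite ler_wpDr ?expR_ge0// -[1 in leLHS]expR0 ler_expR mul1r -mulrA -mulrBr mulr_ge0 ?(ltW s0)//.
    by rewrite subr_ge0 ltW// -(ger0_norm D0).
  rewrite ler_wpDl ?expR_ge0// -[1 in leLHS]expR0 ler_expR mulN1r -mulrA -mulrBr mulr_ge0 ?(ltW s0)//.
  by rewrite subr_ge0 ltW// -(ltr0_norm D0).
move: tot out; set X := Zk phi k ^+ n; set Y := expR _.
by rewrite -/u; lra.
Qed.

Definition average_rate (J : finType) (xi : config J) : R := (\sum_j g (xi j)) / #|J|%:R.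

(** Since c_j g(j) = c_(j-1), the sum of c_j phi^j (g(j) - phi) telescopes to the boundary term -
    phi c_M phi^M. The rate is thus almost centred at phi without any relation between phi and K,
    and a Chernoff bound applies. *)
Lemma average_rate_deviation (J : finType) M K (phi Z1 e : R) :
  (0 < #|J|)%N -> 0 < phi -> phi <= G -> 0 < e -> e <= G ->
  (forall k, Zk phi k <= Z1) -> phi * (c M * phi ^+ M) <= e / 6 ->
  @canonical_sum J M K (fun xi => `|average_rate xi - phi|) <=
  e * @canonical_sum J M K (fun=> 1) +
  2 * G * (Z1 ^+ #|J| / phi ^+ K * expR (- (#|J|%:R * (e ^+ 2 / (12 * G ^+ 2))))).
Proof.
move=> J0 p0 pG e0 eG HZ aM; set n := #|J| in J0 *.
have n0 : 0 < n%:R :> R by rewrite ltr0n.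
have G0 : 0 < G by exact: lt_le_trans G_ge1.
have Z10 : 1 <= Z1.
  apply: le_trans (HZ 0); apply: trunc_Z_ge1; rewrite ?ltW//.
  - exact: inv_rate_fact_gt0.
  - exact: inv_rate_fact0.
(* Minimises - s e + 3 (s G)^2. Two of the three squares come from the exponential; the third is the
   boundary term, since s e / 6 = (s G)^2. *)
pose s := e / (6 * G ^+ 2).
have s0 : 0 < s by rewrite divr_gt0// mulr_gt0// exprn_gt0.
have sGE : s * G = e / (6 * G) by rewrite /s; field; rewrite gt_eqF.
have sG : s * G <= 2^-1 by rewrite sGE ler_pdivrMr ?mulr_gt0//; lra.
have a0 j : 0 <= c j * phi ^+ j by rewrite mulr_ge0 ?exprn_ge0 ?ltW// inv_rate_fact_gt0.
have ag : \sum_(j < M.+1) c j * phi ^+ j * (g j - phi) = - (phi * (c M * phi ^+ M)).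
  elim: (M) => [|m IH].
    rewrite big_ord1 !expr0 (rate_eq0 g 0).2// inv_rate_fact0; ring.
  by rewrite big_ord_recr/= IH !exprS -(inv_rate_factS g m); ring.
pose D (xi : config J) := \sum_j (g (xi j) - phi).
have DE xi : D xi = n%:R * (average_rate xi - phi).
  rewrite /D sumrB sumr_const /average_rate -/n.
  by rewrite -(mulr_natl phi) -/n; field; rewrite gt_eqF.
have H (r : R) : `|r| = 1 -> canonical_sum M K (fun xi : config J =>
      expR (s * (r * D xi))) <= Z1 ^+ n / phi ^+ K * expR (n%:R * (3 * (s * G) ^+ 2)).
  move=> r1; rewrite mulrAC ler_pdivlMr ?exprn_gt0//.
  rewrite (_ : (fun xi => _) = fun xi : config J => expR (s * \sum_j (r * (g (xi j) - phi)))).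
    2: by apply/funext => xi; congr (expR (s * _)); rewrite mulr_sumr.
  apply: le_trans (canonical_exp_moment _ _ _ _ (fun j => r * (g j - phi)) p0) _.
  have h1 : \sum_(i < M.+1) c i * phi ^+ i * expR (s * (r * (g i - phi))) <=
     Z1 * (1 + 3 * (s * G) ^+ 2).
    apply: (@le_trans _ _ (Zk phi M * (1 + 2 * (s * G) ^+ 2) + s * (e / 6))).
      apply: (one_site_exp (a := fun i => c i * phi ^+ i) (h := fun i => r * (g i - phi))) => //.
      - move=> j _; rewrite normrM r1 mul1r ler_norml.
        by have := rate_ge0 g j; have := gG j; lra.
      - exact: ltW.
      - rewrite (eq_bigr (fun i : 'I_M.+1 => r * (c i * phi ^+ i * (g i - phi)))).
          rewrite -mulr_sumr ag; apply: le_trans (ler_norm _) _.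
          by rewrite normrM r1 mul1r normrN ger0_norm// mulr_ge0// ltW.
        by move=> i _; ring.
    have -> : s * (e / 6) = (s * G) ^+ 2 by rewrite /s; field; rewrite gt_eqF.
    have q0 := sqr_ge0 (s * G); set q := _ ^+ 2 in q0 *.
    have h := HZ M; have h4 : q <= Z1 * q by rewrite ler_peMl.
    have h5 : Zk phi M * (1 + 2 * q) <= Z1 * (1 + 2 * q).
      by apply: ler_wpM2r h; lra.
    by lra.
  have h2 : 0 <= \sum_(i < M.+1) c i * phi ^+ i * expR (s * (r * (g i - phi))).
    by apply: sumr_ge0 => i _; rewrite mulr_ge0 ?expR_ge0.
  have q0 : 0 <= 3 * (s * G) ^+ 2 by rewrite mulr_ge0// sqr_ge0.
  exact: le_trans (lerXn2r n h2 (le_trans h2 h1) h1)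
    (expr_exp_bound n (le_trans ler01 Z10) q0).
pose E := expR (- (s * e * n%:R)).
apply: (@le_trans _ _ (canonical_sum M K (fun xi : config J =>
    e * 1 + G * E * (expR (s * (1 * D xi)) + expR (s * (-1 * D xi)))))).
  apply: canonical_sum_le => xi _.
  have bd : `|average_rate xi - phi| <= G.
    have h1 : 0 <= average_rate xi.
      by rewrite divr_ge0// sumr_ge0// => j _; exact: rate_ge0.
    have h2 : average_rate xi <= G.
      rewrite ler_pdivrMr// mulr_natr -sumr_const; apply: ler_sum => j _; exact: gG.
    by rewrite ler_norml; lra.
  have E0 : 0 < E by exact: expR_gt0.
  have e1 := expR_ge0 (s * (1 * D xi)); have e2 := expR_ge0 (s * (-1 * D xi)).
  have [le|gt] := leP `|average_rate xi - phi| e.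
    rewrite mulr1 (le_trans le)// lerDl.
    by apply: mulr_ge0; [exact: mulr_ge0 (ltW G0) (ltW E0)|exact: addr_ge0].
  rewrite mulr1 (le_trans bd)//.
  suff h : 1 <= E * (expR (s * (1 * D xi)) + expR (s * (-1 * D xi))).
    apply: le_trans (ler_peMr (ltW G0) h) _.
    by rewrite -(mulrA G E) lerDr ltW.
  rewrite mulrDr -!expRD !DE.
  set y := average_rate xi - phi in gt *.
  have [y0|y0] := leP 0 y.
    rewrite ler_wpDr ?expR_ge0// -[1 in leLHS]expR0 ler_expR.
    rewrite (_ : _ + _ = s * n%:R * (y - e)); last by ring.
    apply: mulr_ge0; first by rewrite mulr_ge0// ltW.
    by rewrite subr_ge0 -(ger0_norm y0) ltW.
  rewrite ler_wpDl ?expR_ge0// -[1 in leLHS]expR0 ler_expR.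
  rewrite (_ : _ + _ = s * n%:R * (- y - e)); last by ring.
  apply: mulr_ge0; first by rewrite mulr_ge0// ltW.
  by rewrite subr_ge0 -(ltr0_norm y0) ltW.
rewrite canonical_sumD !canonical_sumZ canonical_sumD lerD2l.
have h := lerD (H 1 (normr1 _)) (H (-1) (normrN1 _)).
apply: le_trans (ler_wpM2l _ h) _.
  by rewrite mulr_ge0 ?expR_ge0 ?ltW.
rewrite le_eqVlt; apply/orP; left; apply/eqP.
have -> : expR (- (n%:R * (e ^+ 2 / (12 * G ^+ 2)))) = E * expR (n%:R * (3 * (s * G) ^+ 2)).
  rewrite /E -expRD; congr expR; rewrite /s; field; rewrite gt_eqF//.
ring.
Qed.

End bounded_rate.
End canonical_sums.

(** * Comparison of exponential rates *)

Section equivalence_of_ensembles.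
Context {R : realType}.
Variable g : jump_rate R.
Variable G : R.
Hypothesis G_ge1 : 1 <= G.
Hypothesis gG : forall k, g k <= G.
Local Notation c := (inv_rate_fact g).
Local Notation Zk := (trunc_Z c).
Local Notation Nk := (trunc_N c).
Local Notation phis := (phistar c).
Local Notation c_gt0 := (inv_rate_fact_gt0 g).
Local Notation c0 := (inv_rate_fact0 g).
Local Notation cG := (fun j => inv_rate_fact_ge j gG).

Lemma near_natr_ge (x : R) : \forall n \near \oo, x <= n%:R.
Proof.
exists (Num.bound `|x|) => // n /= xn; apply: le_trans (ler_norm _) _.
by apply: le_trans (ltW (archi_boundP (normr_ge0 _))) _; rewrite ler_nat.
Qed.

Lemma near_expR_small (a e : R) : 0 < a -> 0 < e ->
  \forall n \near \oo, n%:R * expR (- (n%:R * a)) <= e.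
Proof.
move=> a0 e0; near=> n.
have n0 : 0 < n%:R :> R by rewrite ltr0n; near: n; exact: nbhs_infty_gt.
have nb : 4 / (a ^+ 2 * e) <= n%:R by near: n; exact: near_natr_ge.
have x0 : 0 < n%:R * a / 2 by rewrite divr_gt0// mulr_gt0.
have h : (n%:R * a / 2) ^+ 2 <= expR (n%:R * a).
  rewrite [X in _ <= expR X](_ : _ = 2%:R * (n%:R * a / 2)); last by field.
  rewrite expRM_natl; apply: lerXn2r; rewrite ?nnegrE ?expR_ge0 ?(ltW x0)//.
  by have := expR_ge1Dx (n%:R * a / 2); lra.
rewrite expRN ler_pdivrMr ?expR_gt0//.
apply: le_trans (ler_wpM2l (ltW e0) h).
move: nb; rewrite ler_pdivrMr ?mulr_gt0 ?exprn_gt0// => nb.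
have -> : e * (n%:R * a / 2) ^+ 2 = n%:R * (n%:R * (a ^+ 2 * e)) / 4 by field.
by rewrite ler_pdivlMr// ler_wpM2l// ltW.
Unshelve. all: by end_near. Qed.

Lemma canonical_sum_dist (J : finType) M K (x y : R) (F : config J -> R) :
  canonical_sum g M K (fun xi => `|F xi - y|) <=
  canonical_sum g M K (fun xi => `|F xi - x|) +
    `|x - y| * canonical_sum g M K (fun=> 1 : R) (J := J).
Proof.
rewrite -canonical_sumZ -canonical_sumD; apply: canonical_sum_le => xi _.
by rewrite mulr1; have := ler_distD x (F xi) y.
Qed.

(** Vacuous unless rho n is a natural number; the density is kept real so that it can range over a
    compact interval. *)
Definition ensembles_close (e : R) (n : nat) (rho : R) : Prop :=
  forall (J : finType) (M K : nat), #|J| = n -> (K <= M)%N -> K%:R = rho * n%:R ->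
  @canonical_sum R g J M K (fun xi => `|average_rate g xi - phis rho|) <=
  e * @canonical_sum R g J M K (fun=> 1).

(** At small density both quantities are small: g(k) <= G k bounds the average rate by G rho, and
    [phis] is continuous with value 0 at 0. *)
Lemma ensembles_close_near0 (e : R) : 0 < e ->
  \forall rho \near 0 & n \near \oo, ensembles_close e n rho.
Proof.
move=> e0; have G0 : 0 < G by exact: lt_le_trans G_ge1.
have e2 : 0 < e / 2 by rewrite divr_gt0.
near=> rho n => J M K /= Jn KM KE.
have n0 : 0 < n%:R :> R by rewrite ltr0n; near: n; exact: nbhs_infty_gt.
have rho0 : 0 <= rho by rewrite -(pmulr_lge0 _ n0) -KE.
have ps : `|phis rho - phis 0| <= e / 2.
  move: rho0; near: rho.
  exact: (phistar_continuous c_gt0 c0 G_ge1 cG).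
have rhoe : rho <= e / 2 / G by near: rho; apply: lt_le_nbhsl; rewrite divr_gt0.
rewrite -canonical_sumZ; apply: canonical_sum_le => xi xiK; rewrite mulr1.
have a0 : 0 <= average_rate g xi.
  by rewrite divr_ge0// sumr_ge0// => j _; exact: rate_ge0.
have a1 : average_rate g xi <= e / 2.
  rewrite /average_rate Jn ler_pdivrMr//.
  apply: (@le_trans _ _ (G * K%:R)).
    rewrite -xiK /particles natr_sum mulr_sumr; apply: ler_sum => j _.
    case: (xi j) => [|i]; first by rewrite (rate_eq0 g 0).2// mulr0.
    by apply: le_trans (gG _) _; rewrite ler_peMr ?ler1n// ltW.
  by rewrite KE mulrA ler_wpM2r ?(ltW n0)// mulrC -ler_pdivlMr.
move: ps; rewrite (phistar_at0 c_gt0 c0 G_ge1 cG) subr0 => ps.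
have := phistar_ge0 c_gt0 c0 G_ge1 cG rho0.
by move: ps; rewrite !ler_norml => /andP[_ ps] ps0; lra.
Unshelve. all: by end_near. Qed.

(** Geometric decay strictly below a point of convergence; it removes the boundary term of
    [average_rate_deviation]. *)
Lemma near_term_small (a b e : R) : 0 < a -> a < b -> (exists M, forall k, Zk b k <= M) ->
  0 < e -> \forall m \near \oo, a * (c m * a ^+ m) <= e.
Proof.
move=> a0 ab [M HM] e0; have b0 : 0 < b by exact: lt_trans ab.
have M0 : 0 < M by apply: lt_le_trans (HM 0); rewrite (trunc_Z_gt0 c_gt0 c0)// ltW.
have q1 : `|a / b| < 1 by rewrite ger0_norm ?divr_ge0 ?ltW// ltr_pdivrMr// mul1r.
have /cvgrPdist_lt/(_ (e / (a * M))) := cvg_expr q1.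
rewrite divr_gt0 ?mulr_gt0// => /(_ isT); apply: filterS => m.
rewrite sub0r normrN ger0_norm ?exprn_ge0 ?divr_ge0 ?(ltW a0) ?(ltW b0)// => h.
have h1 : c m * b ^+ m <= M.
  apply: le_trans (HM m); rewrite /trunc_Z big_ord_recr/= lerDr.
  by apply: sumr_ge0 => j _; rewrite mulr_ge0 ?exprn_ge0 ?ltW// inv_rate_fact_gt0.
have -> : a * (c m * a ^+ m) = a * (c m * b ^+ m) * (a / b) ^+ m.
  by rewrite expr_div_n; field; rewrite expf_neq0// gt_eqF.
apply: (@le_trans _ _ (a * M * (a / b) ^+ m)).
  rewrite ler_wpM2r ?exprn_ge0 ?divr_ge0 ?(ltW a0) ?(ltW b0)//.
  by rewrite ler_pM2l.
by move: h; rewrite ltr_pdivlMr ?mulr_gt0// mulrC => /ltW.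
Qed.

(** The bound of [average_rate_deviation], taken at a fugacity [phi1] slightly below [phi0] =
    [phis rho0], is divided by a lower bound for the canonical partition function [X]. The losses
    have a small exponential rate, so the fixed rate [kap] of the deviation wins. The constants
    depend on rho0 and e only and serve all nearby densities. *)
Lemma ensembles_close_near (rho0 e : R) : 0 < rho0 -> 0 < e ->
  \forall rho \near rho0 & n \near \oo, ensembles_close e n rho.
Proof.
move=> r0 e0; have G0 : 0 < G by exact: lt_le_trans G_ge1.
set phi0 := phis rho0.
have p0 : 0 < phi0 by exact: (rate_phistar_gt0 G_ge1 gG).
have p0G : phi0 <= G by exact: (phistar_leG c_gt0 c0 G_ge1 cG (ltW r0)).
(* The total error will be at most 4 [eta]; the bound by G is required by
   [average_rate_deviation]. *)
pose eta := Num.min (e / 8) G.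
have eta0 : 0 < eta by rewrite lt_min G0 divr_gt0.
have etae : eta <= e / 8 by rewrite ge_min lexx.
have etaG : eta <= G by rewrite ge_min lexx orbT.
(* The rate of [average_rate_deviation]. Three losses follow, each kept to kap / 8 per site, so that
   a rate of at least kap / 2 survives. *)
pose kap := eta ^+ 2 / (12 * G ^+ 2).
have kap0 : 0 < kap by rewrite divr_gt0 ?mulr_gt0 ?exprn_gt0.
(* Loss from replacing phi^K by phi1^K: K <= (rho0 + 1) n and (rho0 + 1) dl = kap / 8. *)
pose dl := kap / (8 * (rho0 + 1)).
have dl0 : 0 < dl by rewrite divr_gt0// mulr_gt0// addr_gt0.
(* Relative half-width of the fugacity window around [phi0]: the bound dl / 4 keeps phi2 / phi1 <=
   exp dl, and eta / G keeps phi0 - phi1 <= eta. *)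
pose u := Num.min 2^-1 (Num.min (dl / 4) (eta / G)).
have u0 : 0 < u.
  by rewrite !lt_min; apply/and3P; split; [rewrite invr_gt0|exact: divr_gt0..].
have u2 : u <= 2^-1 by rewrite ge_min lexx.
have udl : 4 * u <= dl.
  have : u <= dl / 4 by rewrite /u !ge_min lexx !orbT.
  by lra.
have ueta : G * u <= eta.
  have : u <= eta / G by rewrite /u !ge_min lexx !orbT.
  by rewrite ler_pdivlMr// mulrC.
pose phi1 := phi0 * (1 - u); pose phi2 := phi0 * (1 + u).
have p10 : 0 < phi1 by rewrite mulr_gt0//; lra.
have p1lt : phi1 < phi0 by rewrite /phi1 gtr_pMr//; lra.
have p2gt : phi0 < phi2 by rewrite /phi2 ltr_pMr//; lra.
have p1eta : phi0 - phi1 <= eta.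
  have -> : phi0 - phi1 = phi0 * u by rewrite /phi1; ring.
  by apply: le_trans ueta; rewrite ler_pM2r.
have p12 : phi2 <= phi1 * expR dl.
  rewrite /phi1 /phi2 -mulrA ler_pM2l//.
  apply: (@le_trans _ _ ((1 - u) * (1 + 4 * u))).
    have : 0 <= u * (2 - 4 * u) by rewrite mulr_ge0 ?(ltW u0)//; lra.
    by lra.
  rewrite ler_wpM2l//; first lra.
  by apply: le_trans (expR_ge1Dx _) _; rewrite ler_expR.
have S0 : subcrit c rho0 phi0.
  exact: (phistar_subcrit c_gt0 c0 G_ge1 cG (ltW r0)).
have B0 := subcrit_bounded c_gt0 c0 S0.
have S1 : subcrit c rho0 phi1 := subcrit_down c_gt0 c0 (ltW p10) (ltW p1lt) S0.
have [M1 HM1] := subcrit_bounded c_gt0 c0 S1.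
pose Z1 := sup (range (Zk phi1)).
have supZ : has_sup (range (Zk phi1)).
  by split; [exists (Zk phi1 0), 0|exists M1 => _ [k _ <-]].
have HZ1 k : Zk phi1 k <= Z1 by apply: ub_le_sup; [case: supZ|exists k].
have Z1_0 : 0 < Z1 by apply: lt_le_trans (HZ1 0); rewrite (trunc_Z_gt0 c_gt0 c0)// ltW.
(* At level [k2] the partition sum at [phi1] is complete up to a factor exp(- kap / 8); at level
   [k1] below, the truncated mean at [phi2] exceeds rho0. *)
have [_ [k2 _ <-] Hk2] : exists2 x, range (Zk phi1) x & Z1 * expR (- (kap / 8)) < x.
  apply: sup_gt; first by case: supZ.
  rewrite -/Z1 gtr_pMr// expR_lt1 oppr_lt0 divr_gt0//.
have [k1 Hk1] := gt_phistar c_gt0 c0 G_ge1 cG (ltW r0) p2gt.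
pose k := maxn k1 (maxn k2 1).
have k_gt0 : (0 < k)%N by rewrite !leq_max /= !orbT.
have p2_0 : 0 <= phi2 by exact/ltW/(lt_trans p0).
have Hk1' : rho0 * Zk phi2 k < Nk phi2 k.
  have kk1 : (k1 <= k)%N by rewrite leq_max leqnn.
  have := trunc_mean_homo_index c_gt0 c0 p2_0 kk1.
  have z1 := trunc_Z_gt0 c_gt0 c0 k1 p2_0; have z2 := trunc_Z_gt0 c_gt0 c0 k p2_0.
  move=> h; rewrite -(ltr_pM2r z1); apply: lt_le_trans h.
  by rewrite mulrAC ltr_pM2r.
have Hk2' : Z1 * expR (- (kap / 8)) <= Zk phi1 k.
  apply: le_trans (ltW Hk2) _; apply: (trunc_Z_le c_gt0 (ltW p10)).
  by rewrite !leq_max leqnn !orbT.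
have z1k := trunc_Z_gt0 c_gt0 c0 k (ltW p10).
have z0k := trunc_Z_gt0 c_gt0 c0 k (ltW p0).
pose tau := rho0 - Nk phi1 k / Zk phi1 k.
have tau0 : 0 < tau.
  rewrite subr_gt0 ltr_pdivrMr// -(ltr_pM2r z0k).
  have := trunc_mean_lt c_gt0 c0 (ltW p10) (ltW p1lt) k_gt0.
  have : Nk phi0 k * Zk phi1 k <= rho0 * Zk phi0 k * Zk phi1 k.
    by rewrite ler_pM2r//; case: S0.
  have : 0 < c 1 * (phi0 - phi1) by rewrite mulr_gt0 ?c_gt0// subr_gt0.
  by lra.
have N1k := trunc_N_ge0 c_gt0 k (ltW p10).
pose B := G / phi1.
have B1 : 1 <= B by rewrite ler_pdivlMr// mul1r (le_trans (ltW p1lt)).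
have B0' : 0 < B by exact: lt_le_trans B1.
pose lB := ln B.
have lB0 : 0 <= lB by rewrite ln_ge0.
(* Width of the density window: tau / 4 keeps the target rho0 - 2 de above the truncated mean at
   [phi1], and the last bound keeps the cost of 4 de n added particles, a factor [B] each, below kap
   / 8 per site. *)
pose de := Num.min (Num.min (tau / 4) 1) (kap / (32 * (lB + 1))).
have de0 : 0 < de by rewrite !lt_min ltr01 !divr_gt0 ?mulr_gt0//; lra.
have detau : de <= tau / 4 by rewrite !ge_min lexx.
have de1 : de <= 1 by rewrite !ge_min lexx orbT.
have delB : 4 * de * lB <= kap / 8.
  have h : de <= kap / (32 * (lB + 1)) by rewrite /de ge_min lexx orbT.
  move: h; rewrite ler_pdivlMr ?mulr_gt0//; last by clear - lB0; lra.
  by move=> h; clear - h de0 lB0; lra.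
pose rho' := rho0 - 2 * de.
have rho'N : Nk phi1 k < rho' * Zk phi1 k.
  by rewrite -ltr_pdivrMr// /rho'; rewrite /tau in detau tau0; lra.
have de_rho : de <= rho0 / 4.
  by have := divr_ge0 N1k (ltW z1k); rewrite /tau in detau; lra.
have rho'0 : 0 <= rho'.
  by rewrite ltW// -(pmulr_lgt0 _ z1k) (le_lt_trans N1k).
(* The truncated mean passes the value [rho'] between [phi1] and [phi2], also when [rho'] is above
   [rho_c]; phi may exceed phi_c, since only truncated sums occur. *)
have [phi /andP[] phil phir NZ] : exists2 phi, phi1 <= phi <= phi2 & Nk phi k = rho' * Zk phi k.
  have cont : {within `[phi1, phi2], continuous (fun x => Nk x k - rho' * Zk x k)}.
    apply: continuous_subspaceT => x; apply: cvgB; first exact: trunc_N_continuous.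
    by apply: cvgM; [exact: cvg_cst|exact: (trunc_Z_continuous c0)].
  have p12' : phi1 <= phi2 by exact/ltW/(lt_trans p1lt).
  have [|x] := IVT (v := 0) p12' cont.
    rewrite ge_min le_max !subr_le0 !subr_ge0 (ltW rho'N)/=.
    apply/orP; right; apply: le_trans (ltW Hk1'); apply: ler_wpM2r.
      exact/ltW/(trunc_Z_gt0 c_gt0 c0).
    by rewrite /rho'; clear - de0; lra.
  by rewrite in_itv/= => xI /eqP; rewrite subr_eq0 => /eqP ?; exists x.
have phi_0 : 0 < phi by exact: lt_le_trans phil.
have rho'k : rho' <= k%:R.
  have z := trunc_Z_gt0 c_gt0 c0 k (ltW phi_0).
  by rewrite -(ler_pM2r z) -NZ; exact: (trunc_N_le_index c_gt0 k (ltW phi_0)).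
have kR : 0 < k%:R :> R by rewrite ltr0n.
have hb j : (j <= k)%N -> `|j%:R - rho'| <= k%:R.
  move=> jk; rewrite ler_norml; have h1 : 0 <= j%:R :> R by [].
  have h2 : j%:R <= k%:R :> R by rewrite ler_nat.
  by clear - h1 h2 rho'0 rho'k; lra.
have de2k : de <= 2 * k%:R.
  by have h : 1 <= k%:R :> R; [rewrite ler1n|clear - h de1; lra].
pose kap2 := de ^+ 2 / (8 * k%:R ^+ 2).
have kap20 : 0 < kap2 by rewrite divr_gt0 ?mulr_gt0 ?exprn_gt0.
have et6 : 0 < eta / 6 by rewrite divr_gt0.
have [M0 _ HM0] := near_term_small p10 p1lt B0 et6.
have kap2' : 0 < kap / 2 by rewrite divr_gt0.
have sm : 0 < eta / (20 * G) by rewrite divr_gt0 ?mulr_gt0.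
have psc : \forall rho \near rho0, 0 <= rho -> `|phis rho - phi0| <= eta.
  exact: (phistar_continuous c_gt0 c0 G_ge1 cG (ltW r0) eta0).
near=> rho n => J M K /= Jn KM KE.
have n_gt0 : (0 < n)%N by near: n; exact: nbhs_infty_gt.
have n0 : 0 < n%:R :> R by rewrite ltr0n.
have rho_ge0 : 0 <= rho by rewrite -(pmulr_lge0 _ n0) -KE.
have ps : `|phis rho - phi0| <= eta by move: rho_ge0; near: rho.
have rl : rho0 - de <= rho.
  by apply: ltW; near: rho; apply: lt_nbhsr; rewrite gtrBl.
have rr : rho <= rho0 + de by near: rho; apply: lt_le_nbhsl; rewrite ltrDl.
have K_ge x : x / (rho0 / 2) <= n%:R -> x <= K%:R.
  rewrite ler_pdivrMr ?divr_gt0// => h; apply: le_trans h _.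
  rewrite KE [leRHS]mulrC; apply: ler_wpM2l; first exact: ltW.
  by clear - rl de_rho r0; lra.
have kK : (k <= K)%N.
  by rewrite -(ler_nat R); apply: K_ge; near: n; exact: near_natr_ge.
have M0K : (M0 <= K)%N.
  by rewrite -(ler_nat R); apply: K_ge; near: n; exact: near_natr_ge.
have aM : phi1 * (c M * phi1 ^+ M) <= eta / 6 by apply: HM0; exact: leq_trans KM.
have /card_gt0P[x0 _] : (0 < #|J|)%N by rewrite Jn.
have J0 : (0 < #|J|)%N by rewrite Jn.
set X := @canonical_sum R g J M K (fun=> 1).
have X0 : 0 <= X by exact: canonical_sum_ge0.
(* Under the truncated law the particle number lies within de n of (rho0 - 2 de) n, while K lies
   within de n of rho0 n; so between 0 and 4 de n particles are missing. *)
pose m := Num.truncn (4 * de * n%:R).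
have m_le : m%:R <= 4 * de * n%:R by rewrite truncn_le// !mulr_ge0 ?ltW.
have m_lt : 4 * de * n%:R < m.+1%:R by rewrite truncnS_gt.
have conc := truncated_concentration J phi_0 kR hb de0 de2k NZ.
rewrite Jn in conc.
have win : 2^-1 * Zk phi k ^+ n <= m.+1%:R * (B ^+ m * (phi ^+ K * X)).
  have GB : G / phi <= B by rewrite ler_pM2l// lef_pV2 ?posrE.
  apply: le_trans _ (window_le G_ge1 gG x0 m (leq_trans kK KM) KM phi_0 B1 GB).
  have small : 2 * expR (- (n%:R * kap2)) <= 2^-1.
    have : n%:R * expR (- (n%:R * kap2)) <= 4^-1.
      by near: n; apply: near_expR_small.
    have : 1 <= n%:R :> R by rewrite ler1n.
    move=> n1 h; suff h2 : expR (- (n%:R * kap2)) <= n%:R * expR (- (n%:R * kap2)).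
      by clear - h h2; lra.
    by rewrite ler_peMl ?expR_ge0.
  have Zn0 : 0 <= Zk phi k ^+ n by rewrite exprn_ge0// ltW// (trunc_Z_gt0 c_gt0 c0)// ltW.
  apply: (@le_trans _ _ (Zk phi k ^+ n * (1 - 2 * expR (- (n%:R * kap2))))).
    by rewrite mulrC ler_wpM2l//; clear - small; lra.
  apply: le_trans conc _.
  rewrite [leRHS]big_mkcond [leLHS]big_mkcond; apply: ler_sum => f _.
  have w0 : 0 <= weight g (config_of f) * phi ^+ particles (config_of f).
    by rewrite mulr_ge0 ?exprn_ge0 ?ltW// weight_gt0.
  case: ifPn => [h|_]; last by case: ifP.
  suff -> : (K - m <= particles (config_of f) <= K)%N by [].
  move: h; rewrite ler_norml => /andP[h1 h2].
  set S := particles _ in h1 h2 *.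
  have rn1 : (rho0 - de) * n%:R <= rho * n%:R by rewrite ler_pM2r.
  have rn2 : rho * n%:R <= (rho0 + de) * n%:R by rewrite ler_pM2r.
  have den : 0 < de * n%:R by rewrite mulr_gt0.
  have SK : (S <= K)%N by rewrite -(ler_nat R) KE; rewrite /rho' in h2; clear - h2 rn1 den; lra.
  rewrite SK andbT leq_subLR -ltnS -(ltr_nat R) -addnS natrD KE.
  by rewrite /rho' in h1; clear - h1 rn2 m_lt; lra.
have n1 : 1 <= n%:R :> R by rewrite ler1n.
have m5 : m.+1%:R <= 5 * n%:R :> R.
  rewrite -addn1 natrD.
  have h : 4 * de * n%:R <= 4 * 1 * n%:R by rewrite ler_pM2r// ler_pM2l.
  by clear - h m_le n1; lra.
have Bm : B ^+ m <= expR (n%:R * (kap / 8)).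
  rewrite -(lnK (x := B)) ?posrE// -expRM_natl ler_expR -/lB.
  apply: (@le_trans _ _ (4 * de * n%:R * lB)); first by rewrite ler_wpM2r.
  have -> : 4 * de * n%:R * lB = n%:R * (4 * de * lB) by ring.
  by rewrite ler_pM2l.
have phiK : phi ^+ K <= phi1 ^+ K * expR (n%:R * (kap / 8)).
  apply: (@le_trans _ _ ((phi1 * expR dl) ^+ K)).
    apply: lerXn2r; rewrite ?nnegrE ?(ltW phi_0)//.
      by rewrite mulr_ge0 ?expR_ge0// ltW.
    exact: le_trans p12.
  rewrite exprMn ler_wpM2l ?exprn_ge0 ?(ltW p10)// -expRM_natl ler_expR KE.
  have -> : n%:R * (kap / 8) = (rho0 + 1) * n%:R * dl.
    by rewrite /dl; field; rewrite gt_eqF// addr_gt0.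
  by rewrite ler_pM2r// ler_pM2r//; clear - rr de1; lra.
have Zn : Z1 ^+ n * expR (- (n%:R * (kap / 8))) <= Zk phi k ^+ n.
  rewrite -mulrN expRM_natl -exprMn; apply: lerXn2r.
  - by rewrite nnegrE mulr_ge0 ?expR_ge0// ltW.
  - by rewrite nnegrE ltW// (trunc_Z_gt0 c_gt0 c0)// ltW.
  - apply: le_trans Hk2' _; exact: (trunc_Z_homo c_gt0 k (ltW p10) phil).
pose E := expR (n%:R * (kap / 8)).
have E0 : 0 < E by exact: expR_gt0.
have main : Z1 ^+ n / phi1 ^+ K <= 10 * n%:R * E ^+ 3 * X.
  rewrite ler_pdivrMr ?exprn_gt0//.
  have h1 : m.+1%:R * (B ^+ m * (phi ^+ K * X)) <=
      5 * n%:R * (E * (phi1 ^+ K * E * X)).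
    have f1 : 0 <= phi ^+ K * X by rewrite mulr_ge0// exprn_ge0// ltW.
    have f2 : 0 <= B ^+ m by rewrite exprn_ge0// ltW.
    have f3 : phi ^+ K * X <= phi1 ^+ K * E * X by apply: ler_wpM2r.
    by apply: ler_pM => //; [exact: mulr_ge0|exact: ler_pM].
  have h2 := le_trans win h1.
  have h3 : 2^-1 * (Z1 ^+ n * E^-1) <= 5 * n%:R * (E * (phi1 ^+ K * E * X)).
    by apply: le_trans h2; rewrite ler_pM2l ?invr_gt0// /E -expRN.
  move: h3; rewrite (mulrA 2^-1) ler_pdivrMr// => h3.
  by rewrite !exprS expr0; clear - h3; lra.
have bad : 2 * G * (Z1 ^+ n / phi1 ^+ K * expR (- (n%:R * kap))) <= eta * X.
  have E3 : expR (- (n%:R * kap)) * E ^+ 3 <= expR (- (n%:R * (kap / 2))).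
    rewrite /E -expRM_natl -expRD ler_expR.
    have h : 0 <= n%:R * kap by rewrite mulr_ge0// ltW.
    by clear - h; lra.
  apply: (@le_trans _ _ (2 * G * (10 * n%:R * E ^+ 3 * X * expR (- (n%:R * kap))))).
    rewrite ler_pM2l ?mulr_gt0//; apply: ler_wpM2r main; exact: expR_ge0.
  have -> : 2 * G * (10 * n%:R * E ^+ 3 * X * expR (- (n%:R * kap))) =
     20 * G * (n%:R * (expR (- (n%:R * kap)) * E ^+ 3)) * X by ring.
  apply: ler_wpM2r => //.
  apply: (@le_trans _ _ (20 * G * (n%:R * expR (- (n%:R * (kap / 2)))))).
    by rewrite ler_pM2l ?mulr_gt0// ler_pM2l.
  rewrite mulrC -ler_pdivlMr ?mulr_gt0//.
  by near: n; apply: near_expR_small.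
have p1G : phi1 <= G by exact: le_trans (ltW p1lt) p0G.
have dev := average_rate_deviation G_ge1 gG K J0 p10 p1G eta0 etaG HZ1 aM.
rewrite Jn -/X in dev.
apply: le_trans (canonical_sum_dist M K phi1 _ _) _; rewrite -/X.
have d1 : `|phi1 - phis rho| <= 2 * eta.
  have a1 : `|phi1 - phi0| <= eta by rewrite distrC ger0_norm// subr_ge0 ltW.
  have a2 : `|phi0 - phis rho| <= eta by rewrite distrC.
  by apply: le_trans (ler_distD phi0 _ _) _; clear - a1 a2; lra.
have d2 : `|phi1 - phis rho| * X <= 2 * eta * X by apply: ler_wpM2r.
have d3 : 8 * eta * X <= e * X by apply: ler_wpM2r => //; clear - etae; lra.
have d4 : 0 <= eta * X by rewrite mulr_ge0// ltW.
by rewrite -/kap in dev; clear - dev bad d2 d3 d4; lra.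
Unshelve. all: by end_near. Qed.

Lemma equivalence_of_ensembles (A e : R) : 0 <= A -> 0 < e ->
  \forall n \near \oo, forall rho, 0 <= rho <= A -> ensembles_close e n rho.
Proof.
move=> A0 e0.
have cp : compact `[0, A] := @segment_compact R 0 A.
have : \forall n \near \oo, `[0, A] `<=` [set rho | ensembles_close e n rho].
  apply: (compact_near_coveringP _).1 => // rho /=.
  rewrite in_itv/= le_eqVlt => /andP[/predU1P[<-|r0] _].
    exact: ensembles_close_near0.
  exact: ensembles_close_near.
by apply: filterS => n H rho rA; apply: H; rewrite /= in_itv.
Qed.

End equivalence_of_ensembles.

(** * Block inequality under the product measure *)

Section grand_canonical.
Context {R : realType}.
Variable g : jump_rate R.
Variable G : R.
Hypothesis G_ge1 : 1 <= G.
Hypothesis gG : forall k, g k <= G.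
Variable phi : R.
Hypothesis phi_gt0 : 0 < phi.
Hypothesis phiD : partition_domain g phi.
Local Notation c := (inv_rate_fact g).
Local Notation nu := (site_measure g phi).
Local Notation Z := (fine (partition_function g phi)).

Definition add_particle {I : finType} (eta : config I) (x : I) : config I :=
  [ffun z => (eta z + (z == x))%N].

(** Used for injective [e], where the sum has at most one term; it replaces an inverse of [e], and
    sites outside the image are left unchanged. *)
Definition add_config {I J : finType} (e : J -> I) (eta : config I) (xi : config J) :
  config I := [ffun y => (eta y + \sum_(j | e j == y) xi j)%N].

Definition restrict_config {I J : finType} (e : J -> I) (eta : config I) : config J :=
  [ffun j => eta (e j)].

Lemma move_add_particle (I : finType) (eta : config I) x y :
  move (add_particle eta x) x y = add_particle eta y.
Proof. by apply/ffunP => z; rewrite !ffunE addnK. Qed.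

Lemma add_particleC (I : finType) (eta : config I) x y :
  add_particle (add_particle eta x) y = add_particle (add_particle eta y) x.
Proof. by apply/ffunP => z; rewrite !ffunE addnAC. Qed.

Lemma particles_add_particle (I : finType) (eta : config I) x :
  particles (add_particle eta x) = (particles eta).+1.
Proof.
rewrite /particles; under eq_bigr do rewrite ffunE.
rewrite big_split/= [X in (_ + X)%N](bigD1 x)//= eqxx.
by rewrite [X in (_ + (_ + X))%N]big1 ?addn0 ?addn1// => y /negbTE ->.
Qed.

Lemma add_config_add_particle (I J : finType) (e : J -> I) (eta : config I)
    (xi : config J) j : injective e ->
  add_config e eta (add_particle xi j) = add_particle (add_config e eta xi) (e j).
Proof.
move=> einj; apply/ffunP => y; rewrite !ffunE -addnA; congr (_ + _)%N.
under eq_bigr do rewrite ffunE.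
rewrite big_split/=; congr (_ + _)%N; have [->|yj] := eqVneq y (e j).
  rewrite (bigD1 j)//= eqxx [X in (_ + X)%N]big1 ?addn0// => i /andP[_ /negbTE].
  by move=> ->.
by apply: big1 => i /eqP ey; case: eqP => // ij; move: yj; rewrite -ey ij eqxx.
Qed.

Lemma restrict_add_config (I J : finType) (e : J -> I) (eta : config I)
    (xi : config J) : injective e -> restrict_config e eta = [ffun=> 0%N] ->
  restrict_config e (add_config e eta xi) = xi.
Proof.
move=> einj /ffunP e0; apply/ffunP => j; rewrite !ffunE.
have := e0 j; rewrite !ffunE => ->; rewrite add0n.
rewrite (bigD1 j)//= [X in (_ + X)%N]big1 ?addn0// => i /andP[/eqP /einj ->].
by rewrite eqxx.
Qed.

Lemma site_pmfE k : site_pmf g phi k = Z^-1 * (c k * phi ^+ k).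
Proof. by rewrite /site_pmf [_ / _]mulrC. Qed.

Lemma iid_set1 (I : finType) (eta : config I) :
  iid_measure nu [set eta] = (\prod_x site_pmf g phi (eta x))%:E.
Proof.
have E : \prod_x fine (nu [set eta x]) = \prod_x site_pmf g phi (eta x).
  by apply: eq_bigr => x _; rewrite site_measure_set1.
rewrite /iid_measure esum_set1 ?E// lee_fin.
by apply: prodr_ge0 => x _; rewrite site_pmf_ge0// ltW.
Qed.

Lemma site_pmf_ratio k : site_pmf g phi k.+1 = phi / g k.+1 * site_pmf g phi k.
Proof.
rewrite !site_pmfE -(inv_rate_factS g k) exprS; field.
by rewrite !gt_eqF ?rate_gt0// fine_partition_gt0.
Qed.

Lemma iid_add_particle (I : finType) (eta : config I) x :
  iid_measure nu [set add_particle eta x] =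
  ((phi / g (eta x).+1)%:E * iid_measure nu [set eta])%E.
Proof.
rewrite !iid_set1 -EFinM; congr EFin; rewrite (bigD1 x)//= [in RHS](bigD1 x)//=.
rewrite ffunE eqxx addn1 site_pmf_ratio [RHS]mulrA; congr (_ * _).
by apply: eq_bigr => y /negbTE yx; rewrite ffunE yx addn0.
Qed.

Lemma iid_add_config (I J : finType) (e : J -> I) (eta : config I) (xi : config J) :
  injective e -> restrict_config e eta = [ffun=> 0%N] ->
  iid_measure nu [set add_config e eta xi] =
  ((weight g xi * phi ^+ particles xi)%:E * iid_measure nu [set eta])%E.
Proof.
move=> einj /ffunP e0; rewrite !iid_set1 -EFinM; congr EFin.
rewrite weight_expr -[X in X * _]mulr1.
have -> : \prod_j (c (xi j) * phi ^+ xi j) * 1 =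
    \prod_(y : I) \prod_(j | e j == y) (c (xi j) * phi ^+ xi j).
  rewrite mulr1 [RHS](exchange_big_dep predT)//=; apply: eq_bigr => j _.
  by rewrite (big_pred1 (e j))// => y; rewrite eq_sym.
rewrite -big_split/=; apply: eq_bigr => y _; rewrite ffunE.
have [/existsP[j /eqP ej]|/existsPn ny] := boolP [exists j, e j == y].
  rewrite !(big_pred1 j); try by move=> i; rewrite -ej (inj_eq einj) eq_sym.
  have := e0 j; rewrite !ffunE ej => ->; rewrite add0n !site_pmfE.
  by rewrite inv_rate_fact0 expr0 !mulr1 mulrC.
by rewrite !big_pred0 ?addn0 ?mul1r// => j; apply/negbTE/ny.
Qed.

(** Adding a particle at x multiplies the mass by phi / g(eta x + 1); configurations empty at x are
    not reached, but there g vanishes. *)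
Lemma mean_shift (I : finType) (x : I) (F : config I -> R) : (forall eta, 0 <= F eta) ->
  \int[iid_measure nu]_eta (g (eta x) * F eta) =
  \int[iid_measure nu]_eta (phi * F (add_particle eta x)).
Proof.
move=> F0; pose Q := [set eta : config I | (0 < eta x)%N].
have tinj : set_inj setT (fun eta : config I => add_particle eta x).
  move=> eta eta' _ _ /ffunP h; apply/ffunP => z.
  by have := h z; rewrite !ffunE => /addIn.
have tQ : (fun eta : config I => add_particle eta x) @` setT = Q.
  apply/seteqP; split => [_ [eta _ <-]|eta /= ex].
    by rewrite /Q/= ffunE eqxx addn1.
  exists [ffun z => (eta z - (z == x))%N] => //; apply/ffunP => z; rewrite !ffunE.
  by case: eqP => [->|_]; rewrite ?subnK// subn0 addn0.
have a0 (eta : config I) : 0 <= phi / g (eta x).+1 by rewrite divr_ge0 ?rate_ge0// ltW.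
have f0 (eta : config I) : 0 <= g (eta x) * F eta by rewrite mulr_ge0 ?rate_ge0.
have := integral_change_of_variables (@pickle_config_inj I) (@config_measurable I)
  (m := iid_measure nu) tinj tQ a0 f0 (fun (eta : config I) _ => iid_add_particle eta x).
rewrite (_ : (fun eta => _) = fun eta : config I => g (eta x) * F eta); last first.
  apply/funext => eta; rewrite indicE; case: (boolP (eta \in Q)); rewrite ?mul1r// notin_setE.
  by rewrite /Q/= => /negP; rewrite -eqn0Ngt => /eqP ->; rewrite (rate_eq0 g 0).2// !mul0r.
move=> ->; apply: eq_Rintegral => eta _; rewrite indicE in_setT mul1r ffunE eqxx addn1.
by rewrite mulrA divfK// gt_eqF// rate_gt0.
Qed.

(** The configurations with block content xi are those with an empty block after adding xi.
    Conditioning on the exterior is thereby expressed by integrals over a single event. *)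
Lemma mean_restrict (I J : finType) (e : J -> I) (xi : config J) (F : config I -> R) :
  injective e -> (forall eta, 0 <= F eta) ->
  \int[iid_measure nu]_eta (\1_[set eta | restrict_config e eta = xi] eta * F eta) =
  \int[iid_measure nu]_eta (\1_[set eta | restrict_config e eta = [ffun=> 0%N]] eta *
     (weight g xi * phi ^+ particles xi * F (add_config e eta xi))).
Proof.
move=> einj F0.
have := integral_change_of_variables (@pickle_config_inj I) (@config_measurable I)
  (m := iid_measure nu) (P := [set eta | restrict_config e eta = [ffun=> 0%N]])
  (Q := [set eta | restrict_config e eta = xi])
  (tau := fun eta => add_config e eta xi)
  (a := fun=> weight g xi * phi ^+ particles xi) (F := F).
apply=> //.
- move=> eta eta' _ _ /ffunP h; apply/ffunP => z.
  by have := h z; rewrite !ffunE => /addIn.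
- apply/seteqP; split => [_ [eta /= e0 <-]|eta /= exi].
    exact: restrict_add_config.
  exists [ffun y => if [exists j, e j == y] then 0%N else eta y].
    by apply/ffunP => j; rewrite !ffunE; case: existsP => // -[]; exists j.
  apply/ffunP => y; rewrite !ffunE; case: existsP => [[j /eqP ej]|ny].
    rewrite (big_pred1 j); last by move=> i; rewrite -ej (inj_eq einj) eq_sym.
    by rewrite add0n -exi ffunE ej.
  by rewrite big_pred0 ?addn0// => j; apply/negbTE/negP => ej; apply: ny; exists j.
- by move=> _; rewrite mulr_ge0 ?exprn_ge0 ?ltW// weight_gt0.
- by move=> eta /= e0; exact: iid_add_config.
Qed.

End grand_canonical.

(** * Poincare inequality and Dirichlet form of one block *)

Section box_inequality.
Context {R : realType}.
Variable g : jump_rate R.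

Lemma add_particle_ex (J : finType) (xi : config J) K : particles xi = K.+1 ->
  exists a eta, xi = add_particle eta a /\ particles eta = K.
Proof.
move=> xiK; have [a xa] : exists a, (0 < xi a)%N.
  apply: contrapT => /forallNP h; move: xiK; rewrite /particles big1// => j _.
  by apply/eqP; rewrite -leqn0 leqNgt; apply/negP/h.
exists a, [ffun z => (xi z - (z == a))%N].
have E : xi = add_particle [ffun z => (xi z - (z == a))%N] a.
  by apply/ffunP => z; rewrite !ffunE; case: eqP => [->|_]; rewrite ?subnK// subn0 addn0.
by split=> //; move: xiK; rewrite {1}E particles_add_particle => -[].
Qed.

Lemma particles_eq0 (J : finType) (xi : config J) : particles xi = 0%N ->
  xi = [ffun=> 0%N].
Proof.
move=> /eqP; rewrite /particles sum_nat_eq0 => /forallP h.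
by apply/ffunP => j; rewrite ffunE; exact/eqP/(implyP (h j)).
Qed.

Lemma le_particles (J : finType) (xi : config J) j : (xi j <= particles xi)%N.
Proof. by rewrite /particles (bigD1 j)//= leq_addr. Qed.

Lemma config_of_ex (J : finType) M (xi : config J) : (particles xi <= M)%N ->
  exists f : {ffun J -> 'I_M.+1}, config_of f = xi.
Proof.
move=> xiM; exists [ffun j => inord (xi j)]; apply/ffunP => j.
by rewrite !ffunE inordK// ltnS (leq_trans _ xiM)// le_particles.
Qed.

Lemma config_of_inj (J : finType) M : injective (@config_of J M).
Proof.
move=> f f' /ffunP ff'; apply/ffunP => j; apply: val_inj.
by have := ff' j; rewrite !ffunE.
Qed.

(** Dirichlet form for moves between any two sites, seen from the configuration without the moving
    particle; hence the K - 1 remaining particles in [canonical_gradient]. It carries no weights,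
    which are absorbed by the constants. *)
Definition pair_gradient {J : finType} (psi : config J -> R) (xi : config J) : R :=
  \sum_a \sum_b (psi (add_particle xi a) - psi (add_particle xi b)) ^+ 2.

Definition canonical_gradient (J : finType) (M K : nat) (psi : config J -> R) : R :=
  \sum_(f : {ffun J -> 'I_M.+1} | (particles (config_of f)).+1 == K)
    pair_gradient psi (config_of f).

Lemma pair_gradient_ge0 (J : finType) (psi : config J -> R) xi :
  0 <= pair_gradient psi xi.
Proof. by apply: sumr_ge0 => a _; apply: sumr_ge0 => b _; exact: sqr_ge0. Qed.

Lemma canonical_gradient_add_particle (J : finType) M K (psi : config J -> R) b :
  (K <= M)%N ->
  canonical_gradient M K (fun xi => psi (add_particle xi b)) <=
  canonical_gradient M K.+1 psi.
Proof.
move=> KM; pose h (f : {ffun J -> 'I_M.+1}) : {ffun J -> 'I_M.+1} :=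
  [ffun j => inord (f j + (j == b))].
have hE f : (particles (config_of f)).+1 == K ->
    config_of (h f) = add_particle (config_of f) b.
  move=> /eqP fK; apply/ffunP => j; rewrite !ffunE inordK// ltnS.
  have := le_particles (config_of f) j; rewrite ffunE => fj.
  by apply: leq_trans KM; rewrite -fK -[leqRHS]addn1 leq_add// leq_b1.
rewrite /canonical_gradient (eq_bigr (fun f => pair_gradient psi (config_of (h f)))).
  apply: (ler_sum_inj (F := fun f => pair_gradient psi (config_of f))).
  - move=> f f' fK f'K hff'; apply: config_of_inj.
    have := hE f fK; rewrite hff' hE// => /ffunP e.
    by apply/ffunP => z; have := e z; rewrite !ffunE => /addIn.
  - by move=> f fK; rewrite hE// particles_add_particle eqSS.
  - by move=> f; exact: pair_gradient_ge0.
move=> f fK; rewrite hE//; apply: eq_bigr => a _; apply: eq_bigr => a' _.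
by rewrite ![in LHS](add_particleC _ _ b).
Qed.

(** Induction on K by removing one particle from each configuration: one gradient term moves the
    particle of the first from a to b, after which both share a particle at b. The bound is
    pointwise with a crude constant, which only has to be independent of psi. *)
Lemma canonical_poincare (J : finType) M K : (K <= M)%N ->
  exists2 C : R, 0 <= C & forall (psi : config J -> R) xi xi',
    particles xi = K -> particles xi' = K ->
    (psi xi - psi xi') ^+ 2 <= C * canonical_gradient M K psi.
Proof.
elim: K => [|K IH] KM.
  exists 0 => // psi xi xi' /particles_eq0 -> /particles_eq0 ->.
  by rewrite subrr expr0n mul0r.
have [C C0 HC] := IH (ltnW KM); exists (2 + 2 * C).
  by rewrite addr_ge0 ?mulr_ge0.
move=> psi xi xi' /add_particle_ex[a [eta [-> etaK]]] /add_particle_ex[b [eta' [-> eta'K]]].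
have h1 : (psi (add_particle eta a) - psi (add_particle eta b)) ^+ 2 <=
    canonical_gradient M K.+1 psi.
  have [f fE] := config_of_ex (leq_trans (eq_leq etaK) (ltnW KM)).
  rewrite /canonical_gradient (bigD1 f)/=; last by rewrite fE etaK.
  apply: ler_wpDr; first by apply: sumr_ge0 => *; exact: pair_gradient_ge0.
  rewrite fE /pair_gradient (bigD1 a)//= (bigD1 b)//= -addrA ler_wpDr//.
  rewrite addr_ge0//; first by apply: sumr_ge0 => *; exact: sqr_ge0.
  by apply: sumr_ge0 => *; apply: sumr_ge0 => *; exact: sqr_ge0.
have h2 := HC (fun xi => psi (add_particle xi b)) eta eta' etaK eta'K.
have h3 := ler_wpM2l C0 (canonical_gradient_add_particle psi b (ltnW KM)).
have h4 := sqr_ge0 ((psi (add_particle eta a) - psi (add_particle eta b)) -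
   (psi (add_particle eta b) - psi (add_particle eta' b))).
move: h1 h2 h3 h4; rewrite !expr2.
set x := psi (add_particle eta a); set y := psi (add_particle eta b).
set z := psi (add_particle eta' b); set D := canonical_gradient _ _ psi.
set D' := canonical_gradient _ _ _; clear; lra.
Qed.

(** As psi(xi)^2 <= 2 psi(xi')^2 + 2 (psi(xi) - psi(xi'))^2, averaging over xi' and
    [canonical_poincare] bound psi^2 pointwise by twice its canonical mean plus a gradient term.
    This constant is then summed against [V]. *)
Lemma canonical_inequality (J : finType) M K (V : config J -> R) (e : R) :
  (K <= M)%N -> 0 <= e -> (forall xi, 0 <= V xi) ->
  canonical_sum g M K V <= e * @canonical_sum R g J M K (fun=> 1) ->
  exists2 C : R, 0 <= C & forall psi : config J -> R,
    canonical_sum g M K (fun xi => V xi * psi xi ^+ 2) <=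
    2 * e * canonical_sum g M K (fun xi => psi xi ^+ 2) +
    C * canonical_gradient M K psi.
Proof.
move=> KM e0 V0 HV; have [C C0 HC] := canonical_poincare J KM.
set X := canonical_sum g M K (fun=> 1) in HV.
have X0 : 0 <= X by apply: canonical_sum_ge0.
exists (2 * e * X * C) => [|psi]; first by rewrite !mulr_ge0.
pose D := C * canonical_gradient M K psi.
pose Y := canonical_sum g M K (fun xi => psi xi ^+ 2).
have Y0 : 0 <= Y by apply: canonical_sum_ge0 => xi; exact: sqr_ge0.
have D0 : 0 <= D.
  by rewrite mulr_ge0//; apply: sumr_ge0 => *; exact: pair_gradient_ge0.
have [X00|Xn0] := eqVneq X 0.
  rewrite [leLHS](_ : _ = 0).
    by rewrite X00 mulr0 !mul0r addr0 mulr_ge0// mulr_ge0.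
  apply: big1 => f fK; exfalso; move: X00; apply/eqP; rewrite gt_eqF//.
  rewrite /X /canonical_sum (bigD1 f)//= mulr1 ltr_pwDl ?weight_gt0//.
  by apply: sumr_ge0 => i _; rewrite mulr1 ltW// weight_gt0.
have {Xn0}Xp : 0 < X by rewrite lt_neqAle eq_sym Xn0.
have pt xi : particles xi = K -> X * psi xi ^+ 2 <= 2 * Y + 2 * D * X.
  move=> xiK; rewrite -[X * _]mulrC /X -canonical_sumZ /Y -!canonical_sumZ -canonical_sumD.
  apply: canonical_sum_le => xi' xi'K; rewrite !mulr1.
  have := HC psi xi xi' xiK xi'K; rewrite -/D.
  have := sqr_ge0 (psi xi - 2 * psi xi').
  by set x := psi xi; set y := psi xi'; rewrite !expr2; clear; lra.
rewrite -(ler_pM2l Xp) -[leLHS]canonical_sumZ.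
apply: (@le_trans _ _ (canonical_sum g M K (fun xi => (2 * Y + 2 * D * X) * V xi))).
  apply: canonical_sum_le => xi xiK; rewrite mulrCA mulrC.
  by apply: ler_wpM2r => //; exact: pt.
rewrite canonical_sumZ.
have q0 : 0 <= 2 * Y + 2 * D * X.
  by rewrite addr_ge0//; [exact: mulr_ge0|apply: mulr_ge0 => //; exact: mulr_ge0].
apply: le_trans (ler_wpM2l q0 HV) _; rewrite -/Y.
rewrite le_eqVlt; apply/orP; left; apply/eqP; rewrite /D; ring.
Qed.

Variable phi : R.
Hypothesis phi_gt0 : 0 < phi.
Hypothesis phiD : partition_domain g phi.
Local Notation nu := (site_measure g phi).

Definition pair_dirichlet (I : finType) (psi : config I -> R) (x y : I) : R :=
  \int[iid_measure nu]_eta ((psi (add_particle eta x) - psi (add_particle eta y)) ^+ 2).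

Lemma iid_setT (I : finType) : @iid_measure R I nu setT = 1%E.
Proof. exact: probability_setT. Qed.

Section one_box.
Variables (J : finType) (M : nat) (V : config J -> R) (e : R).
Hypothesis e0 : 0 <= e.
Hypothesis V0 : forall xi, 0 <= V xi.
Hypothesis V_supp : forall xi, (M < particles xi)%N -> V xi = 0.
Hypothesis V_mean : forall K, (K <= M)%N ->
  canonical_sum g M K V <= e * @canonical_sum R g J M K (fun=> 1).

Lemma sum_restrict_le (I : finType) (em : J -> I) (P : pred {ffun J -> 'I_M.+1})
    (F : config I -> R) eta : 0 <= F eta ->
  \sum_(f | P f) (\1_[set eta | restrict_config em eta = config_of f] eta * F eta) <= F eta.
Proof.
move=> F0; rewrite -mulr_suml ler_piMl//.
have [[f fE]|nf] := pselect (exists f : {ffun J -> 'I_M.+1}, config_of f = restrict_config em eta).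
  rewrite big_mkcond (bigD1 f)//= big1 ?addr0.
    by case: (P f) => //; rewrite indicE; case: (_ \in _).
  move=> f' /eqP ff'; case: (P f') => //; rewrite indicE memNset//= => e'.
  by apply: ff'; apply: config_of_inj; rewrite fE e'.
rewrite big1// => f _; rewrite indicE memNset//= => ef.
by apply: nf; exists f.
Qed.

Lemma bounded_mfun_config_of (I : finType) (F : config I -> R) B :
  (forall eta, `|F eta| <= B) -> bounded_mfun F.
Proof. by move=> H; apply: bounded_mfun_config; exists B. Qed.

Lemma bounded_indic (I : finType) (A : set (config I)) : bounded_mfun (\1_A : config I -> R).
Proof.
apply: (@bounded_mfun_config_of _ _ 1) => eta; rewrite indicE.
by case: (_ \in _); rewrite ?normr0 ?normr1.
Qed.

(** Splitting by block content and filling an empty block reduces the claim to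
    [canonical_inequality] for each K <= M. The constant is chosen before [I] and the embedding, so
    it serves every torus and every position of the block. *)
Lemma box_inequality : exists2 C : R, 0 <= C &
  forall (I : finType) (em : J -> I) (psi : config I -> R), injective em ->
    bounded_function psi ->
    \int[iid_measure nu]_eta (V (restrict_config em eta) * psi eta ^+ 2) <=
    2 * e * \int[iid_measure nu]_eta (psi eta ^+ 2) +
    C * \sum_a \sum_b pair_dirichlet psi (em a) (em b).
Proof.
have HK (K : 'I_M.+1) : exists C, 0 <= C /\ forall psi : config J -> R,
    canonical_sum g M K (fun xi => V xi * psi xi ^+ 2) <=
    2 * e * canonical_sum g M K (fun xi => psi xi ^+ 2) +
    C * canonical_gradient M K psi.
  have KM : (K <= M)%N by rewrite -ltnS.
  by have [C C0 HC] := canonical_inequality KM e0 V0 (V_mean KM); exists C.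
have [C HC] := choice HK.
(* Converts the unweighted gradient: 1 / weight restores the weight of the remaining particles, and
   phi accounts for the one particle by which they fall short of K. *)
pose W (f : {ffun J -> 'I_M.+1}) : R := phi / weight g (config_of f).
have W0 f : 0 <= W f by rewrite divr_ge0 ?ltW// weight_gt0.
exists (\sum_(K < M.+1) C K * \sum_f W f).
  by apply: sumr_ge0 => K _; rewrite mulr_ge0 ?sumr_ge0//; case: (HC K).
move=> I em psi einj [B HB].
have N1 := iid_setT I.
pose O : set (config I) := [set eta | restrict_config em eta = [ffun=> 0%N]].
pose psi_ (eta : config I) (xi : config J) := psi (add_config em eta xi).
have b_psi (tau : config I -> config I) : bounded_mfun (fun eta => psi (tau eta)).
  by apply: (@bounded_mfun_config_of _ _ B) => eta; exact: HB.
have b_psi2 (tau : config I -> config I) : bounded_mfun (fun eta => psi (tau eta) ^+ 2).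
  by have := bounded_mfunM (b_psi tau) (b_psi tau).
have VB : exists BV, forall xi, V xi <= BV.
  exists (\sum_(f : {ffun J -> 'I_M.+1}) V (config_of f)) => xi.
  have [xM|xM] := leqP (particles xi) M; last by rewrite V_supp// sumr_ge0.
  have [f <-] := config_of_ex xM; rewrite (bigD1 f)//= lerDl sumr_ge0//.
have [BV HBV] := VB.
have b_ind (P : set (config I)) (F : config I -> R) : bounded_mfun F ->
    bounded_mfun (fun eta => \1_P eta * F eta).
  by move=> bF; apply: bounded_mfunM => //; exact: bounded_indic.
have key (K : 'I_M.+1) (F : config I -> R) : bounded_mfun F -> (forall eta, 0 <= F eta) ->
    \sum_(f : {ffun J -> 'I_M.+1} | particles (config_of f) == K)
      \int[iid_measure nu]_eta (\1_[set eta | restrict_config em eta = config_of f] eta * F eta) =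
    \int[iid_measure nu]_eta (\1_O eta * (phi ^+ K * canonical_sum g M K (fun xi => F (add_config em eta xi)))).
  move=> bF F0.
  have b_add xi : bounded_mfun (fun eta => F (add_config em eta xi)).
    by case: bF => _ [BF HF]; apply: (@bounded_mfun_config_of _ _ BF) => eta; exact: HF.
  under eq_bigr => f /eqP fK do rewrite mean_restrict// fK.
  rewrite -mean_sum//; last first.
    by move=> f; apply: b_ind; apply: bounded_mfunZ; exact: b_add.
  apply: eq_Rintegral => eta _; rewrite /canonical_sum -mulr_sumr; congr (_ * _).
  by rewrite mulr_sumr; apply: eq_bigr => f _; ring.
have level (X : {ffun J -> 'I_M.+1} -> R) :
    \sum_(f | (particles (config_of f) <= M)%N) X f =
    \sum_(K < M.+1) \sum_(f | particles (config_of f) == K) X f.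
  rewrite (partition_big (fun f => inord (particles (config_of f)) : 'I_M.+1) predT)//=.
  apply: eq_bigr => K _; apply: eq_bigl => f; apply/andP/eqP => [[fM /eqP <-]|fK].
    by rewrite inordK.
  by rewrite fK -ltnS ltn_ord; split=> //; apply/eqP/val_inj; rewrite /= inordK.
pose PG (eta : config I) := \sum_a \sum_b
  (psi (add_particle eta (em a)) - psi (add_particle eta (em b))) ^+ 2.
have PG0 eta : 0 <= PG eta.
  by apply: sumr_ge0 => a _; apply: sumr_ge0 => b _; exact: sqr_ge0.
have b_diff a b : bounded_mfun (fun eta : config I =>
    (psi (add_particle eta a) - psi (add_particle eta b)) ^+ 2).
  apply: (@bounded_mfun_config_of _ _ ((B + B) ^+ 2)) => eta.
  rewrite normrX; apply: lerXn2r; rewrite ?nnegrE//.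
    by rewrite addr_ge0// (le_trans (normr_ge0 _) (HB eta)).
  by apply: le_trans (ler_normB _ _) _; rewrite lerD.
have b_PG : bounded_mfun PG.
  by apply: bounded_mfun_sum => a; apply: bounded_mfun_sum => b; exact: b_diff.
have PGE : \int[iid_measure nu]_eta PG eta = \sum_a \sum_b pair_dirichlet psi (em a) (em b).
  rewrite mean_sum//; last by move=> a; apply: bounded_mfun_sum => b; exact: b_diff.
  by apply: eq_bigr => a _; rewrite mean_sum// => b; exact: b_diff.
have PGI : 0 <= \int[iid_measure nu]_eta PG eta by apply: Rintegral_ge0 => eta _; exact: PG0.
pose F1 (eta : config I) := V (restrict_config em eta) * psi eta ^+ 2.
have F10 eta : 0 <= F1 eta by rewrite mulr_ge0// sqr_ge0.
have b_F1 : bounded_mfun F1.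
  apply: bounded_mfunM; last exact: (b_psi2 id).
  by apply: (@bounded_mfun_config_of _ _ BV) => eta; rewrite ger0_norm.
have b_psi2id : bounded_mfun (fun eta => psi eta ^+ 2) := b_psi2 id.
have psi20 eta : 0 <= psi eta ^+ 2 by exact: sqr_ge0.
have step1 : \int[iid_measure nu]_eta F1 eta = \sum_(K < M.+1) \int[iid_measure nu]_eta (\1_O eta *
    (phi ^+ K * canonical_sum g M K (fun xi => F1 (add_config em eta xi)))).
  under [RHS]eq_bigr do rewrite -key//.
  rewrite -level -mean_sum//; last by move=> f; exact: b_ind.
  apply: eq_Rintegral => eta _; rewrite -mulr_suml.
  have [xM|xM] := leqP (particles (restrict_config em eta)) M; last first.
    by rewrite /F1 V_supp// mul0r mulr0.
  have [f fE] := config_of_ex xM.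
  rewrite (bigD1 f)/= ?fE// indicE mem_set// big1 ?addr0 ?mul1r// => f' /andP[_ ff'].
  rewrite indicE memNset//= => e'; move/eqP: ff'; apply.
  by apply: config_of_inj; rewrite fE e'.
have b_csum (K : nat) (H : config J -> config I -> R) : (forall xi, bounded_mfun (H xi)) ->
    bounded_mfun (fun eta => canonical_sum g M K (fun xi => H xi eta)).
  by move=> bH; apply: bounded_mfun_sum => f; apply: bounded_mfunZ.
have step2 : \sum_(K < M.+1) \int[iid_measure nu]_eta (\1_O eta *
    (phi ^+ K * canonical_sum g M K (fun xi => psi (add_config em eta xi) ^+ 2))) <=
    \int[iid_measure nu]_eta (psi eta ^+ 2).
  under eq_bigr do rewrite -(key _ (fun eta => psi eta ^+ 2))//.
  rewrite -level -mean_sum//; last by move=> f; exact: b_ind.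
  apply: mean_le => //; first by apply: bounded_mfun_sum => f; exact: b_ind.
  move=> eta; exact: (@sum_restrict_le _ em (fun f => (particles (config_of f) <= M)%N)
    (fun eta => psi eta ^+ 2) eta (psi20 eta)).
have b_grad (K : nat) : bounded_mfun (fun eta => canonical_gradient M K (psi_ eta)).
  apply: bounded_mfun_sum => f; apply: bounded_mfun_sum => a; apply: bounded_mfun_sum => b.
  rewrite (_ : (fun _ => _) = fun eta => (psi (add_config em eta (add_particle (config_of f) a))
    - psi (add_config em eta (add_particle (config_of f) b))) ^+ 2)//.
  apply: (@bounded_mfun_config_of _ _ ((B + B) ^+ 2)) => eta.
  rewrite normrX; apply: lerXn2r; rewrite ?nnegrE//.
    by rewrite addr_ge0// (le_trans (normr_ge0 _) (HB eta)).
  by apply: le_trans (ler_normB _ _) _; rewrite lerD.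
have step3 (K : 'I_M.+1) : \int[iid_measure nu]_eta (\1_O eta *
    (phi ^+ K * canonical_gradient M K (psi_ eta))) <=
    (\sum_f W f) * \int[iid_measure nu]_eta PG eta.
  have E eta f : pair_gradient (psi_ eta) (config_of f) = PG (add_config em eta (config_of f)).
    rewrite /pair_gradient /PG /psi_; apply: eq_bigr => a _; apply: eq_bigr => b _.
    by rewrite !add_config_add_particle.
  rewrite (_ : (fun eta => _) = fun eta => \sum_(f : {ffun J -> 'I_M.+1} |
      (particles (config_of f)).+1 == K) W f * (\1_O eta * (weight g (config_of f) *
       phi ^+ particles (config_of f) * PG (add_config em eta (config_of f))))); last first.
    apply/funext => eta; rewrite /canonical_gradient !mulr_sumr.
    apply: eq_bigr => f /eqP <-; rewrite E /W exprS.
    by have := weight_gt0 g (config_of f) => w0; field; rewrite gt_eqF.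
  have b_PGf f : bounded_mfun (fun eta => \1_O eta * (weight g (config_of f) *
       phi ^+ particles (config_of f) * PG (add_config em eta (config_of f)))).
    apply: b_ind; apply: bounded_mfunZ; case: b_PG => _ [BP HBP].
    by apply: (@bounded_mfun_config_of _ _ BP) => eta; exact: HBP.
  rewrite mean_sum//; last by move=> f; apply: bounded_mfunZ.
  rewrite [leRHS]mulr_suml [leLHS]big_mkcond; apply: ler_sum => f _.
  case: ifP => [fK|_]; last by rewrite mulr_ge0.
  rewrite meanZ// ler_wpM2l// -mean_restrict//.
  apply: mean_le => //; first exact: b_ind.
  move=> eta; rewrite ler_piMl// indicE; by case: (_ \in _).
rewrite -PGE [leLHS]step1.
apply: (@le_trans _ _ (\sum_(K < M.+1) \int[iid_measure nu]_eta (2 * e * (\1_O eta *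
    (phi ^+ K * canonical_sum g M K (fun xi => psi (add_config em eta xi) ^+ 2))) +
    C K * (\1_O eta * (phi ^+ K * canonical_gradient M K (psi_ eta)))))).
  apply: ler_sum => K _; apply: mean_le => //.
  - apply: b_ind; apply: bounded_mfunZ; apply: (b_csum _ (fun xi eta => F1 (add_config em eta xi))) => xi.
    by case: b_F1 => _ [BP HBP]; apply: (@bounded_mfun_config_of _ _ BP) => eta; exact: HBP.
  - apply: bounded_mfunD; apply: bounded_mfunZ; apply: b_ind; apply: bounded_mfunZ => //.
    by apply: (b_csum _ (fun xi eta => psi (add_config em eta xi) ^+ 2)) => xi; exact: b_psi2.
  move=> eta; rewrite indicE; case: (boolP (eta \in O)) => [|_]; last first.
    by rewrite !mul0r !mulr0 addr0.
  rewrite inE /O/= => etaO; rewrite !mul1r.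
  rewrite mulrCA [C K * _]mulrCA -mulrDr ler_wpM2l ?exprn_ge0 ?(ltW phi_gt0)//.
  have [_ /(_ (psi_ eta))] := HC K; apply: le_trans.
  apply: canonical_sum_le => xi _.
  by rewrite /F1 restrict_add_config.
rewrite (eq_bigr (fun K : 'I_M.+1 => 2 * e * \int[iid_measure nu]_eta (\1_O eta *
    (phi ^+ K * canonical_sum g M K (fun xi => psi (add_config em eta xi) ^+ 2))) +
    C K * \int[iid_measure nu]_eta (\1_O eta * (phi ^+ K * canonical_gradient M K (psi_ eta))))); last first.
  move=> K _.
  have b1 : bounded_mfun (fun eta => \1_O eta * (phi ^+ K *
      canonical_sum g M K (fun xi => psi (add_config em eta xi) ^+ 2))).
    apply: b_ind; apply: bounded_mfunZ.
    by apply: (b_csum _ (fun xi eta => psi (add_config em eta xi) ^+ 2)) => xi; exact: b_psi2.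
  have b2 : bounded_mfun (fun eta => \1_O eta * (phi ^+ K * canonical_gradient M K (psi_ eta))).
    by apply: b_ind; apply: bounded_mfunZ.
  by rewrite meanD ?meanZ//; exact: bounded_mfunZ.
rewrite big_split/= lerD//.
  by rewrite -mulr_sumr ler_wpM2l// mulr_ge0.
rewrite mulr_suml; apply: ler_sum => K _; rewrite -mulrA.
by apply: ler_wpM2l (step3 K); case: (HC K).
Qed.

End one_box.
End box_inequality.

(** * Jump processes and the Feynman-Kac bound *)

Section mixture.
Context {R : realType} {I : finType}.
Local Notation S := (config I).

Lemma esum_exchange (T1 T2 : choiceType) (a : T1 -> T2 -> \bar R) :
  (forall i j, 0 <= a i j)%E ->
  (\esum_(i in [set: T1]) \esum_(j in [set: T2]) a i j =
   \esum_(j in [set: T2]) \esum_(i in [set: T1]) a i j)%E.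
Proof.
move=> a0; rewrite !esum_esum//.
rewrite (reindex_esum ([set: T1] `*`` (fun=> [set: T2])) ([set: T2] `*`` (fun=> [set: T1]))
  (fun k => (k.2, k.1)) (fun k => a k.2 k.1))//.
split => [[x y]//|[x y] [x' y'] _ _ [-> ->]//|[x y] _]; by exists (y, x).
Qed.

Lemma integral_mixture (m m' : {measure set S -> \bar R}) (k : S -> {measure set S -> \bar R})
    (f : S -> \bar R) :
  (forall A, m A = \int[m']_y k y A)%E -> (forall x, 0 <= f x)%E ->
  (\int[m]_x f x = \int[m']_y \int[k y]_x f x)%E.
Proof.
move=> mE f0.
have E := integral_esum (@pickle_config_inj I) (@config_measurable I).
have mf (h : S -> \bar R) : measurable_fun [set: S] h by [].
rewrite E//; transitivity (\esum_(x in [set: S]) \esum_(y in [set: S])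
    (f x * k y [set x] * m' [set y]))%E.
  by apply: eq_esum => x _; rewrite mE -ge0_integralZl// E// => y; rewrite mule_ge0.
rewrite esum_exchange; last by move=> x y; rewrite !mule_ge0.
rewrite [RHS]E; last by move=> y; exact: integral_ge0.
apply: eq_esum => y _; rewrite -ge0_integralZr// E; last by move=> x; rewrite mule_ge0.
by apply: eq_esum => x _; rewrite muleAC.
Qed.

Lemma mean_mixture (m m' : {measure set S -> \bar R}) (k : S -> {measure set S -> \bar R})
    (f : S -> R) :
  m setT = 1%E -> m' setT = 1%E -> (forall y, k y setT = 1%E) ->
  (forall A, m A = \int[m']_y k y A)%E -> bounded_function f ->
  \int[m]_x f x = \int[m']_y (\int[k y]_x f x).
Proof.
move=> m1 m'1 k1 mE [B HB].
have H (h : S -> R) C : (forall x, 0 <= h x) -> (forall x, h x <= C) ->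
    \int[m]_x h x = \int[m']_y (\int[k y]_x h x).
  move=> h0 hC; congr fine; rewrite (integral_mixture mE); last by move=> x; rewrite lee_fin.
  apply: eq_integral => y _; rewrite EFin_mean//.
  by apply: bounded_mfun_config; exists C => x; rewrite ger0_norm.
have bf : bounded_mfun f by apply: bounded_mfun_config; exists B.
have b1 : bounded_mfun (cst B : S -> R) by exact: bounded_mfun_cst.
have bk : bounded_mfun (fun y => \int[k y]_x f x).
  apply: bounded_mfun_config; exists B => y; exact: mean_norm_le.
have := H (fun x => f x + B) (B + B).
rewrite meanD// mean_cst// => e; apply: (addIr B).
rewrite e; last 2 first.
- by move=> x; have := HB x; rewrite ler_norml; lra.
- by move=> x; have := HB x; rewrite ler_norml; lra.
rewrite -[B in RHS](mean_cst m'1) -meanD//; apply: eq_Rintegral => y _.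
by rewrite meanD// mean_cst.
Qed.

Lemma law_ex {d} {Omega : measurableType d} (P : probability Omega R) (X : Omega -> S) :
  measurable_fun [set: Omega] X ->
  exists m : probability S R, (forall A, m A = P (X @^-1` A)) /\
    forall f : S -> R, bounded_function f -> \int[P]_w f (X w) = \int[m]_x f x.
Proof.
move=> mX; pose Y := mfun_Sub (mem_set mX).
exists (distribution P Y); split=> // f [B HB].
congr fine; rewrite [RHS](integral_distribution (X := Y) (f := EFin \o f))//.
apply: bounded_mfun_integrable; first exact: probability_setT.
split; last by exists B => w; exact: HB.
exact: (measurableT_comp _ mX).
Qed.

(** The Markov property is given for one present state and one future event at a time; it is summed
    over the countably many present states. *)
Lemma mean_markov {d} {Omega : measurableType d} (P : probability Omega R)
    (X Y : Omega -> S) (k : S -> {measure set S -> \bar R}) (f : S -> R) :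
  measurable_fun [set: Omega] X -> measurable_fun [set: Omega] Y ->
  (forall x, k x setT = 1%E) ->
  (forall x A, P ((X @^-1` [set x]) `&` (Y @^-1` A)) = P (X @^-1` [set x]) * k x A)%E ->
  bounded_function f ->
  \int[P]_w f (Y w) = \int[P]_w (\int[k (X w)]_x f x).
Proof.
move=> mX mY k1 XY bf.
have [mu [muE mufE]] := law_ex P mX; have [nu [nuE nufE]] := law_ex P mY.
rewrite nufE// (mufE (fun x => \int[k x]_y f y)); last first.
  case: bf => B HB; exists B => x; apply: mean_norm_le => //.
  by apply: bounded_mfun_config; exists B.
apply: mean_mixture => //; [exact: probability_setT|exact: probability_setT|].
move=> A; rewrite /= nuE (integral_esum (@pickle_config_inj I) (@config_measurable I))//.
transitivity (\esum_(x in [set: S]) P ((X @^-1` [set x]) `&` (Y @^-1` A)))%E; last first.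
  by apply: eq_esum => x _; rewrite XY /= muE muleC.
pose F n := [set x : S | pickle x = n].
have FT : \bigcup_n F n = [set: S] by rewrite -subTset => x _; exists (pickle x).
have tF : trivIset setT F by move=> i j _ _ [x []]; rewrite /F/= => <- <-.
have mXA B : measurable (X @^-1` B) by rewrite -[X in measurable X]setTI; exact: mX.
have mYA : measurable (Y @^-1` A) by rewrite -[X in measurable X]setTI; exact: mY.
rewrite -FT nneseries_sum_bigcup//.
transitivity (P (\bigcup_n ((X @^-1` F n) `&` (Y @^-1` A)))).
  congr (P _); rewrite -setI_bigcupl -preimage_bigcup FT preimage_setT setTI//.
rewrite measure_bigcup//; last 2 first.
- by move=> n _; exact: measurableI.
- apply: trivIset_setIr; apply/trivIsetP => i j _ _ ij.
  rewrite -preimage_setI (_ : F i `&` F j = set0) ?preimage_set0//.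
  by move/trivIsetP : tF; exact.
rewrite (eq_eseriesl (Q := xpredT)); last by move=> n; rewrite in_setT.
apply: eq_eseriesr => n _; have [[x xn]|Fn] := pselect (exists x, F n x).
  have -> : F n = [set x].
    by apply/seteqP; split => y /=; [rewrite -xn => /pickle_config_inj|move=> ->].
  by rewrite esum_set1.
have -> : F n = set0 by rewrite -subset0 => x Fx; apply: Fn; exists x.
by rewrite preimage_set0 set0I measure0 esum_set0.
Qed.

End mixture.

(** * Short time expansion for bounded jump rates *)

Section jump_semigroup.
Context {R : realType} {I : finType}.
Local Notation S := (config I).
Variables (K : finType) (r : K -> S -> R) (tau : K -> S -> S) (Lam : R).
Hypothesis r_ge0 : forall i x, 0 <= r i x.
Hypothesis r_sum : forall x, \sum_i r i x <= Lam.

Definition jump_generator (f : S -> R) (x : S) : R :=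
  \sum_i r i x * (f (tau i x) - f x).

Local Notation L := jump_generator.

Lemma Lam_ge0 : 0 <= Lam.
Proof. by apply: le_trans (r_sum point); apply: sumr_ge0. Qed.

Lemma jump_generator_bound (f : S -> R) (B : R) : (forall x, `|f x| <= B) ->
  forall x, `|L f x| <= 2 * Lam * B.
Proof.
move=> HB x; apply: le_trans (ler_norm_sum _ _ _) _.
apply: (@le_trans _ _ (\sum_i r i x * (2 * B))).
  apply: ler_sum => i _; rewrite normrM ger0_norm// ler_wpM2l//.
  by apply: le_trans (ler_normB _ _) _; rewrite mulr_natl mulr2n lerD.
rewrite -mulr_suml mulrCA -mulrA ler_wpM2l// ler_wpM2r//.
exact: le_trans (HB x).
Qed.

Variable P : R -> R.-pker S ~> S.
Hypothesis PL : transition_semigroup jump_generator P.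

Lemma kernel1 t x : P t x setT = 1%E.
Proof. exact: prob_kernel. Qed.

(* A quantity b with b(2s) <= 2 b(s) + 2 c s^2 and right derivative at most a at 0. *)
Lemma doubling_bound (b : R -> R) (a c t : R) : 0 <= t -> 0 <= c -> b 0 <= 0 ->
  (forall s, 0 <= s -> b (s + s) <= 2 * b s + 2 * c * s ^+ 2) ->
  (forall e, 0 < e -> \forall s \near 0^'+, b s <= (a + e) * s) ->
  b t <= a * t + c * t ^+ 2.
Proof.
move=> t0 c0 b0 Hb Ha; have [->|tn0] := eqVneq t 0; first by rewrite expr0n !mulr0 addr0.
have {tn0} tp : 0 < t by rewrite lt_neqAle eq_sym tn0.
(* The quadratic error reproduces itself under doubling: 2 c x^2 + 2 c x^2 = c (2 x)^2. *)
have H (j : nat) s : 0 <= s -> b (2 ^+ j * s) <= 2 ^+ j * b s + c * (2 ^+ j * s) ^+ 2.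
  move=> s0; elim: j => [|j IH]; first by rewrite expr0 !mul1r lerDl mulr_ge0 ?sqr_ge0.
  have p0 : 0 <= 2 ^+ j * s by rewrite mulr_ge0 ?exprn_ge0.
  rewrite exprS -mulrA; set x := 2 ^+ j * s in IH p0 *.
  have -> : 2 * x = x + x by ring.
  apply: le_trans (Hb _ p0) _.
  have -> : (x + x) ^+ 2 = 4 * x ^+ 2 by ring.
  by move: IH; lra.
apply/ler_addgt0Pr => e e0.
have [d /= d0 Hd] := Ha (e / t) (divr_gt0 e0 tp).
pose j := Num.bound (t / d); pose s := t / 2 ^+ j.
have j2 : 0 < 2 ^+ j :> R by rewrite exprn_gt0.
have s0 : 0 < s by rewrite divr_gt0.
have sd : s < d.
  rewrite ltr_pdivrMr// mulrC -ltr_pdivrMr//.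
  apply: lt_le_trans (archi_boundP _) _; first by rewrite divr_ge0// ltW.
  by rewrite -natrX ler_nat ltnW// ltn_expl.
have bs : b s <= (a + e / t) * s.
  by apply: Hd => //=; rewrite sub0r normrN gtr0_norm.
have ts : 2 ^+ j * s = t by rewrite mulrC divfK// gt_eqF.
have := H j s (ltW s0); rewrite ts => h; apply: le_trans h _.
have : 2 ^+ j * b s <= 2 ^+ j * ((a + e / t) * s) by rewrite ler_pM2l.
have -> : 2 ^+ j * ((a + e / t) * s) = (a + e / t) * (2 ^+ j * s) by ring.
rewrite ts mulrDl divfK ?gt_eqF//; lra.
Qed.

Lemma bounded_kernel_mean t (f : S -> R) (B : R) : (forall x, `|f x| <= B) ->
  forall x, `|\int[P t x]_y f y| <= B.
Proof.
move=> HB x; apply: mean_norm_le => //; first exact: kernel1.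
by apply: bounded_mfun_config; exists B.
Qed.

Lemma semigroup_mean s t (f : S -> R) x : 0 <= s -> 0 <= t -> bounded_function f ->
  \int[P (s + t) x]_y f y = \int[P s x]_z (\int[P t z]_y f y).
Proof.
move=> s0 t0 bf; apply: (mean_mixture (k := P t)) => //; try by move=> *; exact: kernel1.
by move=> A; rewrite (semigroupD PL).
Qed.

Lemma mean_indic t x (A : set S) : \int[P t x]_y \1_A y = fine (P t x A).
Proof. by rewrite /Rintegral integral_indic// setIT. Qed.

Lemma near_generator (f : S -> R) x e : bounded_function f -> 0 < e ->
  \forall t \near 0^'+, `|\int[P t x]_y f y - f x - t * L f x| <= e * t.
Proof.
move=> bf e0; have /cvgrPdist_le/(_ e e0) := @semigroup_generator _ _ _ _ PL f x bf.
move=> H; near=> t.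
have t0 : 0 < t by near: t; exact: nbhs_right_gt.
have : `|L f x - (\int[P t x]_y f y - f x) / t| <= e by near: t.
set F := \int[P t x]_y f y => h.
have -> : F - f x - t * L f x = ((F - f x) / t - L f x) * t.
  by field; rewrite gt_eqF.
by rewrite normrM (gtr0_norm t0) ler_pM2r// distrC.
Unshelve. all: by end_near. Qed.

(** Being at x after s and again after s + s gives P_2s(x, x) >= P_s(x, x)^2, so the probability of
    being elsewhere at most doubles with the time, and [doubling_bound] applies with c = 0. *)
Lemma kernel_stay t x : 0 <= t -> fine (P t x (~` [set x])) <= Lam * t.
Proof.
move=> t0.
have E s : fine (P s x (~` [set x])) = 1 - \int[P s x]_y \1_[set x] y.
  rewrite mean_indic.
  have : (P s x [set x] + P s x (~` [set x]) = 1)%E.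
    by rewrite -measureU//; [rewrite setUv; exact: kernel1|rewrite setICr].
  have fn A : P s x A = (fine (P s x A))%:E.
    rewrite fineK// ge0_fin_numE// (@le_lt_trans _ _ (P s x setT))//.
      by apply: le_measure; rewrite ?inE.
    by rewrite (_ : P s x setT = 1%E) ?ltry//; exact: kernel1.
  by rewrite (fn [set x]) (fn (~` [set x])) -EFinD => -[]; lra.
have bi : bounded_function (\1_[set x] : S -> R).
  by exists 1 => y; rewrite indicE; case: (_ \in _); rewrite ?normr0 ?normr1.
have := @doubling_bound (fun s => fine (P s x (~` [set x]))) Lam 0 t t0 (lexx 0).
rewrite !mul0r addr0; apply.
- by rewrite (semigroup0 PL) diracE memNset//= => /(_ erefl).
- move=> s s0; rewrite !mulr0 mul0r addr0 !E semigroup_mean//.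
  pose a := \int[P s x]_y \1_[set x] y; have : a * a <= \int[P s x]_z \int[P s z]_y \1_[set x] y.
    rewrite -(meanZ (kernel1 s x) a (bounded_mfun_config bi)).
    apply: mean_le => //.
    - exact: kernel1.
    - by apply: bounded_mfunZ; exact: bounded_mfun_config.
    - apply: bounded_mfun_config; exists 1; apply: bounded_kernel_mean => y.
      by rewrite indicE; case: (_ \in _); rewrite ?normr0 ?normr1.
    - move=> z; rewrite indicE; case: (boolP (z \in [set x])) => [|_].
        by rewrite inE/= => ->; rewrite mulr1.
      by rewrite mulr0; apply: Rintegral_ge0 => y _; rewrite indicE ler0n.
  by have := sqr_ge0 (1 - a); rewrite expr2 -/a; lra.
- have LLam : - Lam <= L (\1_[set x]) x.
    rewrite lerNl -sumrN; apply: le_trans (r_sum x); apply: ler_sum => i _.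
    rewrite -mulrN ler_piMr//.
  move=> e e0; near=> s; have s0 : 0 < s by near: s; exact: nbhs_right_gt.
  have : `|\int[P s x]_y \1_[set x] y - \1_[set x] x - s * L \1_[set x] x| <= e * s.
    by near: s; exact: near_generator.
  have i1 : (\1_[set x] : S -> R) x = 1 by rewrite indicE mem_set.
  rewrite E i1 ler_norml => /andP[h _].
  by have := ler_wpM2l (ltW s0) LLam; lra.
Unshelve. all: by end_near. Qed.

Lemma kernel_dist t (f : S -> R) (B : R) x : 0 <= t -> (forall y, `|f y| <= B) ->
  `|\int[P t x]_y f y - f x| <= 2 * B * Lam * t.
Proof.
move=> t0 HB.
have bf : bounded_mfun f by apply: bounded_mfun_config; exists B.
have bc c : bounded_mfun (cst c : S -> R) by exact: bounded_mfun_cst.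
have bi : bounded_mfun (\1_(~` [set x]) : S -> R).
  apply: bounded_mfun_config; exists 1 => y.
  by rewrite indicE; case: (_ \in _); rewrite ?normr0 ?normr1.
rewrite -[f x in leLHS](mean_cst (kernel1 t x)) -(meanB (kernel1 t x))//; last exact: bc.
have B0 : 0 <= B by exact: le_trans (HB x).
have bd : bounded_mfun (fun y => 2 * B * \1_(~` [set x]) y) by exact: bounded_mfunZ.
have pt y : `|f y - f x| <= 2 * B * \1_(~` [set x]) y.
  rewrite indicE; have [->|/eqP yx] := eqVneq y x.
    by rewrite subrr normr0 memNset ?mulr0//= => /(_ erefl).
  rewrite mem_set// mulr1; apply: le_trans (ler_normB _ _) _.
  by rewrite mulr_natl mulr2n lerD.
have bfx : bounded_mfun (fun y => f y - f x).
  by have := bounded_mfunD bf (bc (- f x)).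
apply: (@le_trans _ _ (\int[P t x]_y (2 * B * \1_(~` [set x]) y))).
  rewrite ler_norml; apply/andP; split.
    rewrite -mulN1r -(meanZ (kernel1 t x))//; apply: (mean_le (kernel1 t x)) => //.
      exact: bounded_mfunZ.
    by move=> y; have := pt y; rewrite ler_norml mulN1r => /andP[].
  apply: (mean_le (kernel1 t x)) => // y.
  by have := pt y; rewrite ler_norml => /andP[].
rewrite (meanZ (kernel1 t x))// mean_indic -[leRHS]mulrA.
by apply: ler_wpM2l (kernel_stay x t0); exact: mulr_ge0.
Qed.

(** With h = P_s f - f, the defect at time 2 s minus twice the defect at time s is P_s h - h, which
    is of order s^2 by applying [kernel_dist] twice. Doubling then turns the pointwise derivative at
    0 into an estimate uniform in x. *)
Lemma semigroup_expansion t (f : S -> R) (B : R) x : 0 <= t -> (forall y, `|f y| <= B) ->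
  `|\int[P t x]_y f y - f x - t * L f x| <= 2 * B * Lam ^+ 2 * t ^+ 2.
Proof.
move=> t0 HB; have B0 : 0 <= B by exact: le_trans (HB x).
have bf : bounded_function f by exists B.
have := @doubling_bound (fun s => `|\int[P s x]_y f y - f x - s * L f x|)
  0 (2 * B * Lam ^+ 2) t t0.
rewrite (mul0r t) add0r; apply.
- by apply: mulr_ge0; [exact: mulr_ge0|exact: sqr_ge0].
- rewrite (_ : \int[P 0 x]_y f y = f x) ?mul0r ?subr0 ?subrr ?normr0//.
  rewrite -[RHS](@mean_cst _ _ _ (P 0 x) (kernel1 0 x)).
  congr fine; apply: (eq_integral_null_set (@pickle_config_inj I) (@config_measurable I)) => y.
  rewrite (semigroup0 PL) diracE; case: (boolP (x \in [set y])) => [|_]; last by rewrite eqxx.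
  by rewrite inE/= => ->.
- move=> s s0; rewrite semigroup_mean//.
  pose h y := \int[P s y]_z f z - f y.
  have Hh y : `|h y| <= 2 * B * Lam * s by exact: kernel_dist.
  have bP : bounded_mfun (fun y => \int[P s y]_z f z).
    by apply: bounded_mfun_config; exists B; exact: bounded_kernel_mean.
  have bfm : bounded_mfun f by exact: bounded_mfun_config.
  have E : \int[P s x]_z h z = \int[P s x]_z \int[P s z]_y f y - \int[P s x]_z f z.
    by rewrite -(meanB (kernel1 s x)).
  have := kernel_dist x s0 Hh; rewrite E {1}/h.
  set a := \int[P s x]_z \int[P s z]_y f y; set b := \int[P s x]_y f y => h1.
  have -> : a - f x - (s + s) * L f x =
      2 * (b - f x - s * L f x) + (a - b - (b - f x)) by ring.
  apply: le_trans (ler_normD _ _) _; rewrite normrM [`|2|]ger0_norm//.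
  rewrite lerD2l; apply: le_trans h1 _.
  by rewrite le_eqVlt; apply/orP; left; apply/eqP; ring.
- by move=> e e0; rewrite add0r; exact: near_generator.
Qed.

End jump_semigroup.

(** * Euler scheme for the Feynman-Kac semigroup *)

Section feynman_kac.
Context {R : realType} {I : finType}.
Local Notation S := (config I).
Variables (K : finType) (r : K -> S -> R) (tau : K -> S -> S) (Lam : R).
Hypothesis r_ge0 : forall i x, 0 <= r i x.
Hypothesis r_sum : forall x, \sum_i r i x <= Lam.
Local Notation L := (jump_generator r tau).

Context {d : measure_display} {Omega : measurableType d}.
Variables (Pr : probability Omega R) (mu : probability S R) (X : R -> Omega -> S).
Hypothesis XP : markov_jump_process Pr L mu X.

Local Notation law t f := (\int[Pr]_w f (X t w)).

Lemma process_bounded_mfun (f : S -> R) t : 0 <= t -> bounded_function f ->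
  bounded_mfun (fun w => f (X t w)).
Proof.
move=> t0 [B HB]; split; last by exists B => w; exact: HB.
exact: (measurableT_comp _ (process_measurable XP t0)).
Qed.

Lemma process_law0 (f : S -> R) : bounded_function f -> law 0 f = \int[mu]_x f x.
Proof.
move=> bf; have [m [mE mf]] := law_ex Pr (process_measurable XP (lexx 0)).
rewrite mf//; congr fine; apply: eq_measure_integral => A _ _ /=.
by rewrite mE (process_initial XP).
Qed.

Lemma process_law_expansion t h (f : S -> R) (B : R) : 0 <= t -> 0 <= h ->
  (forall x, `|f x| <= B) ->
  law (t + h) f <= law t f + h * law t (L f) + 2 * B * Lam ^+ 2 * h ^+ 2 /\
  law t f + h * law t (L f) <= law (t + h) f + 2 * B * Lam ^+ 2 * h ^+ 2.
Proof.
move=> t0 h0 HB; have [P PL HP] := process_markov XP.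
have bf : bounded_function f by exists B.
have P1 : Pr setT = 1%E := probability_setT Pr.
have E : law (t + h) f = law t (fun x => \int[P h x]_y f y).
  apply: (mean_markov (k := P h)) => //.
  - exact: (process_measurable XP t0).
  - by apply: (process_measurable XP); exact: addr_ge0.
  - by move=> x; exact: prob_kernel.
  move=> x A; have := HP h t [::] x A h0 t0 (fun _ => ltac:(by [])).
  by rewrite (_ : [set w | _ /\ X t w = x] = X t @^-1` [set x])//;
    apply/seteqP; split => [w []//|w ]; split.
have e2 x := semigroup_expansion r_ge0 r_sum PL x h0 HB.
set c := 2 * B * Lam ^+ 2 * h ^+ 2 in e2 *.
have bPf : bounded_function (fun x => \int[P h x]_y f y).
  exists B => x; exact: bounded_kernel_mean.
have bLf : bounded_function (L f).
  by exists (2 * Lam * B) => x; exact: jump_generator_bound.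
have b1 := process_bounded_mfun t0 bf; have b2 := process_bounded_mfun t0 bLf.
have b3 := process_bounded_mfun t0 bPf.
have b4 : bounded_mfun (fun _ : Omega => c) by exact: bounded_mfun_cst.
rewrite E -(meanZ P1 h b2) -(meanD P1)//; last exact: bounded_mfunZ.
have bsum : bounded_mfun (fun w => f (X t w) + h * L f (X t w)).
  by apply: bounded_mfunD => //; exact: bounded_mfunZ.
split.
  rewrite -[X in _ + X](mean_cst P1) -(meanD P1 bsum b4).
  apply: (mean_le P1 b3 (bounded_mfunD bsum b4)) => w.
  by have := e2 (X t w); rewrite ler_norml => /andP[_]; lra.
rewrite -[X in _ <= _ + X](mean_cst P1) -(meanD P1 b3 b4).
apply: (mean_le P1 bsum (bounded_mfunD b3 b4)) => w.
by have := e2 (X t w); rewrite ler_norml => /andP[+ _]; lra.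
Qed.

(** Over n steps of length t / n the second order errors add up to a multiple of 1 / n. It will be
    applied to cut-off particle numbers. *)
Lemma law_conserved t (f : S -> R) : 0 <= t -> bounded_function f ->
  (forall x, L f x = 0) -> law t f = \int[mu]_x f x.
Proof.
move=> t0 bf Lf0; rewrite -process_law0//; case: (bf) => B HB.
have B0 : 0 <= B by exact: le_trans (HB point).
pose C := 2 * B * Lam ^+ 2.
have C0 : 0 <= C by rewrite mulr_ge0 ?sqr_ge0// mulr_ge0.
have law0 s : law s (L f) = 0.
  rewrite -[RHS](mean_cst (probability_setT Pr) 0); apply: eq_Rintegral => w _.
  exact: Lf0.
have step h n : 0 <= h -> `|law (n%:R * h) f - law 0 f| <= n%:R * (C * h ^+ 2).
  move=> h0; elim: n => [|n IH]; first by rewrite !mul0r subrr normr0.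
  have nh : 0 <= n%:R * h by rewrite mulr_ge0.
  have := process_law_expansion nh h0 HB; rewrite law0 mulr0 addr0 -/C.
  rewrite -[n.+1]addn1 natrD (mulrDl _ _ h) mul1r => -[].
  by move: IH; rewrite !ler_norml => /andP[]; lra.
apply/eqP; rewrite -subr_eq0 -normr_le0; apply/ler_addgt0Pr => e e0; rewrite add0r.
pose n := (Num.bound (C * t ^+ 2 / e)).+1.
have n0 : 0 < n%:R :> R by rewrite ltr0n.
have tn0 : 0 <= t / n%:R by rewrite divr_ge0.
have := step (t / n%:R) n tn0; rewrite mulrC divfK ?gt_eqF// => /le_trans; apply.
have -> : n%:R * (C * (t / n%:R) ^+ 2) = C * t ^+ 2 / n%:R.
  by field; rewrite gt_eqF.
rewrite ler_pdivrMr// [leRHS]mulrC -ler_pdivrMr//.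
have q0 : 0 <= C * t ^+ 2 / e by rewrite divr_ge0 ?(ltW e0)// mulr_ge0// sqr_ge0.
by apply: le_trans (ltW (archi_boundP q0)) _; rewrite ler_nat.
Qed.

Section spectral_bound.
Variable nu : probability S R.
Variables (W : S -> R) (Wmax lam H0 : R).
Hypothesis W_ge0 : forall x, 0 <= W x.
Hypothesis W_le : forall x, W x <= Wmax.
Hypothesis lam_ge0 : 0 <= lam.
Hypothesis entropy : (rel_entropy mu nu <= H0%:E)%E.
Hypothesis spectral : forall u : S -> R, bounded_function u ->
  \int[nu]_x (u x * L u x + W x * u x ^+ 2) <= lam * \int[nu]_x (u x ^+ 2).

(** Explicit Euler step for the equation du/dt = (L + W) u, which [fk_iter] starts from u = 1. *)
Definition fk_step (h : R) (u : S -> R) (x : S) : R := u x + h * (L u x + W x * u x).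

Definition fk_iter (h : R) (n : nat) : S -> R := iter n (fk_step h) (cst 1).

Lemma Wmax_ge0 : 0 <= Wmax. Proof. exact: le_trans (W_ge0 point) (W_le point). Qed.

(** For h Lam <= 1 the step of L is monotone, and W >= 0; so the iterates stay above 1 and their
    logarithms are nonnegative. *)
Lemma fk_iter_ge1 h n x : 0 <= h -> h * Lam <= 1 -> 1 <= fk_iter h n x.
Proof.
move=> h0 hL; elim: n x => [|n IH] x //=; rewrite -/(fk_iter h n) /fk_step.
set u := fk_iter h n in IH *.
have : - (\sum_i r i x) * (u x - 1) <= L u x.
  rewrite /jump_generator mulNr mulr_suml -sumrN; apply: ler_sum => i _.
  by rewrite -mulrN ler_wpM2l// opprB lerB// IH.
have : \sum_i r i x * (u x - 1) <= Lam * (u x - 1).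
  by rewrite -mulr_suml ler_wpM2r ?r_sum// subr_ge0 IH.
rewrite -mulr_suml => h1 h2.
have h3 : h * (- (Lam * (u x - 1))) <= h * (L u x) by rewrite ler_wpM2l//; lra.
have h4 : h * Lam * (u x - 1) <= 1 * (u x - 1).
  by rewrite ler_wpM2r// subr_ge0 IH.
have h5 : 0 <= h * (W x * u x) by rewrite !mulr_ge0// (le_trans ler01).
by move: (IH x); lra.
Qed.

Lemma fk_iter_le h n x : 0 <= h -> h * Lam <= 1 ->
  fk_iter h n x <= expR (n%:R * h * Wmax).
Proof.
move=> h0 hL; elim: n x => [|n IH] x; first by rewrite !mul0r expR0.
rewrite /fk_iter iterS -/(fk_iter h n) /fk_step.
have u1 y := fk_iter_ge1 n y h0 hL.
set u := fk_iter h n in IH u1 *; set B := expR _ in IH.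
have h1 : L u x <= Lam * (B - u x).
  apply: (@le_trans _ _ (\sum_i r i x * (B - u x))).
    by apply: ler_sum => i _; rewrite ler_wpM2l// lerB.
  by rewrite -mulr_suml ler_wpM2r ?r_sum// subr_ge0.
have h2 : h * (L u x) <= h * Lam * (B - u x) by rewrite -mulrA ler_wpM2l.
have h3 : h * Lam * (B - u x) <= 1 * (B - u x) by rewrite ler_wpM2r// subr_ge0.
have u0 : 0 <= u x by exact: le_trans ler01 (u1 x).
have h4 : h * (W x * u x) <= h * (Wmax * B).
  by rewrite ler_wpM2l// ler_pM.
apply: (@le_trans _ _ (B * (1 + h * Wmax))); first lra.
rewrite -[n.+1]addn1 natrD !mulrDl mul1r expRD ler_wpM2l ?expR_ge0//.
exact: expR_ge1Dx.
Qed.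

Lemma ln_ge1D (x : R) : `|x| <= 2^-1 -> x - 2 * x ^+ 2 <= ln (1 + x).
Proof.
rewrite ler_norml => /andP[x1 x2]; have p : 0 < 1 + x by lra.
have h : 1 - (1 + x)^-1 <= ln (1 + x).
  have := expR_ge1Dx (ln (1 + x)^-1); rewrite lnK ?posrE ?invr_gt0//.
  by rewrite lnV ?posrE//; lra.
apply: le_trans h.
have -> : 1 - (1 + x)^-1 = x / (1 + x) by field; rewrite gt_eqF.
rewrite ler_pdivlMr//; have : 0 <= x ^+ 2 * (1 + 2 * x) by rewrite mulr_ge0 ?sqr_ge0//; lra.
by rewrite !expr2; lra.
Qed.

Variable T : R.
Hypothesis T_ge0 : 0 <= T.

(** [U] bounds the iterates up to time T, [B1] bounds (L + W) u, and [B2] h^2 is the error of one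
    step: the quadratic term of the logarithm, and the second order term of [process_law_expansion]
    for ln u <= T Wmax. *)
Let U := expR (T * Wmax).
Let B1 := (2 * Lam + Wmax) * U.
Let B2 := 2 * B1 ^+ 2 + 2 * (T * Wmax) * Lam ^+ 2.

(** From ln y <= y - 1 one has L (ln u) <= (L u) / u, so each step backwards in time trades h E W
    for the passage from ln u_m to ln u_(m+1), and the sum telescopes to the initial mean of ln u_n.
    The entropy inequality for 2 ln u_n bounds this mean by half of H0 plus the logarithm of the
    squared L^2(nu) norm of u_n, whose growth rate is 2 lam by [spectral]. *)
Lemma feynman_kac_discrete h n : 0 < h -> h * Lam <= 1 -> h * B1 <= 2^-1 ->
  n%:R * h <= T ->
  \sum_(k < n) h * law (k%:R * h) W <=
  H0 / 2 + lam * (n%:R * h) + (n%:R * h) * h * (B1 ^+ 2 + B2).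
Proof.
move=> h0 hL hB nT; have Wmax0 := Wmax_ge0; have Lam0 := Lam_ge0 r_ge0 r_sum.
pose u := fk_iter h.
have u1 m x : 1 <= u m x := fk_iter_ge1 m x (ltW h0) hL.
have u0 m x : 0 < u m x by exact: lt_le_trans (u1 m x).
have uU m x : (m <= n)%N -> u m x <= U.
  move=> mn; apply: le_trans (fk_iter_le m x (ltW h0) hL) _.
  rewrite ler_expR ler_wpM2r// (le_trans _ nT)// ler_pM2r// ler_nat//.
have uS m x : u m.+1 x = u m x + h * (L (u m) x + W x * u m x) by [].
have u_bd m : bounded_function (u m).
  exists (expR (m%:R * h * Wmax)) => x; rewrite gtr0_norm//.
  exact: (fk_iter_le m x (ltW h0) hL).
have genB m x : (m <= n)%N -> `|L (u m) x + W x * u m x| <= B1.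
  move=> mn; have uB y : `|u m y| <= U by rewrite gtr0_norm// uU.
  apply: le_trans (ler_normD _ _) _; rewrite /B1 mulrDl lerD//.
    exact: jump_generator_bound.
  by rewrite normrM ler_pM// ger0_norm.
have ln_bd m x : (m <= n)%N -> `|ln (u m x)| <= T * Wmax.
  move=> mn; rewrite ger0_norm ?ln_ge0//.
  by rewrite -(expRK (T * Wmax)) ler_ln ?posrE ?expR_gt0// uU.
have b_ln m : (m <= n)%N -> bounded_function (fun x => ln (u m x)).
  by move=> mn; exists (T * Wmax) => x; exact: ln_bd.
have bW : bounded_function W by exists Wmax => x; rewrite ger0_norm.
have pt m x : (m < n)%N -> ln (u m x) + h * L (fun y => ln (u m y)) x + h * W x <=
    ln (u m.+1 x) + 2 * B1 ^+ 2 * h ^+ 2.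
  move=> mn; have mn' := ltnW mn.
  have h1 : L (fun y => ln (u m y)) x <= L (u m) x / u m x.
    rewrite /jump_generator mulr_suml; apply: ler_sum => i _; rewrite -mulrA ler_wpM2l//.
    rewrite -ln_div ?posrE// mulrBl mulfV ?gt_eqF//.
    rewrite lerBrDl -[leRHS]lnK ?posrE ?divr_gt0//; exact: expR_ge1Dx.
  pose y := h * ((L (u m) x + W x * u m x) / u m x).
  have yB : `|y| <= h * B1.
    rewrite /y normrM gtr0_norm// ler_pM2l// normrM normfV [`|u m x|]gtr0_norm//.
    by rewrite ler_pdivrMr// (le_trans (genB m x mn'))// ler_peMr// (le_trans _ (genB m x mn')).
  have E : ln (u m.+1 x) = ln (u m x) + ln (1 + y).
    rewrite -lnM ?posrE//; last first.
      by have := le_trans yB hB; rewrite ler_norml => /andP[]; lra.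
    by rewrite uS /y; congr ln; field; rewrite gt_eqF.
  have h2 := ln_ge1D (le_trans yB hB).
  have h3 : y ^+ 2 <= B1 ^+ 2 * h ^+ 2.
    rewrite -exprMn [B1 * h]mulrC -real_normK ?num_real// ler_pXn2r// nnegrE//.
    exact: le_trans yB.
  have h4 : y = h * (L (u m) x / u m x) + h * W x.
    by rewrite /y; field; rewrite gt_eqF.
  have h5 : h * L (fun y => ln (u m y)) x <= h * (L (u m) x / u m x) by rewrite ler_pM2l.
  by rewrite E; lra.
(* The number of remaining steps decreases as time runs: ln u_m at time t + h is compared with ln
   u_(m+1) at time t. *)
have tele m t : (m <= n)%N -> 0 <= t ->
    \sum_(k < m) h * law (t + k%:R * h) W <= law t (fun x => ln (u m x)) + m%:R * (B2 * h ^+ 2).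
  elim: m t => [|m IH] t mn t0.
    rewrite big_ord0 mul0r addr0; apply: Rintegral_ge0 => w _; exact: ln_ge0.
  have th : 0 <= t + h by rewrite addr_ge0// ltW.
  have mn' := ltnW mn.
  have {IH} := IH (t + h) mn' th.
  have -> : \sum_(k < m) h * law (t + h + k%:R * h) W =
     \sum_(k < m) h * law (t + (lift ord0 k)%:R * h) W.
    apply: eq_bigr => k _; have Ek : t + h + k%:R * h = t + (lift ord0 k)%:R * h.
      by rewrite lift0 -natr1; ring.
    by rewrite Ek.
  rewrite big_ord_recl mul0r addr0 => IH.
  have [h1 _] := process_law_expansion t0 (ltW h0) (fun x => ln_bd m x mn').
  have bL : bounded_function (L (fun x => ln (u m x))).
    exists (2 * Lam * (T * Wmax)) => x; apply: jump_generator_bound => // y; exact: ln_bd.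
  have P1 : Pr setT = 1%E := probability_setT Pr.
  have b1 := process_bounded_mfun t0 (b_ln m mn').
  have b2 := process_bounded_mfun t0 bL; have b3 := process_bounded_mfun t0 bW.
  have b4 := process_bounded_mfun t0 (b_ln m.+1 mn).
  have h2 : law t (fun x => ln (u m x)) + h * law t (L (fun x => ln (u m x))) + h * law t W
     <= law t (fun x => ln (u m.+1 x)) + 2 * B1 ^+ 2 * h ^+ 2.
    rewrite -(meanZ P1 h b2) -(meanZ P1 h b3) -(meanD P1)//; last exact: bounded_mfunZ.
    rewrite -(meanD P1)//; [|by apply: bounded_mfunD => //; exact: bounded_mfunZ|
      exact: bounded_mfunZ].
    rewrite -[X in _ <= _ + X](mean_cst P1) -(meanD P1)//; last exact: bounded_mfun_cst.
    apply: (mean_le P1).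
    - by do 2 (apply: bounded_mfunD => //; last exact: bounded_mfunZ).
    - by apply: bounded_mfunD => //; exact: bounded_mfun_cst.
    by move=> w; exact: pt.
  move: IH; set x1 := \sum_(i < m) _ => IH.
  have -> : m.+1%:R * (B2 * h ^+ 2) = m%:R * (B2 * h ^+ 2) + B2 * h ^+ 2.
    by rewrite -natr1; ring.
  by move: IH h1 h2; rewrite /B2; lra.
have n1 : nu setT = 1%E := probability_setT nu.
have mu1 : mu setT = 1%E := probability_setT mu.
have bC m : bounded_mfun (u m) by exact: bounded_mfun_config.
have bC2 m : bounded_mfun (fun x => u m x ^+ 2).
  by have := bounded_mfunM (bC m) (bC m).
have L2 m : (m <= n)%N -> 1 <= \int[nu]_x (u m x ^+ 2) <=
    expR (m%:R * (2 * h * lam + h ^+ 2 * B1 ^+ 2)).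
  move=> mn; apply/andP; split.
    rewrite -[leLHS](mean_cst n1); apply: (mean_le n1) => //; first exact: bounded_mfun_cst.
    by move=> x; rewrite expr_ge1// ltW.
  elim: m mn => [|m IH] mn.
    rewrite mul0r expR0 -[leRHS](mean_cst n1); apply: (mean_le n1) => //.
      exact: bounded_mfun_cst.
    by move=> x; rewrite /u /= expr1n.
  have mn' := ltnW mn; have {IH} := IH mn'.
  set q := 2 * h * lam + _ => IH.
  have q0 : 0 <= q.
    apply: addr_ge0; last by apply: mulr_ge0; exact: sqr_ge0.
    by apply: mulr_ge0 => //; apply: mulr_ge0 => //; exact: ltW.
  have bLu : bounded_mfun (fun x => u m x * L (u m) x + W x * u m x ^+ 2).
    have bL : bounded_mfun (L (u m)).
      apply: bounded_mfun_config; exists (2 * Lam * U) => x.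
      by apply: jump_generator_bound => // y; rewrite gtr0_norm// uU.
    exact: bounded_mfunD (bounded_mfunM (bC m) bL)
      (bounded_mfunM (bounded_mfun_config bW) (bC2 m)).
  have h1 : \int[nu]_x (u m.+1 x ^+ 2) <= \int[nu]_x (u m x ^+ 2 +
     2 * h * (u m x * L (u m) x + W x * u m x ^+ 2) + h ^+ 2 * B1 ^+ 2).
    apply: (mean_le n1) => //.
      apply: bounded_mfunD; last exact: bounded_mfun_cst.
      by apply: bounded_mfunD => //; exact: bounded_mfunZ.
    move=> x; rewrite uS.
    have := genB m x mn'; set y := L (u m) x + W x * u m x => yB.
    have : y ^+ 2 <= B1 ^+ 2.
      rewrite -real_normK ?num_real// ler_pXn2r// nnegrE//; exact: le_trans yB.
    move=> /(ler_wpM2l (sqr_ge0 h)) yB2.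
    have -> : (u m x + h * y) ^+ 2 = u m x ^+ 2 +
      2 * h * (u m x * L (u m) x + W x * u m x ^+ 2) + h ^+ 2 * y ^+ 2 by rewrite /y; ring.
    by rewrite lerD2l.
  apply: le_trans h1 _.
  rewrite (meanD n1); [|by apply: bounded_mfunD => //; exact: bounded_mfunZ|
     exact: bounded_mfun_cst].
  rewrite (meanD n1)//; last exact: bounded_mfunZ.
  rewrite (meanZ n1)// (mean_cst n1).
  have := spectral (u_bd m); set E := \int[nu]_x (u m x ^+ 2) in IH *.
  set F := \int[nu]_x _ => FE.
  have hF : 2 * h * F <= 2 * h * (lam * E) by rewrite ler_pM2l// mulr_gt0.
  have E1 : 1 <= E.
    rewrite -[leLHS](mean_cst n1); apply: (mean_le n1) => //; first exact: bounded_mfun_cst.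
    by move=> x; rewrite expr_ge1// ltW.
  have hB2 : h ^+ 2 * B1 ^+ 2 <= h ^+ 2 * B1 ^+ 2 * E.
    by rewrite ler_peMr// mulr_ge0 ?sqr_ge0.
  apply: (@le_trans _ _ (E * (1 + q))); first by rewrite /q; lra.
  have -> : m.+1%:R * q = m%:R * q + q by rewrite -natr1; ring.
  rewrite expRD; apply: ler_pM => //.
  - exact: le_trans E1.
  - exact: addr_ge0.
  - exact: expR_ge1Dx.
have := tele n 0 (leqnn n) (lexx 0).
under eq_bigr do rewrite add0r.
move=> h1; apply: le_trans h1 _; rewrite (process_law0 (b_ln n (leqnn n))).
(* The factor 2 makes the exponential equal to u^2, which the quadratic form controls; it also
   halves the entropy. *)
have := entropy_inequality (@pickle_config_inj I) (@config_measurable I)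
  (F := fun x => 2 * ln (u n x)) _ entropy.
rewrite (meanZ mu1); last by apply: bounded_mfun_config; exact: b_ln.
have -> : \int[nu]_x expR (2 * ln (u n x)) = \int[nu]_x (u n x ^+ 2).
  by apply: eq_Rintegral => x _; rewrite expRM_natl lnK ?posrE.
move=> h2; have {}h2 := h2 _.
have /andP[l1 l2] := L2 n (leqnn n).
have l3 : ln (\int[nu]_x (u n x ^+ 2)) <= n%:R * (2 * h * lam + h ^+ 2 * B1 ^+ 2).
  by rewrite -[leRHS]expRK ler_ln ?posrE ?expR_gt0// (lt_le_trans ltr01).
have h3 : 2 * \int[mu]_x ln (u n x) <= H0 + ln (\int[nu]_x (u n x ^+ 2)).
  apply: h2; exists (2 * (T * Wmax)) => x.
  by rewrite normrM ger0_norm// ler_pM2l// ln_bd.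
have nn : 0 <= n%:R * (h ^+ 2 * B1 ^+ 2).
  by apply: mulr_ge0 => //; apply: mulr_ge0; exact: sqr_ge0.
by move: h3 l3 nn; rewrite !expr2; lra.
Qed.

End spectral_bound.
End feynman_kac.

(** * The torus and the Dirichlet form *)

Section torus_geometry.
Context {d : nat}.

Definition translate {N : nat} (x : torus d N.+1) (z : 'rV[int]_d) : torus d N.+1 :=
  \row_i inord `|((Posz (x ord0 i) + z ord0 i)%R %% N.+1)%Z|%N.

Lemma translateE N (x : torus d N.+1) (z : 'rV[int]_d) i :
  Posz (translate x z ord0 i) = ((Posz (x ord0 i) + z ord0 i) %% N.+1)%Z.
Proof.
have h0 : (0 <= (Posz (x ord0 i) + z ord0 i) %% N.+1)%Z by rewrite modz_ge0.
rewrite mxE inordK ?gez0_abs// -ltz_nat gez0_abs// ltz_pmod//.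
Qed.

Lemma ord_modz N (a : 'I_N.+1) : ((a : nat)%:Z %% N.+1)%Z = a.
Proof. by rewrite modz_nat modn_small. Qed.

Lemma translateP N (x y : torus d N.+1) (z : 'rV[int]_d) :
  (forall i, (Posz (x ord0 i) + z ord0 i = Posz (y ord0 i) %[mod N.+1])%Z) <->
  translate x z = y.
Proof.
split => [h|<- i]; last by rewrite translateE modz_mod.
apply/rowP => i; apply/val_inj/eqP; rewrite -eqz_nat; apply/eqP.
by rewrite /= translateE h ord_modz.
Qed.

Lemma translateD N (x : torus d N.+1) (z z' : 'rV[int]_d) : translate (translate x z) z' = translate x (z + z').
Proof.
apply/translateP => i; rewrite !translateE !modz_mod modzDml mxE addrA//.
Qed.

Lemma translate0 N (x : torus d N.+1) : translate x 0 = x.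
Proof. by apply/translateP => i; rewrite mxE addr0. Qed.

Lemma translateK N (z : 'rV[int]_d) :
  cancel (fun x : torus d N.+1 => translate x z) (fun x => translate x (- z)).
Proof. by move=> x; rewrite translateD subrr translate0. Qed.

Lemma translate_inj N (z : 'rV[int]_d) : injective (fun x : torus d N.+1 => translate x z).
Proof. exact: can_inj (translateK z). Qed.

Lemma sum_translate (R : realType) N (z : 'rV[int]_d) (F : torus d N.+1 -> R) :
  \sum_x F (translate x z) = \sum_x F x.
Proof. by rewrite [RHS](reindex_inj (@translate_inj N z)). Qed.

Context {R : realType}.
Variable p : step_distribution R d.

Lemma finite_support_step : finite_set [set z | p z != 0].
Proof.
have [M HM] := step_bounded p.
have : finite_set [set (\row_i (Posz (f i) - Posz M) : 'rV[int]_d) |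
    f in [set: {ffun 'I_d -> 'I_(2 * M).+1}]].
  by apply: finite_image; exact: finite_finset.
apply: sub_finite_set => z /= pz.
exists [ffun i => inord `|(z ord0 i + Posz M)%R|%N] => //.
apply/rowP => i; rewrite mxE ffunE; have := HM _ pz i.
rewrite (_ : z 0 i = z ord0 i)//; move: (z ord0 i) => a h.
have h1 : (0 <= a + Posz M)%R by lia.
by rewrite inordK ?gez0_abs//; lia.
Qed.

Definition step_support : seq 'rV[int]_d :=
  finmap.enum_fset (fset_set [set z | p z != 0]).

Lemma mem_step_support z : (z \in step_support) = (p z != 0).
Proof.
have := in_fset_set finite_support_step z; rewrite /step_support => ->.
by apply/idP/idP; rewrite ?in_setE// => ?; apply/mem_set.
Qed.

Lemma torus_stepE N (x y : torus d N.+1) :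
  torus_step p x y = \sum_(z <- step_support | translate x z == y) p z.
Proof.
rewrite /torus_step (_ : [set z | _] = [set z | translate x z = y]); last first.
  by apply/seteqP; split => z /translateP.
rewrite fsbig_mkcond/= (fsbigE step_support) ?finmap.fset_uniq//; last first.
  move=> z _; rewrite mem_step_support negbK => /eqP pz.
  by rewrite /patch; case: ifP.
rewrite [LHS]big_mkcond [RHS]big_mkcond; apply: eq_bigr => z _.
rewrite in_setT /patch/=; case: (boolP (_ \in _)); rewrite ?inE ?notin_setE/=.
  by move=> ->; rewrite eqxx.
by case: eqP.
Qed.

Lemma step_support_sum : \sum_(z <- step_support) p z = 1.
Proof.
rewrite -(step_sum1 p) (fsbigE step_support) ?finmap.fset_uniq//; last first.
  by move=> z _; rewrite mem_step_support negbK => /eqP.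
by apply: eq_bigl => z; rewrite in_setT.
Qed.

Lemma torus_step_ge0 N (x y : torus d N.+1) : 0 <= torus_step p x y.
Proof. by rewrite torus_stepE sumr_ge0// => z _; exact: step_ge0. Qed.

Lemma torus_step_sum N (x : torus d N.+1) : \sum_y torus_step p x y = 1.
Proof.
rewrite -step_support_sum; under eq_bigr do rewrite torus_stepE.
rewrite (exchange_big_dep predT)//=; apply: eq_bigr => z _.
by rewrite (big_pred1 (translate x z))// => y; rewrite eq_sym.
Qed.

Lemma torus_step_suml N (y : torus d N.+1) : \sum_x torus_step p x y = 1.
Proof.
rewrite -step_support_sum; under eq_bigr do rewrite torus_stepE.
rewrite (exchange_big_dep predT)//=; apply: eq_bigr => z _.
rewrite (big_pred1 (translate y (- z)))// => x.
by apply/eqP/eqP => [<-|->]; rewrite translateD ?subrr ?addNr translate0.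
Qed.

Lemma le_torus_step N (x : torus d N.+1) v : p v != 0 -> p v <= torus_step p x (translate x v).
Proof.
move=> pv; rewrite torus_stepE -big_filter.
have vin : v \in [seq z <- step_support | translate x z == translate x v].
  by rewrite mem_filter eqxx mem_step_support.
rewrite (big_rem v)//= lerDl sumr_ge0// => z _; exact: step_ge0.
Qed.

(* The squared-difference functionals satisfy D x z <= 2 D x y + 2 D y z, so that a path
   of steps of p from 0 to z bounds the translation by z. *)
Lemma translate_bound (z : 'rV[int]_d) : exists2 C : R, 0 <= C &
  forall N (D : torus d N.+1 -> torus d N.+1 -> R),
    (forall x y, 0 <= D x y) -> (forall x, D x x = 0) ->
    (forall x y w, D x w <= 2 * D x y + 2 * D y w) ->
    \sum_x D x (translate x z) <= C * \sum_x \sum_y torus_step p x y * D x y.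
Proof.
have [s [sp ->]] := step_generate p z.
elim: s sp => [|v s IH] sp.
  exists 0 => // N D D0 Dx Dt; rewrite mul0r big_nil big1// => x _.
  by rewrite translate0 Dx.
have [|C C0 HC] := IH; first by move=> u us; apply: sp; rewrite in_cons us orbT.
have pv : p v != 0 by apply: sp; rewrite mem_head.
have pv0 : 0 < p v by rewrite lt_neqAle eq_sym pv step_ge0.
exists (2 / p v + 2 * C) => [|N D D0 Dx Dt].
  by rewrite addr_ge0// mulr_ge0// invr_ge0 ltW.
rewrite big_cons.
apply: (@le_trans _ _ (\sum_x (2 * D x (translate x v) +
    2 * D (translate x v) (translate (translate x v) (\sum_(u <- s) u))))).
  by apply: ler_sum => x _; rewrite -translateD Dt.
rewrite big_split/= -!mulr_sumr (sum_translate v (fun x => D x (translate x _))).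
have := HC N D D0 Dx Dt; set E := \sum_x \sum_y _ => h1.
have h2 : p v * \sum_x D x (translate x v) <= E.
  rewrite mulr_sumr; apply: ler_sum => x _; rewrite (bigD1 (translate x v))//=.
  apply: (@le_trans _ _ (torus_step p x (translate x v) * D x (translate x v))).
    by rewrite ler_wpM2r// le_torus_step.
  by rewrite lerDl sumr_ge0// => y _; rewrite mulr_ge0// torus_step_ge0.
rewrite [leRHS]mulrDl; apply: lerD; last by rewrite -mulrA ler_pM2l.
by rewrite -mulrA ler_pM2l// mulrC ler_pdivlMr// mulrC.
Qed.

End torus_geometry.

(** * Blocks on the torus *)

Section boxes.
Context {d : nat}.

(** The index type does not depend on N or on the centre, so constants obtained on a block are
    shared by all tori and positions. *)
Definition box (l : nat) : finType := {ffun 'I_d -> 'I_(2 * l).+1}.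

Definition box_vector (l : nat) (j : box l) : 'rV[int]_d :=
  \row_i (Posz (j i) - Posz l).

Definition box_at {N : nat} (l : nat) (x : torus d N.+1) (j : box l) : torus d N.+1 :=
  translate x (box_vector j).

Lemma card_box l : #|box l| = ((2 * l + 1) ^ d)%N.
Proof. by rewrite card_ffun !card_ord addn1. Qed.

Lemma box_at_inj N l (x : torus d N.+1) : (2 * l < N.+1)%N -> injective (box_at (l := l) x).
Proof.
move=> lN j j' h; apply/ffunP => i; apply: val_inj => /=.
have := congr1 (fun y : torus d N.+1 => Posz (y ord0 i)) h.
rewrite !translateE !mxE => /eqP; rewrite eqz_modDl.
rewrite -(eqz_modDr (Posz l)) !subrK => /eqP.
have jl (k : box l) : (k i < N.+1)%N by exact: leq_trans (ltn_ord _) lN.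
by rewrite !modz_nat !modn_small// => -[].
Qed.

Lemma circle_distP N l (a b : 'I_N.+1) : (2 * l < N.+1)%N ->
  (circle_dist a b <= l)%N <->
  exists2 k : nat, (k <= 2 * l)%N & ((a%:Z + (k%:Z - l%:Z)) = b%:Z %[mod N.+1])%Z.
Proof.
move=> lN; rewrite /circle_dist geq_min; have := ltn_ord a; have := ltn_ord b.
move: (a : nat) (b : nat) => {}a {}b bN aN.
split.
  have [ab|ab] := leqP a b.
    move=> /orP[h|h].
      by exists (b + l - a)%N; [lia|congr modz; lia].
    exists (b + l - a - N.+1)%N; first by lia.
    by rewrite -[RHS](modzMDl (-1)); congr modz; lia.
  move=> /orP[h|h].
    by exists (b + l - a)%N; [lia|congr modz; lia].
  exists (b + l + N.+1 - a)%N; first by lia.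
  by rewrite -[RHS](modzMDl 1); congr modz; lia.
move=> [k kl] /eqP; rewrite eqz_mod_dvd => /dvdzP[q hq].
(* Two coordinates differ by at most N and the displacement is at most l, so it wraps around at most
   once in either direction. *)
have : (q = 0 \/ q = 1 \/ q = -1)%R.
  have : (q < 2)%R by nia.
  have : (-2 < q)%R by nia.
  by lia.
by case=> [q0|[q1|q1]]; subst q; lia.
Qed.

Lemma block_averageE (R : realType) N l (eta : config (torus d N.+1)) x :
  (2 * l < N.+1)%N ->
  block_average l eta x =
  (particles (restrict_config (box_at (l := l) x) eta))%:R / #|box l|%:R :> R.
Proof.
move=> lN; rewrite /block_average card_box; congr (_%:R / _); rewrite /particles.
under [RHS]eq_bigr do rewrite ffunE.
rewrite -(big_imset (fun y => eta y) (h := box_at x) (A := mem (predT : {pred box l})))/=; last first.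
  by move=> j j' _ _; exact: box_at_inj.
apply: eq_bigl => y; apply/forallP/imsetP => [h|[j _ ->] i]; last first.
  apply/(circle_distP _ _ lN); exists (j i); first by rewrite -ltnS.
  by rewrite translateE modz_mod mxE.
have {}h i : exists k : 'I_(2 * l).+1,
    (Posz (x ord0 i) + (k%:Z - l%:Z) = Posz (y ord0 i) %[mod N.+1])%Z.
  have [k kl hk] := (circle_distP (x ord0 i) (y ord0 i) lN).1 (h i).
  by exists (inord k); rewrite inordK.
have [k hk] := choice h.
exists [ffun i => k i] => //.
by apply/esym/translateP => i; rewrite mxE ffunE.
Qed.

End boxes.

(** * The generator of the zero range process and its Dirichlet form *)

Section zrp_generator.
Context {R : realType} {d : nat}.
Variables (g : jump_rate R) (p : step_distribution R d) (G : R) (N : nat).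
Hypothesis gG : forall k, g k <= G.
Local Notation I := (torus d N.+1).

Definition zrp_rate (xy : I * I) (eta : config I) : R :=
  (N.+1 ^ 2)%:R * (g (eta xy.1) * torus_step p xy.1 xy.2).

Definition zrp_move (xy : I * I) (eta : config I) : config I := move eta xy.1 xy.2.

Lemma zrp_generatorE :
  (fun f eta => (N.+1 ^ 2)%:R * zrp_generator g p f eta) =
  jump_generator zrp_rate zrp_move.
Proof.
apply/funext => f; apply/funext => eta; rewrite /zrp_generator /jump_generator.
rewrite mulr_sumr; under eq_bigr do rewrite mulr_sumr.
rewrite pair_big/=; apply: eq_bigr => -[x y] _ /=.
by rewrite /zrp_rate /zrp_move/=; ring.
Qed.

Lemma zrp_rate_ge0 xy eta : 0 <= zrp_rate xy eta.
Proof. by rewrite !mulr_ge0 ?rate_ge0// torus_step_ge0. Qed.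

Lemma zrp_rate_sum eta : \sum_xy zrp_rate xy eta <= (N.+1 ^ 2)%:R * (#|I|%:R * G).
Proof.
rewrite -mulr_sumr ler_wpM2l//.
rewrite -(pair_big predT predT (fun x y => g (eta x) * torus_step p x y))/=.
under eq_bigr do rewrite -mulr_sumr torus_step_sum mulr1.
apply: (@le_trans _ _ (\sum_(x : I) G)); first exact: ler_sum.
by rewrite sumr_const mulr_natl.
Qed.

Lemma zrp_generator_particles (f : nat -> R) eta :
  jump_generator zrp_rate zrp_move (fun eta => f (particles eta)) eta = 0.
Proof.
rewrite /jump_generator big1// => -[x y] _; rewrite /zrp_rate /zrp_move/=.
(* From an empty site [move] could create a particle; the rate g(0) = 0 removes this case. *)
have [e0|ex] := posnP (eta x); first by rewrite e0 (rate_eq0 g 0).2// mul0r mulr0 mul0r.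
pose xi : config I := [ffun z => (eta z - (z == x))%N].
have -> : eta = add_particle xi x.
  apply/ffunP => z; rewrite !ffunE.
  by case: eqP => [->|_]; rewrite ?subnK// subn0 addn0.
by rewrite move_add_particle !particles_add_particle subrr mulr0.
Qed.

Variable phi : R.
Hypothesis phi_gt0 : 0 < phi.
Hypothesis phiD : partition_domain g phi.
Local Notation m := (iid_measure (site_measure g phi)).

Lemma mean_shift_bounded (x : I) (F : config I -> R) : bounded_function F ->
  \int[m]_eta (g (eta x) * F eta) = phi * \int[m]_eta F (add_particle eta x).
Proof.
move=> bF; have [B HB] := bF; have m1 : m [set: config I] = 1%E := probability_setT _.
have bg : bounded_mfun (fun eta : config I => g (eta x)).
  apply: bounded_mfun_config; exists G => eta.
  by rewrite ger0_norm ?rate_ge0.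
have bF' : bounded_mfun F by exact: bounded_mfun_config.
have bc : bounded_mfun (cst B : config I -> R) := bounded_mfun_cst B.
have bFs : bounded_mfun (fun eta => F (add_particle eta x)).
  by apply: bounded_mfun_config; exists B.
have B0 : 0 <= B by exact: le_trans (HB point).
have h1 := mean_shift phi_gt0 phiD (I := I) x (F := fun eta => F eta + B).
have h2 := mean_shift phi_gt0 phiD (I := I) x (F := fun=> B) (fun=> B0).
rewrite (meanZ m1)// in h2; rewrite (meanZ m1) in h1; last exact: bounded_mfunD.
move: h1; under eq_Rintegral do rewrite mulrDr.
rewrite (meanD m1 (bounded_mfunM bg bF') (bounded_mfunM bg bc)) (meanD m1 bFs bc) h2 mulrDr => h1; apply: (addIr (phi * \int[m]_x B)).
by apply: h1 => eta; have := HB eta; rewrite ler_norml => /andP[]; lra.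
Qed.

Definition torus_dirichlet (u : config I -> R) : R :=
  \sum_x \sum_y torus_step p x y * pair_dirichlet g phi u x y.

Lemma pair_dirichlet_ge0 (u : config I -> R) x y : 0 <= pair_dirichlet g phi u x y.
Proof. by apply: Rintegral_ge0 => eta _; exact: sqr_ge0. Qed.

Lemma pair_dirichletxx (u : config I -> R) x : pair_dirichlet g phi u x x = 0.
Proof.
have m1 : m [set: config I] = 1%E := probability_setT _.
rewrite /pair_dirichlet -[RHS](mean_cst m1 0).
by apply: eq_Rintegral => eta _; rewrite subrr expr0n.
Qed.

Lemma pair_dirichlet_triangle (u : config I -> R) x y z : bounded_function u ->
  pair_dirichlet g phi u x z <=
  2 * pair_dirichlet g phi u x y + 2 * pair_dirichlet g phi u y z.
Proof.
move=> [B HB]; have m1 : m [set: config I] = 1%E := probability_setT _.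
have b a b : bounded_mfun (fun eta => (u (add_particle eta a) - u (add_particle eta b)) ^+ 2).
  have bu c : bounded_mfun (fun eta => u (add_particle eta c)).
    by apply: bounded_mfun_config; exists B.
  have h := bounded_mfunD (bu a) (bounded_mfunZ (-1) (bu b)).
  have := bounded_mfunM h h; congr bounded_mfun.
  by apply/funext => eta /=; rewrite mulN1r expr2.
have b2 c e := bounded_mfunZ 2 (b c e).
have := mean_le m1 (b x z) (bounded_mfunD (b2 x y) (b2 y z)).
rewrite (meanD m1 (b2 x y) (b2 y z)) (meanZ m1 2 (b x y)) (meanZ m1 2 (b y z)).
apply=> eta.
set a := u _; set c := u _; set e := u _.
by have := sqr_ge0 ((a - e) - (e - c)); rewrite !expr2; lra.
Qed.

(** Shifting by one particle replaces g(eta x) by phi and the pair u(eta), u(move eta x y) by a =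
    u(eta + x), b = u(eta + y). Then 2 a (b - a) = b^2 - a^2 - (a - b)^2, and the differences of
    squares cancel since the row and column sums of [torus_step] are 1. *)
Lemma mean_generator (u : config I -> R) : bounded_function u ->
  \int[m]_eta (u eta * jump_generator zrp_rate zrp_move u eta) =
  - ((N.+1 ^ 2)%:R * phi / 2) * torus_dirichlet u.
Proof.
move=> bu; have [B HB] := bu; have m1 : m [set: config I] = 1%E := probability_setT _.
have B0 : 0 <= B by exact: le_trans (HB point).
pose F xy eta := u eta * u (move eta xy.1 xy.2) - u eta ^+ 2 : R.
have bF xy : bounded_function (F xy).
  exists (B * B + B * B) => eta; apply: le_trans (ler_normB _ _) _.
  by rewrite lerD// normrM ler_pM.
pose a x := \int[m]_eta (u (add_particle eta x) ^+ 2).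
have bus c : bounded_mfun (fun eta => u (add_particle eta c)).
  by apply: bounded_mfun_config; exists B.
have bsq c : bounded_mfun (fun eta => u (add_particle eta c) ^+ 2).
  by have := bounded_mfunM (bus c) (bus c).
have bg x : bounded_mfun (fun eta : config I => g (eta x)).
  by apply: bounded_mfun_config; exists G => eta; rewrite ger0_norm ?rate_ge0.
have bgF xy : bounded_mfun (fun eta : config I => g (eta xy.1) * F xy eta).
  by apply: bounded_mfunM => //; exact: bounded_mfun_config.
have E1 xy : \int[m]_eta (g (eta xy.1) * F xy eta) =
    phi / 2 * (a xy.2 - a xy.1 - pair_dirichlet g phi u xy.1 xy.2).
  rewrite mean_shift_bounded//; case: xy => x y /=; rewrite -mulrA; congr (_ * _).
  rewrite /a /pair_dirichlet.
  have bd : bounded_mfun (fun eta => (u (add_particle eta x) - u (add_particle eta y)) ^+ 2).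
    have h := bounded_mfunD (bus x) (bounded_mfunZ (-1) (bus y)).
    have := bounded_mfunM h h; congr bounded_mfun.
    by apply/funext => eta /=; rewrite mulN1r expr2.
  rewrite -(meanB m1)// -(meanB m1)//; last first.
    have := bounded_mfunD (bsq y) (bounded_mfunZ (-1) (bsq x)); congr bounded_mfun.
    by apply/funext => eta /=; rewrite mulN1r.
  rewrite -(meanZ m1); last first.
    have := bounded_mfunD (bounded_mfunD (bsq y) (bounded_mfunZ (-1) (bsq x)))
       (bounded_mfunZ (-1) bd); congr bounded_mfun.
    by apply/funext => eta /=; rewrite !mulN1r.
  apply: eq_Rintegral => eta _; rewrite /F/= move_add_particle.
  by field.
transitivity (\int[m]_eta \sum_xy (N.+1 ^ 2)%:R * torus_step p xy.1 xy.2 *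
    (g (eta xy.1) * F xy eta)).
  apply: eq_Rintegral => eta _; rewrite /jump_generator mulr_sumr; apply: eq_bigr => xy _.
  by rewrite /F /zrp_rate /zrp_move; ring.
rewrite (mean_sum m1); last by move=> xy; exact: bounded_mfunZ.
under eq_bigr do rewrite (meanZ m1)// E1.
rewrite /torus_dirichlet; move: (pair_dirichlet g phi u) a {E1} => D a.
rewrite pair_big/= mulNr mulr_sumr -sumrN.
have Z : \sum_xy torus_step p xy.1 xy.2 * (a xy.2 - a xy.1) = 0.
  rewrite -(pair_big predT predT (fun x y => torus_step p x y * (a y - a x)))/=.
  under eq_bigr do under eq_bigr do rewrite mulrBr.
  under eq_bigr do rewrite sumrB.
  rewrite sumrB exchange_big/=.
  under eq_bigr do rewrite -mulr_suml torus_step_suml mul1r.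
  under [X in _ - X]eq_bigr do rewrite -mulr_suml torus_step_sum mul1r.
  by rewrite subrr.
apply/eqP; rewrite -subr_eq0 -sumrB; apply/eqP.
rewrite -[RHS](mulr0 ((N.+1 ^ 2)%:R * phi / 2)) -[X in _ = _ * X]Z [RHS]mulr_sumr.
by apply: eq_bigr => -[x y] _ /=; ring.
Qed.

End zrp_generator.

(** * Spectral bound for the sum of block potentials *)

Section one_block.
Context {R : realType} {d : nat}.
Variables (g : jump_rate R) (p : step_distribution R d) (G : R).
Hypothesis gG : forall k, g k <= G.
Variable phi : R.
Hypothesis phi_gt0 : 0 < phi.
Hypothesis phiD : partition_domain g phi.
Variables (l M : nat) (V : config (box (d := d) l) -> R) (e : R).
Hypothesis e_ge0 : 0 <= e.
Hypothesis V_ge0 : forall xi, 0 <= V xi.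
Hypothesis V_large : forall xi, (M < particles xi)%N -> V xi = 0.
Hypothesis V_bounded : bounded_function V.
Hypothesis V_mean : forall K, (K <= M)%N ->
  canonical_sum g M K V <= e * @canonical_sum R g (box (d := d) l) M K (fun=> 1).

Lemma spectral_estimate : exists2 C : R, 0 <= C &
  forall (N : nat) (gam : R) (u : config (torus d N.+1) -> R), (2 * l < N.+1)%N ->
  0 <= gam -> gam * C <= (N.+1 ^ 2)%:R -> bounded_function u ->
  \int[iid_measure (site_measure g phi)]_eta
     (u eta * jump_generator (zrp_rate g p (N := N)) (@zrp_move d N) u eta +
      (gam * \sum_x V (restrict_config (box_at x) eta)) * u eta ^+ 2) <=
  2 * e * gam * #|torus d N.+1|%:R *
    \int[iid_measure (site_measure g phi)]_eta (u eta ^+ 2).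
Proof.
have [C1 C10 HC1] := box_inequality phi_gt0 phiD e_ge0 V_ge0 V_large V_mean.
(* Going from site a to site b of a block is the translation by the difference of their vectors;
   summing over all x absorbs the shift of the base point. *)
have hC2 (ab : box l * box l) : exists C : R, 0 <= C /\
  forall N (D : torus d N.+1 -> torus d N.+1 -> R),
    (forall x y, 0 <= D x y) -> (forall x, D x x = 0) ->
    (forall x y w, D x w <= 2 * D x y + 2 * D y w) ->
    \sum_x D (box_at x ab.1) (box_at x ab.2) <=
    C * \sum_x \sum_y torus_step p x y * D x y.
  have [C C0 HC] := translate_bound p (box_vector ab.2 - box_vector ab.1).
  exists C; split=> // N D D0 Dx Dt; apply: le_trans (HC N D D0 Dx Dt).
  rewrite -(sum_translate (box_vector ab.1) (fun x => D x (translate x _))).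
  by under [leRHS]eq_bigr do rewrite translateD addrCA subrr addr0.
have [C2 HC2] := choice hC2.
pose C' := \sum_a \sum_b C2 (a, b).
have C'0 : 0 <= C' by apply: sumr_ge0 => a _; apply: sumr_ge0 => b _; have [] := HC2 (a, b).
(* The factor 2 / phi inverts the prefactor phi / 2 of the Dirichlet form in [mean_generator]. *)
exists (C1 * C' * 2 / phi); first by rewrite divr_ge0 ?(ltW phi_gt0)// mulr_ge0// mulr_ge0.
move=> N gam u lN gam0 gamN bu; have [B HB] := bu; have [BV HBV] := V_bounded.
set m := iid_measure _; have m1 : m setT = 1%E := probability_setT _.
have bu1 : bounded_mfun u by exact: bounded_mfun_config.
have bu2 : bounded_mfun (fun eta => u eta ^+ 2) by have := bounded_mfunM bu1 bu1.
have bL : bounded_mfun (jump_generator (zrp_rate g p (N := N)) (@zrp_move d N) u).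
  apply: bounded_mfun_config.
  exists (2 * ((N.+1 ^ 2)%:R * (#|torus d N.+1|%:R * G)) * B) => eta.
  by apply: jump_generator_bound => //; [exact: zrp_rate_ge0|exact: zrp_rate_sum].
have bV (x : torus d N.+1) : bounded_mfun (fun eta => V (restrict_config (box_at x) eta)).
  by apply: bounded_mfun_config; exists BV.
have bVu (x : torus d N.+1) :
  bounded_mfun (fun eta => V (restrict_config (box_at x) eta) * u eta ^+ 2).
  exact: bounded_mfunM.
have bS : bounded_mfun (fun eta => \sum_(x : torus d N.+1)
    V (restrict_config (box_at x) eta) * u eta ^+ 2).
  by apply: bounded_mfun_sum.
have E0 : \int[m]_eta (u eta * jump_generator (zrp_rate g p (N := N)) (@zrp_move d N) u eta +
      (gam * \sum_x V (restrict_config (box_at x) eta)) * u eta ^+ 2) =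
    \int[m]_eta (u eta * jump_generator (zrp_rate g p (N := N)) (@zrp_move d N) u eta +
      gam * \sum_x (V (restrict_config (box_at x) eta) * u eta ^+ 2)).
  by apply: eq_Rintegral => eta _; rewrite -mulrA mulr_suml.
rewrite {}E0 (meanD m1); [|exact: bounded_mfunM|exact: bounded_mfunZ].
rewrite (meanZ m1)// (mean_sum m1)//.
have MG : \int[m]_eta (u eta * jump_generator (zrp_rate g p (N := N)) (@zrp_move d N) u eta) =
    - ((N.+1 ^ 2)%:R * phi / 2 * torus_dirichlet g p phi u).
  by rewrite -mulNr; exact: mean_generator.
rewrite {}MG.
have D0 x y := pair_dirichlet_ge0 g phi u x y.
have Dx x := pair_dirichletxx g phi u x.
have Dt x y z := pair_dirichlet_triangle g phi x y z bu.
have S1 a b : \sum_(x : torus d N.+1) pair_dirichlet g phi u (box_at x a) (box_at x b) <=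
    C2 (a, b) * torus_dirichlet g p phi u.
  by have [_ /(_ N (pair_dirichlet g phi u) D0 Dx Dt)] := HC2 (a, b).
have D1 : 0 <= torus_dirichlet g p phi u.
  by apply: sumr_ge0 => x _; apply: sumr_ge0 => y _; rewrite mulr_ge0// torus_step_ge0.
have S2 : \sum_(x : torus d N.+1)
      \int[m]_eta (V (restrict_config (box_at x) eta) * u eta ^+ 2) <=
    #|torus d N.+1|%:R * (2 * e * \int[m]_eta (u eta ^+ 2)) +
    C1 * (C' * torus_dirichlet g p phi u).
  apply: (@le_trans _ _ (\sum_(x : torus d N.+1) (2 * e * \int[m]_eta (u eta ^+ 2) +
      C1 * \sum_a \sum_b pair_dirichlet g phi u (box_at x a) (box_at x b)))).
    by apply: ler_sum => x _; apply: HC1 => //; exact: box_at_inj.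
  rewrite big_split/= sumr_const -[X in X + _ <= _]mulr_natl lerD2l -mulr_sumr ler_wpM2l//.
  rewrite exchange_big/= mulr_suml; apply: ler_sum => a _.
  by rewrite exchange_big/= mulr_suml; apply: ler_sum => b _.
set D := torus_dirichlet _ _ _ _ in D1 S2 *; set Q := \int[m]_eta (u eta ^+ 2) in S2 *.
have S3 := ler_wpM2l gam0 S2.
have S4 : gam * (C1 * (C' * D)) <= (N.+1 ^ 2)%:R * phi / 2 * D.
  rewrite !mulrA ler_wpM2r//.
  rewrite -(ler_pM2r (x := 2 / phi)) ?divr_gt0//.
  have -> : (N.+1 ^ 2)%:R * phi / 2 * (2 / phi) = (N.+1 ^ 2)%:R.
    by field; rewrite gt_eqF.
  by apply: le_trans gamN; rewrite !mulrA.
apply: le_trans (lerD (lexx _) S3) _.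
have -> : gam * (#|torus d N.+1|%:R * (2 * e * Q) + C1 * (C' * D)) =
    2 * e * gam * #|torus d N.+1|%:R * Q + gam * (C1 * (C' * D)) by ring.
move: S4; generalize (gam * (C1 * (C' * D))) => x1.
generalize (2 * e * gam * #|torus d N.+1|%:R * Q) => x2.
generalize ((N.+1 ^ 2)%:R * phi / 2 * D) => x3.
by move=> h1; lra.
Qed.

End one_block.

(** * Time integrals along the paths *)

Section nonmeasurable_integrals.
Context {R : realType} {d : measure_display} {T : measurableType d}.
Variable m : {measure set T -> \bar R}.

(** The integral of a nonnegative function is a supremum over simple functions below it, and this is
    monotone for arbitrary functions, such as time integrals as functions of the path. *)
Lemma ge0_integral_mono (D : set T) (f f' : T -> \bar R) :
  (forall x, D x -> 0 <= f x)%E -> (forall x, D x -> f x <= f' x)%E ->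
  (\int[m]_(x in D) f x <= \int[m]_(x in D) f' x)%E.
Proof.
move=> f0 ff'; rewrite !ge0_integralE//; last first.
  by move=> x Dx; exact: le_trans (f0 x Dx) (ff' x Dx).
apply: le_ereal_sup => _ [h /= hf <-]; exists h => //= x.
apply: le_trans (hf x) _; rewrite /patch; case: ifPn => // xD.
by apply: ff'; rewrite -in_setE.
Qed.

Lemma Rintegral_norm_bound (D : set T) (f : T -> R) (q : T -> \bar R) :
  (forall x, D x -> `|f x|%:E <= q x)%E ->
  (`|\int[m]_(x in D) f x|%:E <= \int[m]_(x in D) q x)%E.
Proof.
move=> fq; have q0 x : D x -> (0 <= q x)%E by move=> /fq; apply: le_trans; rewrite lee_fin.
rewrite /Rintegral integralE; set a := integral _ _ (_ ^\+)%E; set b := integral _ _ _.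
set c := integral _ _ q.
have a0 : (0 <= a)%E by apply: integral_ge0 => x _; exact: funepos_ge0.
have b0 : (0 <= b)%E by apply: integral_ge0 => x _; exact: funeneg_ge0.
have ac : (a <= c)%E.
  apply: ge0_integral_mono => x Dx; first exact: funepos_ge0.
  by rewrite funeposE ge_max q0// andbT (le_trans _ (fq x Dx))// lee_fin ler_norm.
have bc : (b <= c)%E.
  apply: ge0_integral_mono => x Dx; first exact: funeneg_ge0.
  rewrite funenegE ge_max q0// andbT (le_trans _ (fq x Dx))//.
  by rewrite -EFinN lee_fin -normrN ler_norm.
move: a b c a0 b0 ac bc => [a||] [b||] [c||]//=;
  rewrite ?lee_fin ?leey//= => a0 b0 ac bc; rewrite ?normr0//.
by rewrite ler_norml; apply/andP; split; lra.
Qed.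

End nonmeasurable_integrals.

Section liminf.
Context {R : realType}.

Lemma limn_einf_ge (u : nat -> \bar R) (c : \bar R) :
  (\forall n \near \oo, c <= u n)%E -> (c <= limn_einf u)%E.
Proof.
move=> [N _ H]; rewrite limn_einf_lim; apply: lime_ge; first exact: is_cvg_einfs.
exists N => // n /= Nn; apply: le_ereal_inf_tmp => _ [k /= nk <-]; apply: H => /=.
exact: leq_trans nk.
Qed.

Lemma limn_einf_le (u : nat -> \bar R) (c : \bar R) :
  (\forall n \near \oo, u n <= c)%E -> (limn_einf u <= c)%E.
Proof.
move=> [N _ H]; rewrite limn_einf_lim; apply: lime_le; first exact: is_cvg_einfs.
exists N => // n /= Nn; apply: le_trans (H n Nn).
by apply: ereal_inf_lbound; exists n => /=.
Qed.

End liminf.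

Section time_integral.
Context {R : realType} {d : measure_display} {Omega : measurableType d}.
Context {I : finType}.
Variables (Pr : probability Omega R) (X : R -> Omega -> config I) (T : R).
Hypothesis T_gt0 : 0 < T.
Hypothesis X_measurable : forall t, 0 <= t -> measurable_fun [set: Omega] (X t).
Hypothesis X_right : forall w t, 0 <= t -> \forall s \near t^'+, X s w = X t w.
Variables (Psi : config I -> R) (B : R).
Hypothesis Psi_ge0 : forall x, 0 <= Psi x.
Hypothesis Psi_le : forall x, Psi x <= B.

Let h n : R := T / n.+1%:R.

Let h_gt0 n : 0 < h n. Proof. by rewrite divr_gt0. Qed.

(** Step function with values at right endpoints, which right-continuous paths approximate. The
    intervals are closed so that t = T is covered; their overlap only increases a nonnegative
    sum. *)
Let stp n w t : R :=
  \sum_(j < n.+1) \1_(`[j%:R * h n, j.+1%:R * h n]) t * Psi (X (j.+1%:R * h n) w).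

Let stp_ge0 n w t : 0 <= stp n w t.
Proof. by apply: sumr_ge0 => j _; rewrite mulr_ge0// indicE. Qed.

Let stp_ge n w t (j : 'I_n.+1) : j%:R * h n <= t <= j.+1%:R * h n ->
  Psi (X (j.+1%:R * h n) w) <= stp n w t.
Proof.
move=> tj; rewrite /stp (bigD1 j)//= indicE mem_set//= ?mul1r.
by rewrite lerDl sumr_ge0// => i _; rewrite mulr_ge0// indicE.
Qed.

Let stp_liminf w t : 0 <= t <= T ->
  ((Psi (X t w))%:E <= limn_einf (fun n => (stp n w t)%:E))%E.
Proof.
move=> /andP[t0]; rewrite le_eqVlt => /predU1P[->|tT].
  apply: limn_einf_ge; near=> n; rewrite lee_fin.
  have E : T = (ord_max : 'I_n.+1).+1%:R * h n by rewrite /= /h mulrC divfK.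
  rewrite {1}E; apply: stp_ge; apply/andP; split; last by rewrite -E.
  by rewrite [leRHS]E; apply: ler_wpM2r; [exact: ltW|rewrite ler_nat].
have [e /= e0 He] := X_right w t0.
apply: limn_einf_ge; near=> n; rewrite lee_fin.
have he : h n < e.
  rewrite /h ltr_pdivrMr// mulrC -ltr_pdivrMr//.
  by apply: (lt_le_trans _ (_ : n%:R <= _)); [near: n; exact: nbhs_infty_gtr|rewrite ler_nat].
have th0 : 0 <= t / h n by rewrite divr_ge0// ltW.
have /andP[j1 j2] := truncn_itv th0; set j := Num.truncn _ in j1 j2.
have jt : j%:R * h n <= t by rewrite -ler_pdivlMr.
have tj : t < j.+1%:R * h n by rewrite -ltr_pdivrMr.
have jn : (j < n.+1)%N.
  rewrite -(ltr_nat R) -(ltr_pM2r (h_gt0 n)) (le_lt_trans jt)//.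
  by rewrite /h mulrC divfK.
have <- : X ((Ordinal jn).+1%:R * h n) w = X t w.
  apply: He => //=; rewrite ltr0_norm ?subr_lt0//.
  by rewrite -natr1 mulrDl mul1r; lra.
by apply: stp_ge => /=; rewrite jt ltW.
Unshelve. all: by end_near. Qed.

Let mean_stp n w :
  (\int[lebesgue_measure]_(t in `[0%R, T]) (stp n w t)%:E <=
   (\sum_(j < n.+1) h n * Psi (X (j.+1%:R * h n) w))%:E)%E.
Proof.
under eq_integral do rewrite /stp -sumEFin.
rewrite ge0_integral_sum//; last 2 first.
- by move=> j; apply/measurable_EFinP; apply: measurable_funM => //;
    apply: measurable_indic.
- by move=> j t _; rewrite lee_fin mulr_ge0// indicE.
rewrite -sumEFin; apply: lee_sum => j _.
under eq_integral do rewrite EFinM muleC.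
rewrite ge0_integralZl//; last 2 first.
- by apply/measurable_EFinP; apply: measurable_indic.
- by rewrite lee_fin.
rewrite integral_indic// EFinM muleC; apply: lee_wpmul2r; first by rewrite lee_fin.
apply: (@le_trans _ _ (lebesgue_measure (`[j%:R * h n, j.+1%:R * h n]%classic : set R))).
  by apply: le_measure; rewrite ?inE//; first [exact: measurableI|exact: subIsetl].
rewrite lebesgue_measure_itv/= lte_fin; case: ifPn => _; last by rewrite lee_fin ltW.
by rewrite -EFinB lee_fin -natr1 mulrDl mul1r addrAC subrr add0r.
Qed.

Variables (F : R -> Omega -> R) (b : R).
Hypothesis F_le : forall t w, 0 <= t <= T -> `|F t w| <= Psi (X t w).
Hypothesis riemann : forall e, 0 < e -> \forall n \near \oo,
  \sum_(j < n.+1) (T / n.+1%:R) * \int[Pr]_w Psi (X (j.+1%:R * (T / n.+1%:R)) w) <= b + e.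

(* Right-continuity of the paths and Fatou's lemma, in t and then in w, so that no
   joint measurability of (t, w) is needed. *)
Lemma time_integral_bound :
  ('E_Pr[fun w => `| \int[lebesgue_measure]_(t in `[0%R, T]) F t w |%R] <= b%:E)%E.
Proof.
have P1 : Pr setT = 1%E := probability_setT Pr.
have bX t : 0 <= t -> bounded_mfun (fun w => Psi (X t w)).
  move=> t0; split; last by exists B => w; rewrite ger0_norm.
  exact: (measurableT_comp _ (X_measurable t0)).
have jh0 n j : 0 <= j%:R * h n by rewrite mulr_ge0// ltW.
pose S n w : R := \sum_(j < n.+1) h n * Psi (X (j.+1%:R * h n) w).
have bS n : bounded_mfun (S n).
  by apply: bounded_mfun_sum => j; apply: bounded_mfunZ; exact: bX.
have S0 n w : 0 <= S n w by apply: sumr_ge0 => j _; rewrite mulr_ge0// ltW.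
rewrite unlock; apply: (@le_trans _ _ (\int[Pr]_w limn_einf (fun n => (S n w)%:E))%E).
  apply: ge0_integral_mono => w _; first by rewrite lee_fin.
  apply: (@le_trans _ _ (\int[lebesgue_measure]_(t in `[0%R, T])
      limn_einf (fun n => (stp n w t)%:E))%E).
    apply: Rintegral_norm_bound => t /=; rewrite in_itv/= => tT.
    by apply: le_trans (stp_liminf w tT); rewrite lee_fin F_le.
  apply: le_trans (fatou _ _ _ _) _ => //.
  - move=> n; apply/measurable_EFinP; apply: measurable_sum => j.
    by apply: measurable_funM => //; apply: measurable_indic.
  - by move=> n t _; rewrite lee_fin.
  rewrite !limn_einf_lim; apply: lee_lim; try exact: is_cvg_einfs.
  near=> n; apply: le_ereal_inf_tmp => _ [k /= nk <-].
  apply: le_trans (mean_stp k w); apply: ereal_inf_lbound.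
  by exists k.
apply: le_trans (fatou _ _ _ _) _ => //.
- by move=> n; apply/measurable_EFinP; have [] := bS n.
- by move=> n w _; rewrite lee_fin.
apply/lee_addgt0Pr => e e0; rewrite -EFinD; apply: limn_einf_le.
have := riemann e0; apply: filterS => n Hn.
rewrite (EFin_mean P1 (bS n)) lee_fin; apply: le_trans Hn.
rewrite (mean_sum P1)//; last by move=> j; apply: bounded_mfunZ; exact: bX.
by apply: ler_sum => j _; rewrite (meanZ P1)//; exact: bX.
Unshelve. all: by end_near. Qed.

End time_integral.

(** * The one-block estimate *)

Section particle_moment.
Context {R : realType}.
Variables (g : jump_rate R) (phi theta : R).
Hypothesis phi_gt0 : 0 < phi.
Hypothesis phiD : partition_domain g phi.
Hypothesis theta_gt0 : 0 < theta.
Hypothesis phiD' : partition_domain g (phi * expR theta).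
Local Notation Z := (fine (partition_function g phi)).
Local Notation Z' := (fine (partition_function g (phi * expR theta))).
Context {I : finType}.
Local Notation m := (iid_measure (I := I) (site_measure g phi)).

Let phi'_gt0 : 0 < phi * expR theta. Proof. by rewrite mulr_gt0// expR_gt0. Qed.

Lemma iid_exponential_tilt (eta : config I) :
  ((expR (theta * (particles eta)%:R))%:E * m [set eta] =
  ((Z' / Z) ^+ #|I|)%:E * iid_measure (site_measure g (phi * expR theta)) [set eta])%E.
Proof.
rewrite (iid_set1 phi_gt0 phiD) (iid_set1 phi'_gt0 phiD') -!EFinM; congr EFin.
rewrite /particles natr_sum mulr_sumr expR_sum -prodr_const -!big_split/=.
apply: eq_bigr => x _; rewrite !site_pmfE exprMn -expRM_natr.
have Z0 := fine_partition_gt0 phiD; have Z'0 := fine_partition_gt0 phiD'.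
by field; rewrite !gt_eqF.
Qed.

Lemma mean_exp_particles M :
  \int[m]_eta expR (theta * (minn (particles eta) M)%:R) <= (Z' / Z) ^+ #|I|.
Proof.
have m1 : m setT = 1%E := probability_setT _.
pose m' := iid_measure (I := I) (site_measure g (phi * expR theta)).
have m'1 : m' setT = 1%E := probability_setT _.
rewrite -lee_fin -(EFin_mean m1); last first.
  apply: bounded_mfun_config; exists (expR (theta * M%:R)) => eta.
  by rewrite ger0_norm ?expR_ge0// ler_expR ler_pM2l// ler_nat geq_minr.
apply: (@le_trans _ _ (\int[m]_eta (expR (theta * (particles eta)%:R))%:E)%E).
  apply: (integral_monotone (@config_measurable I)) => eta.
  by rewrite lee_fin ler_expR ler_pM2l// ler_nat geq_minl.
rewrite (integral_esum (@pickle_config_inj I) (@config_measurable I))//.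
have r0 : 0 <= (Z' / Z) ^+ #|I|.
  by rewrite exprn_ge0// divr_ge0// ltW// fine_partition_gt0.
apply: (@le_trans _ _ (\int[m']_eta ((Z' / Z) ^+ #|I|)%:E)%E).
  rewrite (integral_esum (@pickle_config_inj I) (@config_measurable I))//.
  by rewrite (eq_esum (fun eta _ => iid_exponential_tilt eta)).
by rewrite integral_cst// (_ : _ setT = 1%E) ?mule1//; exact: m'1.
Qed.

(** Entropy inequality for theta times the particle number. The tilt by theta changes the fugacity
    phi to phi exp(theta), hence the ratio of partition functions at each site; the cut-off makes
    the test function bounded and leaves the bound unchanged. *)
Lemma particle_moment (mu : probability (config I) R) (H : R) M :
  (rel_entropy mu m <= H%:E)%E ->
  theta * \int[mu]_eta (minn (particles eta) M)%:R <= H + #|I|%:R * ln (Z' / Z).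
Proof.
move=> He; have m1 : m setT = 1%E := probability_setT _.
have mu1 : mu setT = 1%E := probability_setT _.
have bF : bounded_function (fun eta : config I => theta * (minn (particles eta) M)%:R).
  exists (theta * M%:R) => eta; rewrite normrM gtr0_norm// ler_pM2l// normr_nat ler_nat.
  exact: geq_minr.
have := entropy_inequality (@pickle_config_inj I) (@config_measurable I) bF He.
rewrite (meanZ mu1); last first.
  apply: bounded_mfun_config; exists M%:R => eta; rewrite normr_nat ler_nat.
  exact: geq_minr.
move=> /le_trans; apply; rewrite lerD2l.
have r0 : 0 < Z' / Z by rewrite divr_gt0// fine_partition_gt0.
rewrite mulr_natl -lnXn// ler_ln ?posrE ?exprn_gt0//; first exact: mean_exp_particles.
apply: (@lt_le_trans _ _ 1) => //; rewrite -[leLHS](mean_cst m1 1).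
apply: (mean_le m1); first exact: bounded_mfun_cst.
  apply: bounded_mfun_config; exists (expR (theta * M%:R)) => eta.
  by rewrite ger0_norm ?expR_ge0// ler_expR ler_pM2l// ler_nat geq_minr.
by move=> eta; rewrite -expR0 ler_expR mulr_ge0// ltW.
Qed.

End particle_moment.

(** * Reduction to the block deviation *)

Section block_deviation.
Context {R : realType} {d : nat}.
Variables (g : jump_rate R) (G : R).
Hypothesis G_ge1 : 1 <= G.
Hypothesis gG : forall k, g k <= G.
Local Notation c := (inv_rate_fact g).
Local Notation phis := (phistar c).

Definition block_deviation {J : finType} (M : nat) (xi : config J) : R :=
  if (particles xi <= M)%N
  then `|average_rate g xi - phis ((particles xi)%:R / #|J|%:R)| else 0.

Local Notation cG := (fun j => inv_rate_fact_ge j gG).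

Lemma average_rate_bounds {J : finType} (xi : config J) : (0 < #|J|)%N ->
  0 <= average_rate g xi <= G.
Proof.
move=> J0; rewrite /average_rate divr_ge0 ?sumr_ge0//=; last by move=> j _; exact: rate_ge0.
rewrite ler_pdivrMr ?ltr0n// mulr_natr -sumr_const; exact: ler_sum.
Qed.

Lemma deviation_leG {J : finType} (xi : config J) (rho : R) : (0 < #|J|)%N -> 0 <= rho ->
  `|average_rate g xi - phis rho| <= G.
Proof.
move=> J0 r0; have /andP[] := average_rate_bounds xi J0.
have := phistar_ge0 (inv_rate_fact_gt0 g) (inv_rate_fact0 g) G_ge1 cG r0.
have := phistar_leG (inv_rate_fact_gt0 g) (inv_rate_fact0 g) G_ge1 cG r0.
by move=> h1 h2 h3 h4; rewrite ler_norml; apply/andP; split; lra.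
Qed.

Lemma block_deviation_ge0 {J : finType} M (xi : config J) : 0 <= block_deviation M xi.
Proof. by rewrite /block_deviation; case: ifP. Qed.

Lemma block_deviation_leG {J : finType} M (xi : config J) : (0 < #|J|)%N ->
  block_deviation M xi <= G.
Proof.
move=> J0; rewrite /block_deviation; case: ifP => _.
  by apply: deviation_leG => //; rewrite divr_ge0.
exact: le_trans ler01 G_ge1.
Qed.

Lemma block_deviation_mean (J : finType) (A M K : nat) (e : R) : (0 < #|J|)%N ->
  (K <= M)%N -> (M <= A * #|J|)%N ->
  (forall rho, 0 <= rho <= A%:R -> ensembles_close g e #|J| rho) ->
  @canonical_sum R g J M K (block_deviation M) <= e * @canonical_sum R g J M K (fun=> 1).
Proof.
move=> J0 KM MA H; have Jr : 0 < #|J|%:R :> R by rewrite ltr0n.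
have KA : K%:R <= A%:R * #|J|%:R :> R.
  by rewrite -natrM ler_nat (leq_trans KM).
have := H (K%:R / #|J|%:R) _ J M K erefl KM _.
rewrite divfK ?gt_eqF// divr_ge0//= ler_pdivrMr// => /(_ KA erefl).
apply: le_trans; rewrite le_eqVlt; apply/orP; left; apply/eqP.
apply: eq_bigr => f /eqP fK; rewrite /block_deviation fK KM//.
Qed.

Variables (N l A : nat).
Hypothesis lN : (2 * l < N.+1)%N.
Hypothesis A_gt0 : (0 < A)%N.
Local Notation I := (torus d N.+1).
Local Notation J := (box (d := d) l).
Local Notation M := (A * #|J|)%N.

Let J_gt0 : (0 < #|J|)%N. Proof. by rewrite card_box expn_gt0 addn1. Qed.

Lemma sum_particles_blocks (eta : config I) :
  (\sum_(x : I) particles (restrict_config (box_at (l := l) x) eta) =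
   #|J| * particles eta)%N.
Proof.
rewrite /particles; under eq_bigr do under eq_bigr do rewrite ffunE.
rewrite exchange_big/= -sum_nat_const; apply: eq_bigr => j _.
by rewrite [RHS](reindex_inj (@translate_inj d N (box_vector j))).
Qed.

(** Each particle lies in #|J| blocks and a dense block holds more than A #|J| particles. The
    trivial second bound in the minimum makes the right-hand side a bounded function of the
    configuration. *)
Lemma card_dense_blocks (eta : config I) :
  (A * #|[pred x : I | (M < particles (restrict_config (box_at (l := l) x) eta))%N]| <=
   minn (particles eta) (A * #|I|))%N.
Proof.
rewrite leq_min leq_mul2l max_card orbT andbT -(leq_pmul2l J_gt0) -sum_particles_blocks.
rewrite mulnA [leqLHS]mulnC -sum_nat_const [leqRHS](bigID (mem [pred x : I | (M <
  particles (restrict_config (box_at (l := l) x) eta))%N]))/=.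
apply: (leq_trans _ (leq_addr _ _)); apply: leq_sum => x /=.
by rewrite inE mulnC => /ltnW.
Qed.

(** Replacing g at a site by its block average costs the oscillation [omega] of h over a block; the
    remaining difference is the block deviation, except that each dense block costs at most G. *)
Lemma block_replacement (h : I -> R) (B omega : R) (eta : config I) :
  (forall x, `|h x| <= B) -> (forall x j, `|h (box_at (l := l) x j) - h x| <= omega) ->
  `|#|I|%:R^-1 * \sum_x h x * (g (eta x) - Phi g (min_rho_c g (block_average l eta x)))| <=
  G * omega + B * (#|I|%:R^-1 *
    \sum_x block_deviation M (restrict_config (box_at (l := l) x) eta) +
    G / (A%:R * #|I|%:R) * (minn (particles eta) (A * #|I|))%:R).
Proof.
move=> hB hw; have G0 : 0 <= G by exact: le_trans ler01 G_ge1.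
have n0 : 0 < #|J|%:R :> R by rewrite ltr0n.
have A0 : 0 < A%:R :> R by rewrite ltr0n.
have I0 : (0 < #|I|)%N by apply/card_gt0P; exists (\row__ ord0).
have Ir : 0 < #|I|%:R :> R by rewrite ltr0n.
pose r x := restrict_config (box_at (l := l) x) eta.
pose av x := average_rate g (r x); pose ph x := phis ((particles (r x))%:R / #|J|%:R).
have -> : \sum_x h x * (g (eta x) - Phi g (min_rho_c g (block_average l eta x))) =
    \sum_x h x * (g (eta x) - ph x).
  apply: eq_bigr => x _; rewrite block_averageE// (Phi_min_rho_c G_ge1 gG)//.
(* The sum over the torus is invariant under translation, so averaging g over blocks only displaces
   the argument of h. *)
have E1 : \sum_x h x * g (eta x) - \sum_x h x * av x =
    #|J|%:R^-1 * \sum_x \sum_(j : J) (h (box_at x j) - h x) * g (eta (box_at x j)).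
  have -> : \sum_x h x * g (eta x) =
      #|J|%:R^-1 * \sum_x \sum_(j : J) h (box_at x j) * g (eta (box_at x j)).
    rewrite exchange_big/=.
    have Ej (j : J) : \sum_x h (box_at x j) * g (eta (box_at x j)) = \sum_x h x * g (eta x).
      exact: (sum_translate (box_vector j) (fun x => h x * g (eta x))).
    rewrite (eq_bigr _ (fun j _ => Ej j)).
    by rewrite sumr_const -[X in _ * X]mulr_natl mulKf// gt_eqF.
  rewrite mulr_sumr [RHS]mulr_sumr -sumrB; apply: eq_bigr => x _.
  rewrite /av /average_rate mulrA [X in _ - X]mulrC -mulrBr; congr (_ * _).
  rewrite mulr_sumr -sumrB; apply: eq_bigr => j _.
  by rewrite ffunE mulrBl.
have B1 : `|\sum_x h x * g (eta x) - \sum_x h x * av x| <= #|I|%:R * (G * omega).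
  rewrite E1 normrM ger0_norm ?invr_ge0// mulrC ler_pdivrMr//.
  apply: le_trans (ler_norm_sum _ _ _) _.
  rewrite -mulrA mulr_natl -sumr_const; apply: ler_sum => x _.
  apply: le_trans (ler_norm_sum _ _ _) _.
  rewrite mulr_natr -sumr_const; apply: ler_sum => j _.
  by rewrite normrM mulrC ler_pM// ger0_norm ?rate_ge0.
pose bad := [pred x : I | (M < particles (r x))%N].
have B2 : \sum_x `|av x - ph x| <= \sum_x block_deviation M (r x) + G * #|bad|%:R.
  rewrite mulr_natr -sumr_const [X in _ <= _ + X]big_mkcond -big_split/=.
  apply: ler_sum => x _; rewrite /block_deviation inE/= ltnNge; case: ifP => _/=.
    by rewrite addr0.
  by rewrite add0r deviation_leG// divr_ge0.
have B3 : A%:R * #|bad|%:R <= (minn (particles eta) (A * #|I|))%:R :> R.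
  by rewrite -natrM ler_nat; exact: card_dense_blocks.
have B0 : 0 <= B by apply: le_trans (hB (\row__ ord0)).
have B4 : `|\sum_x h x * (g (eta x) - ph x)| <= #|I|%:R * (G * omega) +
    B * (\sum_x block_deviation M (r x) + G * #|bad|%:R).
  have -> : \sum_x h x * (g (eta x) - ph x) =
     (\sum_x h x * g (eta x) - \sum_x h x * av x) + \sum_x h x * (av x - ph x).
    rewrite -sumrB -big_split/=; apply: eq_bigr => x _; ring.
  apply: le_trans (ler_normD _ _) _; apply: lerD => //.
  apply: le_trans (ler_norm_sum _ _ _) _; apply: le_trans (ler_wpM2l B0 B2).
  rewrite mulr_sumr; apply: ler_sum => x _; rewrite normrM ler_wpM2r//.
rewrite normrM ger0_norm ?invr_ge0// mulrC ler_pdivrMr//.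
apply: le_trans B4 _.
set D := \sum_x _; set m := (minn _ _)%:R in B3 *.
have -> : (G * omega + B * (#|I|%:R^-1 * D + G / (A%:R * #|I|%:R) * m)) * #|I|%:R =
    #|I|%:R * (G * omega) + B * (D + G * (m / A%:R)).
  by field; rewrite !gt_eqF.
by rewrite lerD2l ler_wpM2l// lerD2l ler_wpM2l// ler_pdivlMr// mulrC.
Qed.

End block_deviation.

(** * Boundedness and uniform continuity of periodic test functions *)

Section test_functions.
Context {R : realType} {d : nat}.
Variables (T : R) (H : R * 'rV[R]_d -> R).
Hypothesis H_cts : test_function T H.

Let H_near (t0 : R) (u0 : 'rV[R]_d) (e : R) : 0 <= t0 <= T -> 0 < e -> exists2 r, 0 < r &
  forall (t : R) (u : 'rV[R]_d), 0 <= t <= T -> `|t0 - t| < r -> (forall i, `|u0 ord0 i - u ord0 i| < r) ->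
  `|H (t0, u0) - H (t, u)| < e.
Proof.
move=> tT e0; have [+ _] := H_cts; move=> /subspace_continuousP/(_ (t0, u0)).
move=> /(_ _)/cvgrPdist_lt; have tu : (`[0, T] `*` [set: 'rV[R]_d]) (t0, u0) by split.
move=> /(_ tu e e0) /nbhs_ballP[r /= r0 Hr]; exists r => // t u tT' tr ur.
apply: (Hr (t, u)) => //=; split=> //=; split=> // i j; rewrite (ord1 i).
exact: ur.
Qed.

(** By periodicity every space point can be moved into this compact set. *)
Let unit_box : set (R * 'rV[R]_d) :=
  `[0, T] `*` [set u : 'rV[R]_d | forall i, u ord0 i \in `[0, 1]].

Let compact_unit_box : compact unit_box.
Proof.
apply: compact_setX; first exact: segment_compact.
exact: (rV_compact (fun=> @segment_compact R 0 1)).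
Qed.

Definition floor_vector (u : 'rV[R]_d) : 'rV[int]_d := \row_i Num.floor (u ord0 i).

Lemma floor_vectorP (u : 'rV[R]_d) i :
  (u - map_mx intr (floor_vector u)) ord0 i \in `[0, 1].
Proof.
rewrite in_itv/= !mxE; have := floor_itv (u ord0 i); rewrite intrD => /andP[].
by move=> h1 h2; apply/andP; split; lra.
Qed.

Let H_floor (t : R) (u : 'rV[R]_d) : 0 <= t <= T -> H (t, u - map_mx intr (floor_vector u)) = H (t, u).
Proof.
move=> tT; rewrite -[RHS](H_cts.2 _ _ (- floor_vector u))//; congr (H (_, _)).
by apply/rowP => i; rewrite !mxE intrN.
Qed.

Lemma test_function_bounded : exists B : R, forall t (u : 'rV[R]_d), 0 <= t <= T -> `|H (t, u)| <= B.
Proof.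
have : \forall B \near +oo, unit_box `<=` [set x | 0 <= x.1 <= T -> `|H x| <= B].
  apply: (compact_near_coveringP _).1 => // -[t0 u0] [/= + _]; rewrite in_itv/= => tT.
  have [r r0 Hr] := H_near u0 tT ltr01.
  exists (ball (t0, u0) r, [set B | `|H (t0, u0)| + 1 <= B]).
    split=> /=; first exact: nbhsx_ballx.
    exact: nbhs_pinfty_ge.
  move=> [[t u] B] /= [[tr ur] hB] tT'; apply: le_trans hB.
  have : `|H (t0, u0) - H (t, u)| < 1 by apply: Hr => // i; exact: (ur.2 ord0 i).
  by rewrite -lerBlDl distrC => /ltW; apply: le_trans; exact: lerB_dist.
move=> /filter_ex[B HB]; exists B => t u tT; rewrite -H_floor//.
by apply: HB => //; split => //= i; exact: floor_vectorP.
Qed.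

(** The second point [v] may lie outside the unit box, so that one integer translation, chosen for
    the first point, serves both. *)
Let osc (e r : R) : set (R * 'rV[R]_d) := [set x : R * 'rV[R]_d | 0 <= x.1 <= T ->
  forall v : 'rV[R]_d, (forall i, `|x.2 ord0 i - v ord0 i| < r) -> `|H x - H (x.1, v)| <= e].

Lemma test_function_uniform (e : R) : 0 < e -> exists2 r : R, 0 < r & forall t (u v : 'rV[R]_d),
  0 <= t <= T -> (forall i, `|u ord0 i - v ord0 i| < r) -> `|H (t, u) - H (t, v)| <= e.
Proof.
move=> e0.
have : \forall r \near (0:R)^'+, unit_box `<=` osc e r.
  apply: (compact_near_coveringP _).1 => // -[t0 u0] [/= + _]; rewrite in_itv/= => tT.
  have e20 : 0 < e / 2 by rewrite divr_gt0.
  have [r r0 Hr] := H_near u0 tT e20; have r20 : 0 < r / 2 by rewrite divr_gt0.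
  exists (ball (t0, u0) (r / 2), [set s | s < r / 2]).
    split=> /=; first exact: nbhsx_ballx.
    exact: nbhs_right_lt.
  move=> [[t u] s] /= [[tr ur] hs] tT' v uv.
  have tr' : `|t0 - t| < r by apply: lt_trans tr _; lra.
  have h1 : `|H (t0, u0) - H (t, u)| < e / 2.
    by apply: Hr => // i; apply: lt_trans (ur.2 ord0 i) _; lra.
  have h2 : `|H (t0, u0) - H (t, v)| < e / 2.
    apply: Hr => // i; have := uv i; have := ur.2 ord0 i; rewrite /ball/= => h3 h4.
    by rewrite -(subrKA (u ord0 i)) (le_lt_trans (ler_normD _ _))//; lra.
  rewrite -(subrKA (H (t0, u0))) (le_trans (ler_normD _ _))// [X in X + _]distrC.
  by lra.
move=> h; have [|r [r0 Hr]] := @filter_ex _ (0^'+ : set_system R) _ [set r | 0 < r /\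
    unit_box `<=` osc e r].
  by apply: filterI => //; exact: nbhs_right_gt.
exists r => // t u v tT uv; rewrite -H_floor//.
rewrite -(H_cts.2 t v (- floor_vector u))//; apply: (Hr (_, _)) => //=.
  by split => //= i; exact: floor_vectorP.
by move=> i; have := uv i; rewrite !mxE intrN; congr (`|_| < _); ring.
Qed.

Lemma torus_point_translate N (x : torus d N.+1) (z : 'rV[int]_d) :
  exists q : 'rV[int]_d, torus_point (translate x z) + map_mx intr q =
    torus_point x + N.+1%:R^-1 *: map_mx intr z :> 'rV[R]_d.
Proof.
exists (\row_i ((Posz (x ord0 i) + z ord0 i) %/ N.+1)%Z).
apply/rowP => i; have := translateE x z i; move: (translate x z) => y hy.
rewrite !mxE (_ : 0 = ord0)//.
have := congr1 (fun a : int => a%:~R : R) (divz_eq (Posz (x ord0 i) + z ord0 i) N.+1).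
rewrite -hy !intrD intrM -!pmulrn => h.
have N0 : N.+1%:R != 0 :> R by rewrite pnatr_eq0.
apply: (mulIf N0); rewrite !mulrDl !divfK// [_^-1 * _]mulrC divfK// h.
exact: addrC.
Qed.

Lemma test_function_block l e : 0 < e -> \forall N \near \oo, forall t
  (x : torus d N.+1) (j : box l), 0 <= t <= T ->
  `|H (t, torus_point (box_at x j)) - H (t, torus_point x)| <= e.
Proof.
move=> /test_function_uniform[r r0 Hr]; near=> N => t x j tT.
have [q hq] := torus_point_translate x (box_vector j).
rewrite -(H_cts.2 t _ q)//; apply: Hr => // i; rewrite hq mxE addrAC subrr add0r.
rewrite !mxE mulrC.
rewrite normrM normfV (ger0_norm (ler0n _ _)) ltr_pdivrMr ?ltr0n//.
apply: (@le_lt_trans _ _ l%:R).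
  rewrite -intr_norm; have := ltn_ord (j i).
  move: (j i : nat) => k kl; rewrite pmulrn ler_int; lia.
rewrite mulrC -ltr_pdivrMr//; apply: (@lt_le_trans _ _ N%:R); last by rewrite ler_nat.
by near: N; exact: nbhs_infty_gtr.
Unshelve. all: by end_near. Qed.

End test_functions.

(** * The Feynman-Kac bound for Riemann sums *)

Section feynman_kac_limit.
Context {R : realType} {I : finType}.
Local Notation S := (config I).
Variables (K : finType) (r : K -> S -> R) (tau : K -> S -> S) (Lam : R).
Hypothesis r_ge0 : forall i x, 0 <= r i x.
Hypothesis r_sum : forall x, \sum_i r i x <= Lam.
Local Notation L := (jump_generator r tau).
Context {d : measure_display} {Omega : measurableType d}.
Variables (Pr : probability Omega R) (mu nu : probability S R) (X : R -> Omega -> S).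
Hypothesis XP : markov_jump_process Pr L mu X.
Variables (W : S -> R) (Wmax lam H0 T : R).
Hypothesis W_ge0 : forall x, 0 <= W x.
Hypothesis W_le : forall x, W x <= Wmax.
Hypothesis lam_ge0 : 0 <= lam.
Hypothesis entropy : (rel_entropy mu nu <= H0%:E)%E.
Hypothesis spectral : forall u : S -> R, bounded_function u ->
  \int[nu]_x (u x * L u x + W x * u x ^+ 2) <= lam * \int[nu]_x (u x ^+ 2).
Hypothesis T_gt0 : 0 < T.

Lemma feynman_kac_riemann e : 0 < e -> \forall n \near \oo,
  \sum_(j < n.+1) (T / n.+1%:R) * \int[Pr]_w W (X (j.+1%:R * (T / n.+1%:R)) w) <=
  H0 / 2 + lam * T + e.
Proof.
move=> e0.
(* The sum over right endpoints is a left-endpoint sum of n + 2 steps without its first term; it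
   covers the time T + h <= T + T, hence the doubled horizon. *)
have FK h n := feynman_kac_discrete (h := h) (n := n) r_ge0 r_sum XP W_ge0 W_le lam_ge0 entropy spectral (T := T + T).
move: FK; set B1 := (2 * Lam + Wmax) * _; set B2 := 2 * B1 ^+ 2 + _ => FK.
pose D := lam + `|(T + T) * (B1 ^+ 2 + B2)|.
have D0 : 0 <= D by rewrite addr_ge0.
(* The single condition h m <= 1 yields h Lam <= 1, h B1 <= 1/2 and D h <= e. *)
pose m := Lam + `|B1| * 2 + D / e + 1.
near=> n; pose h := T / n.+1%:R.
have n0 : 0 < n.+1%:R :> R by rewrite ltr0n.
have h0 : 0 < h by rewrite divr_gt0.
have Lam0 := Lam_ge0 r_ge0 r_sum.
have De0 : 0 <= D / e by rewrite divr_ge0// ltW.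
have hm : h * m <= 1.
  rewrite /h mulrAC ler_pdivrMr// mul1r mulrC.
  apply: (@le_trans _ _ n%:R); last by rewrite ler_nat.
  by near: n; exact: nbhs_infty_ger.
have le_m c : 0 <= c -> c <= m -> h * c <= 1.
  by move=> c0 cm; apply: le_trans hm; rewrite ler_pM2l.
have nB : 0 <= `|B1| by [].
have m_ge (a b c : R) : 0 <= a -> 0 <= b -> 0 <= c ->
  [/\ a <= a + b * 2 + c + 1, b * 2 <= a + b * 2 + c + 1 & c <= a + b * 2 + c + 1].
  by move=> *; split; lra.
have [m1 m2 m3] := m_ge _ _ _ Lam0 nB De0.
have hL : h * Lam <= 1 by exact: le_m.
have hB : h * B1 <= 2^-1.
  have hB' : h * (`|B1| * 2) <= 1.
    by apply: le_m => //; rewrite mulr_ge0.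
  apply: (@le_trans _ _ (h * `|B1|)); first by rewrite ler_pM2l// ler_norm.
  by rewrite -(ler_pM2r (x := 2))// mulVf// -mulrA.
have hD : D * h <= e.
  have : h * (D / e) <= 1 by exact: le_m.
  by rewrite mulrA ler_pdivrMr// mul1r mulrC.
have nh : n.+2%:R * h = T + h.
  by rewrite -natr1 mulrDl mul1r /h mulrC divfK// gt_eqF.
have hT : h <= T by rewrite /h ler_pdivrMr// ler_peMr ?ler1n// ltW.
have nT : n.+2%:R * h <= T + T by rewrite nh lerD2l.
have := FK h n.+2 h0 hL hB nT; rewrite big_ord_recl nh => h1.
have W0 : 0 <= h * \int[Pr]_w W (X ((ord0 : 'I_n.+2)%:R * h) w).
  by apply: mulr_ge0; [exact: ltW|]; apply: Rintegral_ge0 => w _; exact: W_ge0.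
have h2 : \sum_(j < n.+1) h * \int[Pr]_w W (X (j.+1%:R * h) w) <=
    H0 / 2 + lam * (T + h) + (T + h) * h * (B1 ^+ 2 + B2).
  apply: le_trans h1; rewrite -[leLHS]add0r; apply: lerD => //.
have h3 : (T + h) * h * (B1 ^+ 2 + B2) <= `|(T + T) * (B1 ^+ 2 + B2)| * h.
  rewrite mulrAC ler_pM2r//; apply: le_trans (ler_norm _) _; rewrite !normrM ler_wpM2r//.
  rewrite !ger0_norm ?lerD2l//; first by rewrite addr_ge0// ltW.
  by rewrite addr_ge0// ltW.
apply: le_trans h2 _; apply: le_trans (lerD (lexx _) h3) _.
by rewrite mulrDr -!addrA !lerD2l -mulrDl.
Unshelve. all: by end_near. Qed.

End feynman_kac_limit.

(** * The estimate for a fixed block size *)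

Section one_block_bound.
Context {R : realType} {d : nat}.
Variables (g : jump_rate R) (p : step_distribution R d) (G : R).
Hypothesis G_ge1 : 1 <= G.
Hypothesis gG : forall k, g k <= G.
Variables (phi theta : R).
Hypothesis phi_gt0 : 0 < phi.
Hypothesis phiD : partition_domain g phi.
Hypothesis theta_gt0 : 0 < theta.
Hypothesis phiD' : partition_domain g (phi * expR theta).
Variables (l A : nat) (e : R).
Hypothesis e_ge0 : 0 <= e.
Hypothesis A_gt0 : (0 < A)%N.
Hypothesis close : forall rho, 0 <= rho <= A%:R ->
  ensembles_close g e #|box (d := d) l| rho.
Local Notation q := (ln (fine (partition_function g (phi * expR theta)) /
  fine (partition_function g phi))).

(** The four terms come from the oscillation of h over a block, the initial entropy, the canonical
    means and the dense blocks. The multiplier [gam] of the potential divides the entropy term, and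
    its size is paid for by the threshold for N only. *)
Lemma one_block_bound (gam : R) : 0 < gam -> \forall N \near \oo,
  forall (mu : probability (config (torus d N.+1)) R)
    (dsp : measure_display) (Omega : measurableType dsp) (P : probability Omega R)
    (eta : R -> Omega -> config (torus d N.+1)) (T C0 B omega : R)
    (h : R -> torus d N.+1 -> R),
  (rel_entropy mu (iid_measure (site_measure g phi)) <=
     (C0 * #|torus d N.+1|%:R)%:E)%E ->
  accelerated_zrp g p P mu eta -> 0 < T ->
  (forall t x, 0 <= t <= T -> `|h t x| <= B) ->
  (forall t x (j : box l), 0 <= t <= T -> `|h t (box_at x j) - h t x| <= omega) ->
  ('E_P[fun w => `| \int[lebesgue_measure]_(t in `[0%R, T])
      (#|torus d N.+1|%:R^-1 * \sum_x h t x *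
        (g (eta t w x) - Phi g (min_rho_c g (block_average l (eta t w) x)))) |%R] <=
   (T * (G * omega) + B * (C0 / (2 * gam) + 2 * e * T +
      T * (G / (A%:R * theta) * (C0 + q))))%:E)%E.
Proof.
move=> gam0; have J0 : (0 < #|box (d := d) l|)%N by rewrite card_box expn_gt0 addn1.
pose M := (A * #|box (d := d) l|)%N.
have V0 := @block_deviation_ge0 R g (box (d := d) l) M.
have VG := fun xi => @block_deviation_leG R g G G_ge1 gG (box (d := d) l) M xi J0.
have [|||C C0 HC] := spectral_estimate p gG phi_gt0 phiD e_ge0 V0
  (M := M) (l := l).
- by move=> xi xiM; rewrite /block_deviation leqNgt xiM.
- by exists G => xi; rewrite ger0_norm.
- by move=> K KM; apply: (block_deviation_mean (A := A)) => //; exact: leqnn.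
near=> N => mu dsp Omega P eta T C1 B omega h He zrp T0 hB hw.
have lN : (2 * l < N.+1)%N by rewrite ltnS; near: N; exact: nbhs_infty_ge.
have gamN : gam * C <= (N.+1 ^ 2)%:R.
  apply: (@le_trans _ _ N%:R).
    by near: N; exact: nbhs_infty_ger.
  by rewrite ler_nat; nia.
set I := torus d N.+1 in mu eta h He zrp hB hw *.
have I0 : (0 < #|I|)%N by apply/card_gt0P; exists (\row__ ord0).
have Ir : 0 < #|I|%:R :> R by rewrite ltr0n.
have A0 : 0 < A%:R :> R by rewrite ltr0n.
have G0 : 0 <= G := le_trans ler01 G_ge1.
have t00 : (0 : R) <= 0 <= T by apply/andP; split=> //; exact: ltW.
have B0 : 0 <= B := le_trans (normr_ge0 _) (hB 0 (\row__ ord0) t00).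
have w0 : 0 <= omega.
  by apply: le_trans (normr_ge0 _) (hw 0 (\row__ ord0) [ffun=> ord0] t00).
rewrite /accelerated_zrp zrp_generatorE in zrp.
have r0 := @zrp_rate_ge0 R d g p N; have rs := zrp_rate_sum p (N := N) gG.
pose SV (xi : config I) := \sum_x block_deviation g M (restrict_config (box_at (l := l) x) xi).
pose f (xi : config I) : R := (minn (particles xi) (A * #|I|))%:R.
have SV0 xi : 0 <= SV xi by apply: sumr_ge0.
have SVle xi : SV xi <= #|I|%:R * G.
  by rewrite mulr_natl -sumr_const; apply: ler_sum.
have f0 xi : 0 <= f xi by [].
have fle xi : f xi <= (A * #|I|)%:R by rewrite ler_nat geq_minr.
pose Psi xi := G * omega + B * (#|I|%:R^-1 * SV xi + G / (A%:R * #|I|%:R) * f xi).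
have k0 : 0 <= G / (A%:R * #|I|%:R) by rewrite divr_ge0// mulr_ge0// ltW.
have Psi0 xi : 0 <= Psi xi.
  by rewrite addr_ge0 ?mulr_ge0// addr_ge0// mulr_ge0// invr_ge0.
have Psile xi : Psi xi <= G * omega + B * (#|I|%:R^-1 * (#|I|%:R * G) +
     G / (A%:R * #|I|%:R) * (A * #|I|)%:R).
  by rewrite lerD2l ler_wpM2l// lerD// ler_wpM2l// invr_ge0.
have Xm := process_measurable zrp.
apply: (time_integral_bound T0 Xm (process_right_cts zrp) Psi0 Psile).
  by move=> t w tT; apply: (block_replacement G_ge1 gG) => // x; [exact: hB|move=> j; exact: hw].
move=> e1 e10.
have P1 : P setT = 1%E := probability_setT P.
have bSV t : 0 <= t -> bounded_mfun (fun w => SV (eta t w)).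
  move=> t0; apply: (process_bounded_mfun zrp t0); exists (#|I|%:R * G) => xi.
  by rewrite ger0_norm.
have bf' : bounded_function f by exists (A * #|I|)%:R => xi; rewrite ger0_norm.
have bf t : 0 <= t -> bounded_mfun (fun w => f (eta t w)).
  by move=> t0; exact: (process_bounded_mfun zrp t0).
have lawf t : 0 <= t -> \int[P]_w f (eta t w) <= #|I|%:R * (C1 + q) / theta.
  move=> t0; rewrite (law_conserved r0 rs zrp t0 bf'); last first.
    move=> xi; exact: (zrp_generator_particles g p (fun k => (minn k (A * #|I|))%:R)).
  rewrite ler_pdivlMr// mulrC.
  have := particle_moment phi_gt0 phiD theta_gt0 phiD' (A * #|I|) He.
  by move=> /le_trans; apply; rewrite mulrDr [C1 * _]mulrC.
have lawPsi t : 0 <= t -> \int[P]_w Psi (eta t w) <= G * omega +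
    B / (gam * #|I|%:R) * \int[P]_w (gam * SV (eta t w)) +
    B * (G / (A%:R * theta) * (C1 + q)).
  move=> t0; rewrite /Psi.
  have b1 := bounded_mfunZ (#|I|%:R^-1) (bSV t t0).
  have b2 := bounded_mfunZ (G / (A%:R * #|I|%:R)) (bf t t0).
  rewrite (meanD P1); [|exact: bounded_mfun_cst|
    by apply: bounded_mfunZ; exact: bounded_mfunD].
  rewrite (mean_cst P1) (meanZ P1); last exact: bounded_mfunD.
  rewrite (meanD P1 b1 b2) !(meanZ P1); [|exact: bSV|exact: bf|exact: bSV].
  rewrite -addrA lerD2l mulrDr; apply: lerD.
    rewrite le_eqVlt; apply/orP; left; apply/eqP.
    by field; rewrite !gt_eqF.
  rewrite ler_wpM2l//; apply: le_trans (ler_wpM2l k0 (lawf t t0)) _.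
  rewrite le_eqVlt; apply/orP; left; apply/eqP.
  by field; rewrite !gt_eqF.
have e20 : 0 < e1 * (gam * #|I|%:R) / (B + 1).
  by rewrite divr_gt0 ?ltr_wpDl// !mulr_gt0.
have W0 xi : 0 <= gam * SV xi by rewrite mulr_ge0// ltW.
have Wle xi : gam * SV xi <= gam * (#|I|%:R * G) by rewrite ler_pM2l.
have lam0 : 0 <= 2 * e * gam * #|I|%:R by rewrite !mulr_ge0// ltW.
have sp u : bounded_function u -> \int[iid_measure (site_measure g phi)]_xi
    (u xi * jump_generator (zrp_rate g p (N := N)) (@zrp_move d N) u xi +
      (gam * SV xi) * u xi ^+ 2) <= 2 * e * gam * #|I|%:R *
    \int[iid_measure (site_measure g phi)]_xi (u xi ^+ 2).
  by move=> bu; exact: (HC N gam u lN (ltW gam0) gamN bu).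
have := feynman_kac_riemann r0 rs zrp W0 Wle lam0 He sp T0 e20.
apply: filterS => n Hn; have n0 : 0 < n.+1%:R :> R by rewrite ltr0n.
have hn0 : 0 <= T / n.+1%:R by rewrite divr_ge0// ltW.
have sumT (c : R) : \sum_(j < n.+1) T / n.+1%:R * c = T * c.
  by rewrite sumr_const card_ord -[LHS]mulr_natl; field; rewrite gt_eqF.
apply: (@le_trans _ _ (\sum_(j < n.+1) (T / n.+1%:R * (G * omega) +
    B / (gam * #|I|%:R) * (T / n.+1%:R *
       \int[P]_w (gam * SV (eta (j.+1%:R * (T / n.+1%:R)) w))) +
    T / n.+1%:R * (B * (G / (A%:R * theta) * (C1 + q)))))).
  apply: ler_sum => j _; rewrite [X in _ <= _ + X + _]mulrCA -!mulrDr; apply: ler_wpM2l => //.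
  by apply: lawPsi; rewrite mulr_ge0.
rewrite 2!big_split/= !sumT -mulr_sumr.
have k1 : 0 <= B / (gam * #|I|%:R) by rewrite divr_ge0// mulr_ge0// ltW.
have {Hn} h1 := ler_wpM2l k1 Hn.
apply: le_trans (lerD (lerD (lexx _) h1) (lexx _)) _.
have B1 : B / (B + 1) <= 1 by rewrite ler_pdivrMr ?ltr_wpDl// mul1r lerDl.
have E1 : B / (gam * #|I|%:R) * (C1 * #|I|%:R / 2 + 2 * e * gam * #|I|%:R * T +
    e1 * (gam * #|I|%:R) / (B + 1)) =
  B * (C1 / (2 * gam) + 2 * e * T) + e1 * (B / (B + 1)).
  by field; rewrite !gt_eqF// ltr_wpDl.
rewrite E1; have : e1 * (B / (B + 1)) <= e1 by rewrite ler_piMr// ltW.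
move: (e1 * (B / (B + 1))) => y yle.
have -> : T * (G * omega) + B * (C1 / (2 * gam) + 2 * e * T +
      T * (G / (A%:R * theta) * (C1 + q))) + e1 =
   T * (G * omega) + (B * (C1 / (2 * gam) + 2 * e * T) + e1) +
   T * (B * (G / (A%:R * theta) * (C1 + q))) by ring.
by rewrite lerD2r lerD2l lerD2l.
Unshelve. all: by end_near. Qed.

End one_block_bound.

(** * Passage to the limit *)

Section limsup.
Context {R : realType}.

Lemma limn_esup_le (u : nat -> \bar R) (c : \bar R) :
  (\forall n \near \oo, u n <= c)%E -> (limn_esup u <= c)%E.
Proof.
move=> [N _ H]; rewrite limn_esup_lim; apply: lime_le; first exact: is_cvg_esups.
exists N => // n /= Nn; apply: ge_ereal_sup => _ [k /= nk <-]; apply: H => /=.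
exact: leq_trans nk.
Qed.

Lemma limn_esup_ge0 (u : nat -> \bar R) : (forall n, 0 <= u n)%E -> (0 <= limn_esup u)%E.
Proof.
move=> H; rewrite limn_esup_lim; apply: lime_ge; first exact: is_cvg_esups.
exists 0%N => // n _ /=; apply: le_trans (H n) _.
by apply: ereal_sup_ubound; exists n => /=.
Qed.

Lemma ge0_cvge0 (u : nat -> \bar R) : (forall n, 0 <= u n)%E ->
  (forall e : R, 0 < e -> \forall n \near \oo, (u n <= e%:E)%E) -> u @ \oo --> 0%E.
Proof.
move=> u0 H; apply/fine_cvgP; split.
  apply: filterS (H 1 ltr01) => n un; rewrite ge0_fin_numE//.
  by apply: le_lt_trans un _; exact: ltry.
apply/cvgrPdist_le => e e0; apply: filterS (H e e0) => n un /=.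
rewrite sub0r normrN ger0_norm ?fine_ge0// -lee_fin fineK// ge0_fin_numE//.
by apply: le_lt_trans un _; exact: ltry.
Qed.

End limsup.

Theorem theorem3p1 (R : realType) (d : nat) (hd : (0 < d)%N)
  (g : jump_rate R) (g_bounded : has_ubound (range g))
  (p : step_distribution R d) (p_mean_zero : mean_zero p)
  (mu0 : forall N : nat, probability (config (torus d N)) R)
  (rho : R) (rho_gt0 : 0 < rho) (rho_lt : (rho%:E < rho_c g)%E)
  (entropy : (ereal_sup [set ((N ^ d)%:R^-1)%:E *
       rel_entropy (mu0 N) (iid_measure (site_measure g (Phi g rho)))
     | N in [set N : nat | (0 < N)%N]] < +oo)%E)
  (dsp : nat -> measure_display) (Omega : forall N : nat, measurableType (dsp N))
  (P : forall N : nat, probability (Omega N) R)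
  (eta : forall N : nat, R -> Omega N -> config (torus d N))
  (zrp : forall N : nat, (0 < N)%N -> accelerated_zrp g p (P N) (mu0 N) (eta N))
  (T : R) (T_gt0 : 0 < T)
  (H : R * 'rV[R]_d -> R) (H_cts : test_function T H) :
  limn_esup (fun N : nat => ('E_(P N)[fun w =>
    `| \int[lebesgue_measure]_(t in `[0, T])
         ((N ^ d)%:R^-1 * \sum_(x : torus d N) H (t, torus_point x) *
            (g (eta N t w x)
             - Phi g (min_rho_c g (block_average l (eta N t w) x)))) |%R])%E)
    @[l --> \oo] --> 0%E.
Proof.
have [G G_ge1 gG] : exists2 G : R, 1 <= G & forall k, g k <= G.
  have [M HM] := g_bounded; exists (Num.max 1 M) => [|k]; first by rewrite le_max lexx.
  by rewrite le_max HM ?orbT//; exists k.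
have [phiE phi_lt] := Phi_subcritical G_ge1 gG (ltW rho_gt0) rho_lt.
have phi_gt0 := rate_phistar_gt0 G_ge1 gG rho_gt0.
move: phiE phi_lt phi_gt0; set phi := phistar _ rho => phiE phi_lt phi_gt0.
rewrite phiE in entropy.
have domain := lt_pc_domain G_ge1 gG.
have phiD : partition_domain g phi by apply: domain => //; exact: ltW.
have [theta theta_gt0 phiD'] :
    exists2 theta : R, 0 < theta & partition_domain g (phi * expR theta).
  (* The tilted fugacity is the midpoint of phi and phi_c, available because rho < [rho_c] gives phi
     < phi_c. *)
  have r0 : 1 < (phi + pc g) / 2 / phi.
    by rewrite ltr_pdivlMr// mul1r ltr_pdivlMr//; lra.
  exists (ln ((phi + pc g) / 2 / phi)); first exact: ln_gt0.
  rewrite lnK ?posrE ?(lt_trans ltr01)// mulrC divfK ?gt_eqF//; apply: domain; lra.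
set q := ln (fine (partition_function g (phi * expR theta)) /
  fine (partition_function g phi)).
have cardE N : #|torus d N| = (N ^ d)%N by rewrite card_mx card_ord mul1n.
have [C0 C00 HC0] : exists2 C0 : R, 0 <= C0 & forall N, (0 < N)%N ->
    (rel_entropy (mu0 N) (iid_measure (site_measure g phi)) <=
     (C0 * #|torus d N|%:R)%:E)%E.
  set S := ereal_sup _ in entropy.
  have [C0 C00 SC] : exists2 C0 : R, 0 <= C0 & (S <= C0%:E)%E.
    move: S entropy => [s _||_]; [|by rewrite ltxx|by exists 0; rewrite ?leNye].
    by exists (Num.max 0 s); rewrite ?lee_fin le_max lexx ?orbT.
  exists C0 => // N N0; have Nd : 0 < (N ^ d)%:R :> R by rewrite ltr0n expn_gt0 N0.
  rewrite cardE mulrC EFinM -lee_pdivrMl//; apply: le_trans SC.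
  by apply: ereal_sup_ubound; exists N.
have [B HB] := test_function_bounded H_cts.
have B0 : 0 <= B by apply: le_trans (HB 0 0 _); rewrite // lexx ltW.
apply: ge0_cvge0 => [l|e e0].
  by apply: limn_esup_ge0 => N; apply: expectation_ge0.
(* Each of the four terms of [one_block_bound] receives e / 4, through [gam], [eps], [omega] and
   [A]; the added 1 keeps the denominators positive when B or C0 vanishes. *)
pose gam := 2 * (B * C0 + 1) / e.
have BC0 : 0 < B * C0 + 1 by rewrite ltr_wpDl// mulr_ge0.
have gam0 : 0 < gam by rewrite divr_gt0// mulr_gt0.
pose eps := e / (8 * (B + 1) * T).
have B10 : 0 < B + 1 by rewrite ltr_wpDl.
have eps0 : 0 < eps by rewrite divr_gt0// !mulr_gt0.
have G0 : 0 < G := lt_le_trans ltr01 G_ge1.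
pose omega := e / (4 * (T * G)).
have omega0 : 0 < omega by rewrite divr_gt0// !mulr_gt0.
pose k := B * (T * (G * (C0 + q))).
pose A := (Num.bound `|4 * k / (theta * e)|).+1.
have A0 : 0 < A%:R :> R by rewrite ltr0n.
have kA : k / (A%:R * theta) <= e / 4.
  rewrite ler_pdivrMr ?mulr_gt0//.
  have : 4 * k / (theta * e) <= A%:R.
    apply: le_trans (ler_norm _) _; apply: le_trans (ltW (archi_boundP (normr_ge0 _))) _.
    by rewrite ler_nat.
  by rewrite ler_pdivrMr ?mulr_gt0//; lra.
have [n0 _ Hn0] := equivalence_of_ensembles G_ge1 gG (ler0n _ A) eps0.
exists n0 => // l /= n0l.
have close r : 0 <= r <= A%:R -> ensembles_close g eps #|box (d := d) l| r.
  apply: Hn0 => /=; rewrite card_box; apply: (leq_trans n0l).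
  apply: (@leq_trans ((2 * l + 1) ^ 1)%N); first by rewrite expn1 addn1 leqW// leq_pmull.
  by rewrite leq_pexp2l// addn1.
apply: limn_esup_le.
have OB := one_block_bound p G_ge1 gG phi_gt0 phiD theta_gt0 phiD' (ltW eps0) (ltn0Sn _)
  close gam0.
have TF := test_function_block H_cts l omega0.
(* The estimates concern tori of size N + 1. With the size abstracted as M, the final index shift
   applies and size 0 is left out. *)
have : \forall N \near \oo, (fun M : nat => (('E_(P M)[fun w =>
    `| \int[lebesgue_measure]_(t in `[0%R, T])
         ((M ^ d)%:R^-1 * \sum_(x : torus d M) H (t, torus_point x) *
            (g (eta M t w x)
             - Phi g (min_rho_c g (block_average l (eta M t w) x)))) |%R]) <= e%:E)%E) N.+1.
  apply: filterS2 OB TF => N OBN TFN.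
  have := OBN (mu0 N.+1) _ _ (P N.+1) (eta N.+1) T C0 B omega
    (fun t x => H (t, torus_point x)) (HC0 N.+1 isT) (zrp N.+1 isT) T_gt0
    (fun t x => HB t _) TFN.
  rewrite cardE => /le_trans; apply; rewrite lee_fin.
  have -> : T * (G * omega) = e / 4.
    by rewrite /omega; field; rewrite !gt_eqF.
  have E1 : B * (C0 / (2 * gam)) = e / 4 * (B * C0 / (B * C0 + 1)).
    by rewrite /gam; field; rewrite !gt_eqF.
  have E2 : B * (2 * eps * T) = e / 4 * (B / (B + 1)).
    by rewrite /eps; field; rewrite !gt_eqF.
  have E3 : B * (T * (G / (A%:R * theta) * (C0 + q))) = k / (A%:R * theta).
    by rewrite /k; move: (_^-1) => y; ring.
  rewrite (mulrDr B) (mulrDr B) E1 E2 E3.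
  have h1 : e / 4 * (B * C0 / (B * C0 + 1)) <= e / 4.
    by rewrite ler_piMr ?divr_ge0 ?(ltW e0)// ler_pdivrMr// mul1r lerDl.
  have h2 : e / 4 * (B / (B + 1)) <= e / 4.
    by rewrite ler_piMr ?divr_ge0 ?(ltW e0)// ler_pdivrMr// mul1r lerDl.
  move: (e / 4 * _) (e / 4 * _) (k / _) h1 h2 kA => x1 x2 x3 h1 h2 h3.
  have E4 : e / 4 + (e / 4 + e / 4 + e / 4) = e by field.
  by rewrite -[leRHS]E4 !lerD.
by move=> [N0 _ HN0]; exists N0.+1 => // -[//|N] /= NN0; exact: HN0.
Qed.
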